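(* Let $\varepsilon>0$ be fixed and let $\bar\Psi_{\Delta t}^\rho,\bar S_{\Delta t}^\rho,\hat S_{\Delta t}^\rho$, $\rho\in\{m_1,m_2,f\}$, be the interpolations in time of the solutions of the time-discrete problems, as defined in the context. Let $\Psi_\rho\in L^2(0,T;\mathcal V_\rho)$ be limits along a sequence $\Delta t\to0$ such that, for each $\rho$, $\hat S_{\Delta t}^\rho\to S_\rho(\Psi_\rho)$, $\bar S_{\Delta t}^\rho\to S_\rho(\Psi_\rho)$ and $\bar\Psi_{\Delta t}^\rho\to\Psi_\rho$ strongly in $L^2(0,T;L^2(\Omega_\rho))$, and $\bar\Psi_{\Delta t}^\rho\rightharpoonup\Psi_\rho$ weakly in $L^2(0,T;\mathcal V_\rho)$. Then $(\Psi_{m_1},\Psi_{m_2},\Psi_f)$ is a weak solution to Problem $\mathcal P_\varepsilon$, i.e. $\Psi_{m_j}=\Psi_f$ on $\Gamma_j$ ($j=1,2$) for a.e. $t\in[0,T]$ in the sense of traces, and $$-\sum_{j=1}^2(S_m(\Psi_{m_j}),\partial_t\phi_{m_j})_{\Omega_{m_j}^T}-\varepsilon^\kappa(S_f(\Psi_f),\partial_t\phi_f)_{\Omega_f^T}+\sum_{j=1}^2(K_m(S_m(\Psi_{m_j}))\nabla\Psi_{m_j},\nabla\phi_{m_j})_{\Omega_{m_j}^T}+\varepsilon^\lambda(K_f(S_f(\Psi_f))\nabla\Psi_f,\nabla\phi_f)_{\Omega_f^T}$$ $$=\sum_{j=1}^2(f_{m_j},\phi_{m_j})_{\Omega_{m_j}^T}+(f_f,\phi_f)_{\Omega_f^T}+\sum_{j=1}^2(S_m(\psi_{m_j,I}),\phi_{m_j}(0))_{\Omega_{m_j}}+\varepsilon^\kappa(S_f(\psi_{f,I}),\phi_f(0))_{\Omega_f}$$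 for all $(\phi_{m_1},\phi_{m_2},\phi_f)\in W^{1,2}(0,T;\mathcal V_{m_1})\times W^{1,2}(0,T;\mathcal V_{m_2})\times W^{1,2}(0,T;\mathcal V_f)$ with $\phi_{m_j}=\phi_f$ on $\Gamma_j$ for a.e. $t$ ($j=1,2$) and $\phi_\rho(T)=0$ for $\rho\in\{m_1,m_2,f\}$.
   Context: **Setting.** Fix $\varepsilon>0$, $\kappa\in\mathbb R$, $\lambda<1$, $T>0$. $\Omega_{m_1}=(-1-\frac\varepsilon2,-\frac\varepsilon2)\times(0,1)$, $\Omega_{m_2}=(\frac\varepsilon2,1+\frac\varepsilon2)\times(0,1)$, $\Omega_f=(-\frac\varepsilon2,\frac\varepsilon2)\times(0,1)$, $\Gamma_1=\{-\frac\varepsilon2\}\times(0,1)$, $\Gamma_2=\{\frac\varepsilon2\}\times(0,1)$. $\mathcal V_{m_j}=\{u\in W^{1,2}(\Omega_{m_j}):u=0\text{ on }\partial\Omega_{m_j}\setminus\Gamma_j\}$, $\mathcal V_f=\{u\in W^{1,2}(\Omega_f):u=0\text{ on }\partial\Omega_f\setminus(\Gamma_1\cup\Gamma_2)\}$. The index $\rho$ ranges over $\{m_1,m_2,f\}$; $S_{m_1}=S_{m_2}=S_m$, $K_{m_1}=K_{m_2}=K_m$. $(\cdot,\cdot)_D$ is the $L^2(D)$ inner product and $(\cdot,\cdot)_{D^T}$ that of $L^2(0,T;L^2(D))$. **Assumptions.** $f_\rho\in C([0,T];L^2(\Omega_\rho))$, $|f_\rho|\le M_f$ a.e.; $S_\rho\in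 C^1(\mathbb R)$, $S_\rho(0)=0$, $0<m_S\le S_\rho'\le M_S$ on $\mathbb R$; $K_\rho\in C^1(\mathbb R)$, $K_\rho'>0$, $0<m_K\le K_\rho<M_K$ on $\mathbb R$; $|\psi_{\rho,I}|\le M_\rho$ a.e. in $\Omega_\rho$ and $\psi_{\rho,I}\in\mathcal V_\rho$. **Problem $\mathcal P_\varepsilon$** (strong form): Richards' equations $\partial_tS_m(\psi_{m_j})-\nabla\cdot(K_m(S_m(\psi_{m_j}))\nabla\psi_{m_j})=f_{m_j}$ in the blocks and $\partial_t(\varepsilon^\kappa S_f(\psi_f))-\nabla\cdot(\varepsilon^\lambda K_f(S_f(\psi_f))\nabla\psi_f)=f_f$ in the fracture, with continuity of pressure head and normal flux on $\Gamma_1,\Gamma_2$ and initial data $\psi_{\rho,I}$. **Time-discrete problems.** $\Delta t=T/N$, $N\in\mathbb N$, $t_k=k\Delta t$, $\psi_\rho^0=\psi_{\rho,I}$, $f_\rho^k=f_\rho(t_k)$. For $k=1,\dots,N$, $(\psi_{m_1}^k,\psi_{m_2}^k,\psi_f^k)\in\mathcal V_{m_1}\times\mathcal V_{m_2}\times\mathcal V_f$ satisfies $\psi_{m_j}^k=\psi_f^k$ on $\Gamma_j$ (traces) and $$\sum_j(S_m(\psi_{m_j}^k)-S_m(\psi_{m_j}^{k-1}),\phi_{m_j})_{\Omega_{m_j}}+\varepsilon^\kappa(S_f(\psi_f^k)-S_f(\psi_f^{k-1}),\phi_f)_{\Omega_f}+\Delta t\sum_j(K_m(S_m(\psi_{m_j}^k))\nabla\psi_{m_j}^k,\nabla\phi_{m_j})_{\Omega_{m_j}}$$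 $$+\varepsilon^\lambda\Delta t(K_f(S_f(\psi_f^k))\nabla\psi_f^k,\nabla\phi_f)_{\Omega_f}=\Delta t\sum_j(f_{m_j}^k,\phi_{m_j})_{\Omega_{m_j}}+\Delta t(f_f^k,\phi_f)_{\Omega_f}$$ for all $(\phi_{m_1},\phi_{m_2},\phi_f)\in\mathcal V_{m_1}\times\mathcal V_{m_2}\times\mathcal V_f$ with $\phi_{m_j}=\phi_f$ on $\Gamma_j$. **Interpolations.** For $t\in(t_{k-1},t_k]$: $\bar\Psi_{\Delta t}^\rho(t)=\psi_\rho^k$, $\bar S_{\Delta t}^\rho(t)=S_\rho(\psi_\rho^k)$, $\hat S_{\Delta t}^\rho(t)=S_\rho(\psi_\rho^{k-1})+\frac{t-t_{k-1}}{\Delta t}(S_\rho(\psi_\rho^k)-S_\rho(\psi_\rho^{k-1}))$. *)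

(* Defs.v *)
From HB Require Import structures.
From mathcomp Require Import all_boot all_order all_algebra.
From mathcomp Require Import all_classical all_reals all_analysis.

Set Implicit Arguments.
Unset Strict Implicit.
Unset Printing Implicit Defensive.

Import Order.TTheory GRing.Theory Num.Theory.
Import numFieldNormedType.Exports.

Local Open Scope classical_set_scope.
Local Open Scope ring_scope.

(* Elements of L^2, W^{1,2} and of the Bochner spaces below are represented by
   functions; equality of elements is almost-everywhere equality. *)

Section Smooth.
Context {R : realType}.
Implicit Types (eta : R -> R) (f : R * R -> R).

Definition slice (i : bool) f (p : R * R) : R -> R :=
  fun r => if i then f (p.1, r) else f (r, p.2).

Definition coord (i : bool) (p : R * R) : R := if i then p.2 else p.1.

(* partial derivative: i = false is d/dx, i = true is d/dy *)
Definition pderiv (i : bool) f : R * R -> R :=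
  fun p => derive1 (slice i f p) (coord i p).

Definition smooth2 f : Prop := forall s : seq bool,
  let g := foldr pderiv f s in
  continuous g /\ forall i p, derivable (slice i g p) (coord i p) 1.

Definition test_fun2 (D : set (R * R)) f : Prop :=
  smooth2 f /\ exists K, [/\ compact K, K `<=` D & forall p, ~ K p -> f p = 0].

Definition smooth1 eta : Prop := forall n t, derivable (derive1n n eta) t 1.

Definition test_fun1 (T : R) eta : Prop :=
  smooth1 eta /\
  exists K, [/\ compact K, K `<=` `]0, T[ & forall t, ~ K t -> eta t = 0].

Definition C1 (g : R -> R) : Prop :=
  (forall x, derivable g x 1) /\ continuous (derive1 g).

End Smooth.

Section Sobolev.
Context {R : realType}.

Local Notation mu := (@lebesgue_measure R).
Definition mu2 := (@lebesgue_measure R \x @lebesgue_measure R)%E.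

Implicit Types (D : set (R * R)) (u v : R * R -> R).

Definition L2 D u : Prop :=
  measurable_fun D u /\ mu2.-integrable D (fun p => (u p ^+ 2)%:E).

Definition ip D u v : R := \int[mu2]_(p in D) (u p * v p).

Definition L2norm D u : R := Num.sqrt (ip D u u).

Definition is_weak_grad D u (g : (R * R -> R) * (R * R -> R)) : Prop :=
  [/\ L2 D g.1, L2 D g.2 &
   forall phi, test_fun2 D phi ->
     ip D u (pderiv false phi) = - ip D g.1 phi /\
     ip D u (pderiv true phi) = - ip D g.2 phi].

Definition W12 D u : Prop := L2 D u /\ exists g, is_weak_grad D u g.

(* the weak gradient, unique almost everywhere in D when W12 D u *)
Definition wgrad D u : (R * R -> R) * (R * R -> R) :=
  xget ((fun=> 0), (fun=> 0)) (is_weak_grad D u).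

Definition W12norm D u : R :=
  Num.sqrt (L2norm D u ^+ 2 + L2norm D (wgrad D u).1 ^+ 2
            + L2norm D (wgrad D u).2 ^+ 2).

(* (c grad u, grad v)_D for a scalar coefficient c *)
Definition grad_ip D (c u v : R * R -> R) : R :=
  \int[mu2]_(p in D) (c p * ((wgrad D u).1 p * (wgrad D v).1 p
                           + (wgrad D u).2 p * (wgrad D v).2 p)).

Definition rect (a b : R) : set (R * R) := `]a, b[ `*` `]0, 1[.

Variant side := Left | Right | Bottom | Top.

Definition side_pt (a b : R) (s : side) (r : R) : R * R :=
  match s with
  | Left => (a, r) | Right => (b, r) | Bottom => (r, 0) | Top => (r, 1)
  end.

Definition side_dom (a b : R) (s : side) : set R :=
  match s with Left | Right => `]0, 1[ | Bottom | Top => `]a, b[ end.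

(* g, an element of L^2(boundary of rect a b) given side by side, is the trace
   of u: the trace operator is the continuous extension to W^{1,2} of the
   restriction to the boundary of functions that are smooth up to it. *)
Definition has_trace (a b : R) u (g : side -> R -> R) : Prop :=
  [/\ W12 (rect a b) u,
      forall s, measurable_fun (side_dom a b s) (g s) /\
        mu.-integrable (side_dom a b s) (fun r => (g s r ^+ 2)%:E) &
      exists w : nat -> R * R -> R,
      [/\ forall n, smooth2 (w n),
          W12norm (rect a b) (w n - u) @[n --> \oo] --> (0 : R) &
          forall s, (\int[mu]_(r in side_dom a b s)
             ((w n (side_pt a b s r) - g s r) ^+ 2)%:E)%E @[n --> \oo]
             --> 0%E]].

End Sobolev.

(* Bochner spaces over (0,T) with values in a linear space X of functions on
   R^2, seminormed by N. *)
Section Bochner.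
Context {R : realType}.
Variables (T : R) (X : set (R * R -> R)) (N : (R * R -> R) -> R).

Local Notation mu := (@lebesgue_measure R).
Local Notation E := (R * R -> R).
Implicit Types u v : R -> E.

Record simple := Simple {
  s_size : nat;
  s_set : 'I_s_size -> set R;
  s_val : 'I_s_size -> E;
  s_setP : forall i, measurable (s_set i);
  s_valP : forall i, X (s_val i) }.

Definition simple_fun (s : simple) : R -> E :=
  fun t p => \sum_(i < s_size s) \1_(s_set i) t * s_val i p.

Definition simple_int (s : simple) : E :=
  fun p => \sum_(i < s_size s) fine (mu (s_set i `&` `]0, T[)) * s_val i p.

(* Simple functions converge at every t in (0,T): every class of functions
   measurable in the almost-everywhere sense has such a representative, and
   these representatives form a linear space over the Borel sigma-algebra. *)
Definition strongly_measurable u : Prop :=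
  (forall t, 0 < t < T -> X (u t)) /\
  exists s : nat -> simple, forall t, 0 < t < T ->
    N (simple_fun (s n) t - u t) @[n --> \oo] --> (0 : R).

Definition L2T u : Prop :=
  strongly_measurable u /\
  mu.-integrable `]0, T[ (fun t => (N (u t) ^+ 2)%:E).

Definition L2Tnorm u : R := Num.sqrt (\int[mu]_(t in `]0, T[) (N (u t) ^+ 2)).

Definition is_Bochner_int u (I : E) : Prop :=
  [/\ strongly_measurable u, X I &
   exists s : nat -> simple,
     (\int[mu]_(t in `]0%R, T[) (N (simple_fun (s n) t - u t))%:E)%E
        @[n --> \oo] --> 0%E /\
     N (simple_int (s n) - I) @[n --> \oo] --> (0 : R)].

Definition is_weak_dt u v : Prop := forall eta, test_fun1 T eta ->
  exists I, is_Bochner_int (fun t p => derive1 eta t * u t p) I /\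
            is_Bochner_int (fun t p => eta t * v t p) (- I).

(* C([0,T]; X) *)
Definition CT u : Prop :=
  (forall t, 0 <= t <= T -> X (u t)) /\
  forall t e, 0 <= t <= T -> 0 < e -> exists2 d, 0 < d &
    forall s, 0 <= s <= T -> `|s - t| < d -> N (u s - u t) < e.

(* u in W^{1,2}(0,T;X) with weak time derivative v; the representative of u is
   the continuous one, so that u 0 and u T are its values at the end points. *)
Definition W12T u v : Prop := [/\ L2T u, L2T v, is_weak_dt u v & CT u].

Definition strong_cvg (un : nat -> R -> E) u : Prop :=
  (\int[mu]_(t in `]0%R, T[) (N (un n t - u t) ^+ 2)%:E)%E @[n --> \oo] --> 0%E.

Definition dual_L2T (l : (R -> E) -> R) : Prop :=
  (forall (a : R) u v, L2T u -> L2T v ->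
     l (fun t p => a * u t p + v t p) = a * l u + l v) /\
  exists C, forall u, L2T u -> `|l u| <= C * L2Tnorm u.

Definition weak_cvg (un : nat -> R -> E) u : Prop :=
  forall l, dual_L2T l -> l (un n) @[n --> \oo] --> l u.

End Bochner.

Section Problem.
Context {R : realType}.
Variables (eps kappa lambda T : R).

Local Notation mu := (@lebesgue_measure R).
Local Notation E := (R * R -> R).

Variant region := M1 | M2 | Fr.

Definition matfrac (A : Type) (am af : A) (rho : region) : A :=
  match rho with M1 | M2 => am | Fr => af end.

Definition xl (rho : region) : R :=
  match rho with
  | M1 => - 1 - eps / 2 | M2 => eps / 2 | Fr => - (eps / 2)
  end.

Definition xr (rho : region) : R :=
  match rho with
  | M1 => - (eps / 2) | M2 => 1 + eps / 2 | Fr => eps / 2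
  end.

Definition Omega (rho : region) : set (R * R) := rect (xl rho) (xr rho).

(* the sides of Omega rho contained in an interface Gamma_1 or Gamma_2 *)
Definition interface (rho : region) (s : side) : bool :=
  match rho, s with
  | M1, Right | M2, Left | Fr, Left | Fr, Right => true
  | _, _ => false
  end.

Definition VV (rho : region) (u : E) : Prop :=
  exists2 g, has_trace (xl rho) (xr rho) u g &
    forall s, ~~ interface rho s ->
      {ae mu, forall r, side_dom (xl rho) (xr rho) s r -> g s r = 0}.

Definition Vnorm (rho : region) : E -> R := W12norm (Omega rho).

Definition trace_eq (rho : region) (sm sf : side) (um uf : E) : Prop :=
  exists gm gf,
    [/\ has_trace (xl rho) (xr rho) um gm, has_trace (xl Fr) (xr Fr) uf gf &
        {ae mu, forall y, 0 < y < 1 -> gm sm y = gf sf y}].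

(* u_{m_1} = u_f on Gamma_1 and u_{m_2} = u_f on Gamma_2 *)
Definition coupled (u : region -> E) : Prop :=
  trace_eq M1 Right Left (u M1) (u Fr) /\ trace_eq M2 Left Right (u M2) (u Fr).

Variables (Sm Sf Km Kf : R -> R).
Local Notation S := (matfrac Sm Sf).
Local Notation K := (matfrac Km Kf).

Variables (f : region -> R -> E) (psiI : region -> E).

Definition data_hyp (mS MS mK MK Mf : R) (Mpsi : region -> R) : Prop :=
  [/\ forall rho, CT T (L2 (Omega rho)) (L2norm (Omega rho)) (f rho) /\
        {ae mu, forall t, 0 < t < T ->
           {ae mu2, forall p, Omega rho p -> `|f rho t p| <= Mf}},
      0 < mS /\ forall rho, [/\ C1 (S rho), S rho 0 = 0 &
        forall x, mS <= derive1 (S rho) x <= MS],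
      0 < mK /\ forall rho, [/\ C1 (K rho), forall x, 0 < derive1 (K rho) x &
        forall x, mK <= K rho x < MK] &
      forall rho, VV rho (psiI rho) /\
        {ae mu2, forall p, Omega rho p -> `|psiI rho p| <= Mpsi rho}].

Definition dt (N : nat) : R := T / N%:R.

Definition discrete_eq (N : nat) (psi psi' : region -> E) (t : R)
    (phi : region -> E) : Prop :=
  let dS rho := ip (Omega rho)
      (fun p => S rho (psi rho p) - S rho (psi' rho p)) (phi rho) in
  let A rho := grad_ip (Omega rho) (K rho \o (S rho \o psi rho))
                       (psi rho) (phi rho) in
  let b rho := ip (Omega rho) (f rho t) (phi rho) in
  (dS M1 + dS M2) + eps `^ kappa * dS Fr
    + dt N * (A M1 + A M2) + eps `^ lambda * dt N * A Fr
  = dt N * (b M1 + b M2) + dt N * b Fr.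

Definition discrete_sol (N : nat) (psi : region -> nat -> E) : Prop :=
  (forall rho, psi rho 0%N = psiI rho) /\
  forall k, (1 <= k <= N)%N ->
    [/\ forall rho, VV rho (psi rho k),
        coupled (psi ^~ k) &
        forall phi, (forall rho, VV rho (phi rho)) -> coupled phi ->
          discrete_eq N (psi ^~ k) (psi ^~ k.-1) (k%:R * dt N) phi].

(* the k such that t_{k-1} < t <= t_k, for t in (0,T] *)
Definition step (N : nat) (t : R) : nat := `|Num.ceil (t / dt N)|%N.

Definition Psi_bar (N : nat) (psi : nat -> E) : R -> E :=
  fun t => psi (step N t).

Definition S_bar (N : nat) (rho : region) (psi : nat -> E) : R -> E :=
  fun t => S rho \o psi (step N t).

Definition S_hat (N : nat) (rho : region) (psi : nat -> E) : R -> E :=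
  fun t p => let k := step N t in
    S rho (psi k.-1 p) + (t - k.-1%:R * dt N) / dt N
                         * (S rho (psi k p) - S rho (psi k.-1 p)).

(* inner product of L^2(0,T;L^2(Omega rho)) *)
Definition ipT (rho : region) (u v : R -> E) : R :=
  \int[mu]_(t in `]0, T[) ip (Omega rho) (u t) (v t).

Definition grad_ipT (rho : region) (c u v : R -> E) : R :=
  \int[mu]_(t in `]0, T[) grad_ip (Omega rho) (c t) (u t) (v t).

Definition weak_eq (Psi phi dphi : region -> R -> E) : Prop :=
  let B rho := ipT rho (fun t => S rho \o Psi rho t) (dphi rho) in
  let A rho := grad_ipT rho (fun t => K rho \o (S rho \o Psi rho t))
                        (Psi rho) (phi rho) in
  let b rho := ipT rho (f rho) (phi rho) in
  let b0 rho := ip (Omega rho) (S rho \o psiI rho) (phi rho 0) in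
  - (B M1 + B M2) - eps `^ kappa * B Fr + (A M1 + A M2) + eps `^ lambda * A Fr
  = (b M1 + b M2) + b Fr + (b0 M1 + b0 M2) + eps `^ kappa * b0 Fr.

Definition weak_solution (Psi : region -> R -> E) : Prop :=
  [/\ forall rho, L2T T (VV rho) (Vnorm rho) (Psi rho),
      {ae mu, forall t, 0 <= t <= T -> coupled (Psi ^~ t)} &
      forall phi dphi : region -> R -> E,
        (forall rho, W12T T (VV rho) (Vnorm rho) (phi rho) (dphi rho)) ->
        {ae mu, forall t, 0 <= t <= T -> coupled (phi ^~ t)} ->
        (forall rho, {ae mu2, forall p, Omega rho p -> phi rho T p = 0}) ->
        weak_eq Psi phi dphi].

End Problem.

(* Main.v *)
Require Import Defs.
From mathcomp Require Import all_boot all_order all_algebra.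
From mathcomp Require Import all_classical all_reals all_analysis.
From mathcomp Require Import measurable_realfun ring lra.
Import Order.TTheory GRing.Theory Num.Theory.
Import numFieldNormedType.Exports.
Local Open Scope classical_set_scope.
Local Open Scope ring_scope.

(* Test the k-th discrete equation, for t in (t_{k-1}, t_k], with phi(t),
   integrate over (0,T) and divide by the time step. Integration by parts on each
   step turns the difference quotient of S(psi) into minus the pairing of S_hat
   with the time derivative of phi, plus boundary terms; this requires the scalar
   integration by parts for t |-> (g, phi(t)), obtained from the definition of the
   weak time derivative. The time and source terms then pass to the limit by
   strong convergence. In the diffusion term the discrete heads are bounded in
   L^2(0,T;V): weak convergence against all continuous functionals gives this by
   a gliding hump. As K is bounded and uniformly continuous, the strong
   convergence of S_bar lets K(S_bar) be replaced by its limit, and what remains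
   is a continuous functional of the weakly convergent sequence.
   The coupling survives because the integral of a trace over {0 < y < c} is, by
   Green's formula, a scalar product of the function and its gradient with fixed
   weights: equality of these integrals passes to the weak limit on every
   measurable set of times, for every rational c. *)

Set Implicit Arguments.
Unset Strict Implicit.
Unset Printing Implicit Defensive.

(** * Integrals and scalar products *)

(** Three features of the setting shape the proof. [wgrad] is picked by choice, so gradients are
    linear only up to null sets in space: functions enter through their components [wcomp], and
    identities between these are used under integrals. Weak convergence comes without a bound; the
    functionals fed to the hump are normalized scalar products with the members of the sequence. The
    gradient of the test function is merely square integrable, and no almost everywhere convergent
    subsequence is extracted: the gradient is truncated at a level [r], and the uniform continuity
    of [K] is used as an error [e] plus a Lipschitz term, so that only $L^2$ norms occur.
    Measurability in time is carried by approximation with finitely valued functions, which survive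
    composition with any map. Testing with [phi t], not with a value on the grid, leaves the test
    function undiscretized, so the time term is an exact identity before the limit. The null set of
    times where coupling fails depends on the height [c] of the cut-off trace; rational heights keep
    these sets countable in number and still determine the trace. *)

Section RealIntegral.
Context d (T : measurableType d) (R : realType).
Variable mu : {measure set T -> \bar R}.
Variables (D : set T) (mD : measurable D).
Implicit Types f g : T -> R.

Definition rintegrable f : Prop := mu.-integrable D (EFin \o f).

Lemma rintegrable_measurable f : rintegrable f -> measurable_fun D f.
Proof. by move=> /measurable_int /measurable_EFinP. Qed.

Lemma rintegrable_eq f g : (forall x, D x -> f x = g x) ->
  rintegrable f -> rintegrable g.
Proof.
by move=> fg; apply: eq_integrable => // x /set_mem Dx /=; rewrite fg.
Qed.

Lemma Rint_eq f g : (forall x, D x -> f x = g x) ->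
  \int[mu]_(x in D) f x = \int[mu]_(x in D) g x.
Proof. by move=> fg; apply: eq_Rintegral => x /set_mem; exact: fg. Qed.

Lemma rintegrableD f g : rintegrable f -> rintegrable g ->
  rintegrable (fun x => f x + g x).
Proof. by move=> If Ig; exact: (integrableD mD If Ig). Qed.

Lemma rintegrableZ a f : rintegrable f -> rintegrable (fun x => a * f x).
Proof. by move=> If; exact: (integrableZl mD a If). Qed.

Lemma rintegrableB f g : rintegrable f -> rintegrable g ->
  rintegrable (fun x => f x - g x).
Proof. by move=> If Ig; exact: (integrableB mD If Ig). Qed.

Lemma rintegrable_le f g : measurable_fun D f ->
  (forall x, D x -> `|f x| <= g x) -> rintegrable g -> rintegrable f.
Proof.
move=> mf fg; apply: (le_integrable mD); first exact/measurable_EFinP.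
by move=> x Dx /=; rewrite lee_fin (le_trans (fg _ Dx)) // ler_norm.
Qed.

Lemma rintegrable_norm f : rintegrable f -> rintegrable (fun x => `|f x|).
Proof. by move=> If; exact: (integrable_norm If). Qed.

Lemma rintegrable_cst a : (mu D < +oo)%E -> rintegrable (fun=> a).
Proof.
move=> Dfin; apply: measurable_bounded_integrable => //.
by exists `|a|; split=> // M aM x _ /=; exact: ltW.
Qed.

Lemma rintegrable_sum (I : Type) (s : seq I) (F : I -> T -> R) :
  (forall i, rintegrable (F i)) ->
  rintegrable (fun x => \sum_(i <- s) F i x).
Proof.
move=> IF; elim: s => [|i s IHs].
  apply: (@rintegrable_eq (fun=> 0)); first by move=> x _; rewrite big_nil.
  exact: (integrable0 mu D).
have := rintegrableD (IF i) IHs; apply: rintegrable_eq => x _.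
by rewrite big_cons.
Qed.

Lemma Rint_sum (I : Type) (s : seq I) (F : I -> T -> R) :
  (forall i, rintegrable (F i)) ->
  \int[mu]_(x in D) (\sum_(i <- s) F i x) =
  \sum_(i <- s) \int[mu]_(x in D) F i x.
Proof.
move=> IF; elim: s => [|i s IHs].
  rewrite big_nil -[RHS](mul0r (fine (mu D))) -Rintegral_cst //.
  by apply: Rint_eq => x _; rewrite big_nil.
rewrite big_cons -IHs -RintegralD //.
- by apply: Rint_eq => x _; rewrite big_cons.
- exact: IF.
- exact: rintegrable_sum.
Qed.

Lemma Rint_le f g : rintegrable f -> rintegrable g ->
  (forall x, D x -> f x <= g x) ->
  \int[mu]_(x in D) f x <= \int[mu]_(x in D) g x.
Proof. exact: le_Rintegral. Qed.

Lemma Rint_norm_le f g : rintegrable f -> rintegrable g ->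
  (forall x, D x -> `|f x| <= g x) ->
  `|\int[mu]_(x in D) f x| <= \int[mu]_(x in D) g x.
Proof.
move=> If Ig fg; apply: (le_trans (le_normr_Rintegral mD If)).
exact: (Rint_le (rintegrable_norm If) Ig).
Qed.

Lemma Rint_ae_eq f g : rintegrable f -> measurable_fun D g ->
  {ae mu, forall x, D x -> f x = g x} ->
  \int[mu]_(x in D) f x = \int[mu]_(x in D) g x.
Proof.
move=> If mg fg; congr fine; apply: ae_eq_integral => //.
- exact: measurable_int If.
- exact/measurable_EFinP.
- by apply: filterS fg => x + Dx => ->.
Qed.

Lemma Rint_dominated (f_ : nat -> T -> R) f g :
  (forall n, measurable_fun D (f_ n)) ->
  (forall x, D x -> f_ n x @[n --> \oo] --> f x) ->
  (forall n x, D x -> `|f_ n x| <= g x) -> rintegrable g ->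
  rintegrable f /\
  \int[mu]_(x in D) f_ n x @[n --> \oo] --> \int[mu]_(x in D) f x.
Proof.
move=> mf ff fg Ig.
have mlim : measurable_fun D f by apply: measurable_fun_cvg ff.
have [||||If _ cf] := @dominated_convergence _ _ _ mu D mD
    (fun n => EFin \o f_ n) (EFin \o f) (EFin \o g) _ _ _ Ig.
- by move=> n; exact/measurable_EFinP.
- exact/measurable_EFinP.
- by apply: aeW => x Dx; apply: cvg_EFin; [exact: nearW|exact: ff].
- by apply: aeW => x n Dx /=; rewrite lee_fin fg.
split => //; apply: fine_cvg => /=; rewrite fineK //.
exact: (integrable_fin_num mD If).
Qed.

Lemma rintegrable_ge0_fin f : measurable_fun D f ->
  (forall x, D x -> 0 <= f x) ->
  (\int[mu]_(x in D) (f x)%:E < +oo)%E -> rintegrable f.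
Proof.
move=> mf f0 fi; apply/integrableP; split; first exact/measurable_EFinP.
rewrite (_ : integral _ _ _ = \int[mu]_(x in D) (f x)%:E)%E //.
by apply: eq_integral => x /set_mem Dx /=; rewrite ger0_norm // f0.
Qed.

Lemma Rint_indic (A : set T) f :
  \int[mu]_(x in D) (\1_A x * f x) = \int[mu]_(x in D `&` A) f x.
Proof.
rewrite Rintegral_mkcondr; apply: eq_Rintegral => x _.
by rewrite patchE indicE; case: ifP => _; rewrite ?mul1r ?mul0r.
Qed.

Lemma EFin_Rint f : rintegrable f ->
  (\int[mu]_(x in D) f x)%:E = (\int[mu]_(x in D) (f x)%:E)%E.
Proof. by move=> If; rewrite fineK //; exact: (integrable_fin_num mD If). Qed.

(* An extended integral tending to [0] is finite from some rank on only, hence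
   the "near" in the conclusion. *)
Lemma ereal_int_cvg0 (f_ : nat -> T -> R) :
  (forall n, measurable_fun D (f_ n)) ->
  (forall n x, D x -> 0 <= f_ n x) ->
  (\int[mu]_(x in D) (f_ n x)%:E)%E @[n --> \oo] --> 0%E ->
  (\forall n \near \oo, rintegrable (f_ n)) /\
  \int[mu]_(x in D) f_ n x @[n --> \oo] --> (0 : R).
Proof.
move=> mf f0 /fine_cvgP[fin cf]; split => //; apply: filterS fin => n fn.
by apply: rintegrable_ge0_fin => //; [exact: f0|rewrite ltey_eq fn].
Qed.

End RealIntegral.

Section SquareIntegrable.
Context d (T : measurableType d) (R : realType).
Variable mu : {measure set T -> \bar R}.
Variables (D : set T) (mD : measurable D).
Implicit Types u v w : T -> R.

Definition sqint u : Prop :=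
  measurable_fun D u /\ rintegrable mu D (fun x => u x ^+ 2).

Definition L2dot u v : R := \int[mu]_(x in D) (u x * v x).

Lemma sqintD u v : sqint u -> sqint v -> sqint (u + v).
Proof.
move=> [mu_ Iu] [mv Iv]; split; first exact: measurable_funD.
have : rintegrable mu D (fun x => 2 * u x ^+ 2 + 2 * v x ^+ 2).
  by apply: rintegrableD => //; exact: rintegrableZ.
apply: (rintegrable_le mD) => //.
  by apply: measurable_funX; exact: measurable_funD.
move=> x _; rewrite ger0_norm ?sqr_ge0 //.
have := sqr_ge0 (u x - v x); rewrite !fctE; nra.
Qed.

Lemma sqintZ a u : sqint u -> sqint (a *: u).
Proof.
move=> [mu_ Iu]; split; first by apply: (@measurable_funM _ _ _ _ (cst a) u).
have := rintegrableZ mD (a ^+ 2) Iu; apply: (rintegrable_eq mD) => x _.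
by rewrite exprMn.
Qed.

Lemma sqintB u v : sqint u -> sqint v -> sqint (u - v).
Proof. by move=> su sv; rewrite -scaleN1r; apply: sqintD => //; exact: sqintZ. Qed.

Lemma sqint_le u v : measurable_fun D u -> (forall x, D x -> `|u x| <= v x) ->
  sqint v -> sqint u.
Proof.
move=> mu_ uv [mv Iv]; split => //; apply: (rintegrable_le mD) Iv => //.
  exact: measurable_funX.
move=> x Dx; rewrite normrX; apply: lerXn2r; rewrite ?nnegrE ?uv //.
exact: le_trans (uv _ Dx).
Qed.

Lemma sqint_mul u v : sqint u -> sqint v -> rintegrable mu D (fun x => u x * v x).
Proof.
move=> [mu_ Iu] [mv Iv].
apply: (rintegrable_le mD _ _ (rintegrableD mD Iu Iv)).
  exact: measurable_funM.
move=> x _; rewrite ler_norml.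
have := sqr_ge0 (u x - v x); have := sqr_ge0 (u x + v x).
have := sqr_ge0 (u x); have := sqr_ge0 (v x); nra.
Qed.

Lemma dotC u v : L2dot u v = L2dot v u.
Proof. by apply: Rint_eq => x _; rewrite mulrC. Qed.

Lemma dotDl u v w : sqint u -> sqint v -> sqint w ->
  L2dot (u + v) w = L2dot u w + L2dot v w.
Proof.
move=> su sv sw; rewrite /L2dot -RintegralD //; [|exact: sqint_mul..].
by apply: Rint_eq => x _; rewrite mulrDl.
Qed.

Lemma dotZl a u v : sqint u -> sqint v -> L2dot (a *: u) v = a * L2dot u v.
Proof.
move=> su sv; rewrite /L2dot -RintegralZl //; last exact: sqint_mul.
by apply: Rint_eq => x _; rewrite mulrA.
Qed.

Lemma dot_combl k u v w : sqint u -> sqint v -> sqint w ->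
  L2dot (k *: u + v) w = k * L2dot u w + L2dot v w.
Proof. by move=> su sv sw; rewrite (dotDl (sqintZ k su) sv sw) (dotZl k su sw). Qed.

Lemma dotBl u v w : sqint u -> sqint v -> sqint w ->
  L2dot (u - v) w = L2dot u w - L2dot v w.
Proof.
move=> su sv sw; rewrite -scaleN1r dotDl //; last exact: sqintZ.
by rewrite dotZl // mulN1r.
Qed.

Lemma dotDr u v w : sqint u -> sqint v -> sqint w ->
  L2dot w (u + v) = L2dot w u + L2dot w v.
Proof. by move=> *; rewrite dotC dotDl // !(dotC w). Qed.

Lemma dotZr a u v : sqint u -> sqint v -> L2dot u (a *: v) = a * L2dot u v.
Proof. by move=> *; rewrite dotC dotZl // dotC. Qed.

Lemma dotBr u v w : sqint u -> sqint v -> sqint w ->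
  L2dot w (u - v) = L2dot w u - L2dot w v.
Proof. by move=> *; rewrite dotC dotBl // !(dotC w). Qed.

Lemma dot_ge0 u : 0 <= L2dot u u.
Proof. by apply: Rintegral_ge0 => x _; rewrite -expr2 sqr_ge0. Qed.

Lemma dot_ae_eq u u' v v' : sqint u -> sqint u' -> sqint v -> sqint v' ->
  {ae mu, forall x, D x -> u x = u' x} ->
  {ae mu, forall x, D x -> v x = v' x} -> L2dot u v = L2dot u' v'.
Proof.
move=> su su' sv sv' uu' vv'; apply: Rint_ae_eq => //.
- exact: sqint_mul.
- by apply: measurable_funM; [case: su'|case: sv'].
- by apply: filterS2 uu' vv' => x + + Dx => -> // ->.
Qed.

(** The parameter [s] stays free: the inequality is integrated first and optimized afterwards by
    [young_opt], or [s] is used as a small weight. *)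
Lemma young (s a b : R) : 0 < s -> `|2 * (a * b)| <= s * a ^+ 2 + s^-1 * b ^+ 2.
Proof.
move=> s0; have s1 : s * s^-1 = 1 by rewrite mulfV // gt_eqF.
have h c : 0 <= s * (a + s^-1 * c) ^+ 2 by rewrite mulr_ge0 ?sqr_ge0 // ltW.
have e c : s * (a + s^-1 * c) ^+ 2 = s * a ^+ 2 + 2 * (a * c) + s^-1 * c ^+ 2.
  rewrite -[in RHS](mul1r (2 * _)) -{1}s1.
  rewrite (_ : s^-1 * c ^+ 2 = (s * s^-1) * (s^-1 * c ^+ 2)); last by rewrite s1 mul1r.
  by ring.
have := h b; have := h (- b); rewrite !e sqrrN mulrN => h1 h2.
by rewrite ler_norml; lra.
Qed.

Lemma dot_young (s : R) u v : 0 < s -> sqint u -> sqint v ->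
  `|2 * L2dot u v| <= s * L2dot u u + s^-1 * L2dot v v.
Proof.
move=> s0 su sv; rewrite /L2dot -!RintegralZl //; [|exact: sqint_mul..].
rewrite -RintegralD //; last 2 first.
- by apply: (rintegrableZ mD); exact: sqint_mul.
- by apply: (rintegrableZ mD); exact: sqint_mul.
apply: (Rint_norm_le mD).
- by apply: (rintegrableZ mD); exact: sqint_mul.
- by apply: (rintegrableD mD); apply: (rintegrableZ mD); exact: sqint_mul.
- by move=> x _; rewrite -!expr2 young.
Qed.

End SquareIntegrable.

(** The optimal parameter is [sqrt b / sqrt a]. If [a] or [b] is zero, a large or a small [s]
    contradicts [0 < c]. Every Cauchy-Schwarz inequality below, in space, in time and for the
    $W^{1,2}$ scalar product, is Young's inequality integrated and then optimized here. *)
Lemma young_opt (R : realType) (a b c : R) : 0 <= a -> 0 <= b ->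
  (forall s, 0 < s -> 2 * c <= s * a + s^-1 * b) ->
  c <= Num.sqrt a * Num.sqrt b.
Proof.
move=> a0 b0 h; have [c0|c0] := leP c 0.
  by rewrite (le_trans c0) // mulr_ge0 // sqrtr_ge0.
have [a1|] := ltP 0 a; last first.
  move=> a1; have {a0 a1} a0 : a = 0 by apply/eqP; rewrite eq_le a1 a0.
  have s0 : 0 < (b + 1) / c by rewrite divr_gt0 // ltr_pwDr.
  have := h _ s0; rewrite a0 mulr0 add0r invf_div.
  have b1 : 0 < b + 1 by rewrite ltr_pwDr.
  have : c / (b + 1) * b <= c.
    by rewrite mulrAC -mulrA ler_piMr ?ltW // ltr_pdivrMr // mul1r ltrDl.
  set X := _ * b => h1 h2; by exfalso; move: h1 h2 c0; rewrite /X; lra.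
have [b1|] := ltP 0 b; last first.
  move=> b1; have {b0 b1} b0 : b = 0 by apply/eqP; rewrite eq_le b1 b0.
  have := h (c / a) (divr_gt0 c0 a1).
  by rewrite b0 mulr0 addr0 divfK ?gt_eqF // => hc; exfalso; move: hc c0; lra.
pose x := Num.sqrt a; pose y := Num.sqrt b.
have x0 : 0 < x by rewrite sqrtr_gt0.
have y0 : 0 < y by rewrite sqrtr_gt0.
have ea : a = x ^+ 2 by rewrite sqr_sqrtr.
have eb : b = y ^+ 2 by rewrite sqr_sqrtr.
have := h (y / x) (divr_gt0 y0 x0); rewrite -/x -/y ea eb invf_div.
have -> : y / x * x ^+ 2 = x * y by field; rewrite gt_eqF.
have -> : x / y * y ^+ 2 = x * y by field; rewrite gt_eqF.
by lra.
Qed.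

Lemma dot_CS d (T : measurableType d) (R : realType)
    (mu : {measure set T -> \bar R}) (D : set T) (mD : measurable D)
    (u v : T -> R) : sqint mu D u -> sqint mu D v ->
  `|L2dot mu D u v| <= Num.sqrt (L2dot mu D u u) * Num.sqrt (L2dot mu D v v).
Proof.
move=> su sv; apply: young_opt; [exact: dot_ge0..|] => s s0.
by have := dot_young mD s0 su sv; rewrite normrM ger0_norm.
Qed.

(** * Limits of weighted scalar products *)

Section SequenceLimits.
Context {R : realType}.

(** Form suited to truncation: the level depends on [e], and once it is fixed the remaining error
    [y_] vanishes. *)
Lemma cvg0_eps (x_ : nat -> R) : (forall e, 0 < e -> exists2 y_ : nat -> R,
    y_ n @[n --> \oo] --> (0 : R) & \forall n \near \oo, `|x_ n| <= e + y_ n) ->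
  x_ n @[n --> \oo] --> (0 : R).
Proof.
move=> h; apply/cvgrPdist_le => e e0.
have e2 : 0 < e / 2 by rewrite divr_gt0.
have [y_ /cvgrPdist_le /(_ _ e2) y0 xy] := h _ e2.
near=> n; rewrite sub0r normrN.
have : `|x_ n| <= e / 2 + y_ n by near: n.
move/le_trans; apply; rewrite [leRHS](splitr e) lerD2l.
have : `|0 - y_ n| <= e / 2 by near: n.
by rewrite sub0r normrN; apply: le_trans; exact: ler_norm.
Unshelve. all: by end_near.
Qed.

Lemma cvg0_le (x_ y_ : nat -> R) : y_ n @[n --> \oo] --> (0 : R) ->
  (forall n, `|x_ n| <= y_ n) -> x_ n @[n --> \oo] --> (0 : R).
Proof.
move=> y0 xy; apply: cvg0_eps => e e0; exists y_ => //.
by apply: nearW => n; rewrite (le_trans (xy n)) // lerDr ltW.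
Qed.

Lemma sqrt_cvg0 (x_ : nat -> R) : x_ n @[n --> \oo] --> (0 : R) ->
  Num.sqrt (x_ n) @[n --> \oo] --> (0 : R).
Proof.
move=> x0; have s0 : Num.sqrt x @[x --> (0 : R)] --> (0 : R).
  by have := @sqrt_continuous R 0; rewrite /continuous_at sqrtr0.
exact: (cvg_comp _ _ x0 s0).
Qed.

Lemma sqrt_mul_cvg0 (a_ b_ : nat -> R) (B : R) : a_ n @[n --> \oo] --> (0 : R) ->
  (\forall n \near \oo, b_ n <= B) ->
  Num.sqrt (a_ n) * Num.sqrt (b_ n) @[n --> \oo] --> (0 : R).
Proof.
move=> a0 bB; apply: cvg0_eps => e e0.
exists (fun n => Num.sqrt (a_ n) * Num.sqrt B).
  by rewrite -(mul0r (Num.sqrt B)); apply: cvgMl; exact: sqrt_cvg0.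
apply: filterS bB => n bB; rewrite ger0_norm ?mulr_ge0 ?sqrtr_ge0 //.
rewrite (@le_trans _ _ (Num.sqrt (a_ n) * Num.sqrt B)) ?lerDr ?(ltW e0) //.
by rewrite ler_wpM2l ?sqrtr_ge0 // ler_wsqrtr.
Qed.

End SequenceLimits.

(** * Truncation and moduli of continuity *)

Section Truncation.
Context {R : realType}.

Definition clamp (p q x : R) : R := Num.max p (Num.min x q).

Lemma clamp_bounds p q x : p <= q -> p <= clamp p q x <= q.
Proof. by move=> pq; rewrite /clamp le_max lexx /= ge_max pq ge_min lexx orbT. Qed.

Lemma clamp_id p q x : p <= x <= q -> clamp p q x = x.
Proof. by move=> /andP[px xq]; rewrite /clamp min_l // max_r. Qed.

Lemma clamp_incr p q x y : x <= y -> 0 <= clamp p q y - clamp p q x <= y - x.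
Proof.
have h (a b c : R) : a <= b -> 0 <= Num.max c b - Num.max c a <= b - a.
  by move=> ab; case: (leP c a) => ca; case: (leP c b) => cb; lra.
have h' (a b c : R) : a <= b -> 0 <= Num.min b c - Num.min a c <= b - a.
  by move=> ab; case: (leP a c) => ca; case: (leP b c) => cb; lra.
move=> xy; have /andP[m0 m1] := h' _ _ q xy; rewrite subr_ge0 in m0.
have /andP[M0 M1] := h _ _ p m0.
by rewrite /clamp M0 (le_trans M1 m1).
Qed.

Lemma clamp_lip p q x y : `|clamp p q x - clamp p q y| <= `|x - y|.
Proof.
wlog xy : x y / x <= y.
  by move=> h; have [/h //|/ltW /h] := leP x y; rewrite distrC [`|y - x|]distrC.
have /andP[h1 h2] := clamp_incr p q xy.
by rewrite distrC ger0_norm // distrC ger0_norm // (le_trans h1).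
Qed.

(** The part of [x] outside [[-r, r]]. Unlike a cut by an indicator function it is 1-Lipschitz in
    [x], so composition with it preserves measurable curves in $L^2$. *)
Definition excess (r x : R) : R := x - clamp (- r) r x.

Lemma excess_lip r x y : 0 <= r -> `|excess r x - excess r y| <= `|x - y|.
Proof.
move=> r0; wlog xy : x y / x <= y.
  by move=> h; have [/h //|/ltW /h] := leP x y; rewrite distrC [`|y - x|]distrC.
have /andP[h1 h2] := clamp_incr (- r) r xy.
rewrite distrC [`|x - y|]distrC (ger0_norm (_ : 0 <= y - x)) ?subr_ge0 //.
by rewrite /excess ger0_norm; lra.
Qed.

Lemma excess0 r : 0 <= r -> excess r 0 = 0.
Proof.
by move=> r0; rewrite /excess clamp_id ?subrr // oppr_le0 r0.
Qed.

Lemma excess_le r x : 0 <= r -> `|excess r x| <= `|x|.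
Proof. by move=> r0; have := excess_lip x 0 r0; rewrite excess0 // !subr0. Qed.

Lemma excess_dist_le r x : 0 <= r -> `|x - excess r x| <= r.
Proof.
move=> r0; rewrite /excess opprB addrC subrK ler_norml.
by apply: clamp_bounds; lra.
Qed.

Lemma excess_cvg0 x : excess n%:R x @[n --> \oo] --> (0 : R).
Proof.
apply: cvg_near_cst; near=> n.
have : `|x| <= n%:R by near: n; exact: nbhs_infty_ger.
by rewrite ler_norml /excess => h; rewrite clamp_id // subrr.
Unshelve. all: by end_near.
Qed.

Lemma lip_continuous (h : R -> R) (L : R) :
  (forall x y, `|h x - h y| <= L * `|x - y|) -> continuous h.
Proof.
move=> hL x; apply/cvgrPdist_le => e e0.
have L0 : 0 < `|L| + 1 by rewrite ltr_wpDl.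
near=> y; rewrite (le_trans (hL _ _)) //.
have xy : `|x - y| <= e / (`|L| + 1).
  near: y; apply: cvgr_dist_le; [exact: cvg_id|by rewrite divr_gt0].
rewrite (@le_trans _ _ ((`|L| + 1) * `|x - y|)) //.
  by rewrite ler_wpM2r // (le_trans (ler_norm _)) // lerDl.
by rewrite mulrC -ler_pdivlMr.
Unshelve. all: by end_near.
Qed.

Lemma excess_measurable r : 0 <= r -> measurable_fun setT (excess r).
Proof.
move=> r0; apply: continuous_measurable_fun; apply: (@lip_continuous _ 1) => x y.
by rewrite mul1r excess_lip.
Qed.

End Truncation.

Section ModulusOfContinuity.
Context {R : realType}.

(** Boundedness and uniform continuity in a form that can be integrated: the bound is affine in
    [|x - y|], so no splitting of the domain according to the size of [|x - y|] is required. *)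
Definition almost_lip (kap : R -> R) (M : R) : Prop :=
  [/\ continuous kap, forall x, `|kap x| <= M &
   forall e, 0 < e -> exists2 C, 0 <= C &
     forall x y, `|kap x - kap y| <= e + C * `|x - y|].

Lemma almost_lip_cst (a : R) : almost_lip (fun=> a) `|a|.
Proof.
split=> // [|e e0]; first exact: cst_continuous.
by exists 0 => // x y; rewrite subrr normr0 mul0r addr0 ltW.
Qed.

End ModulusOfContinuity.

Section WeightedDot.
Context d (T : measurableType d) (R : realType).
Variable mu : {measure set T -> \bar R}.
Variables (Om : set T) (mOm : measurable Om) (finOm : (mu Om < +oo)%E).
Implicit Types u v w c : T -> R.

Local Notation sqi := (sqint mu Om).
Local Notation dot := (L2dot mu Om).

Definition sqcvg (u_ : nat -> T -> R) u : Prop :=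
  dot (u_ n - u) (u_ n - u) @[n --> \oo] --> (0 : R).

Definition wdot (c u v : T -> R) : R := \int[mu]_(x in Om) (c x * (u x * v x)).

Lemma wdotE c u v : wdot c u v = dot (fun x => c x * u x) v.
Proof. by apply: Rint_eq => x _; rewrite mulrA. Qed.

Lemma wdot1 u v : wdot (fun=> 1) u v = dot u v.
Proof. by apply: Rint_eq => x _; rewrite mul1r. Qed.

Lemma sqint_wmul c u M : measurable_fun Om c -> (forall x, Om x -> `|c x| <= M) ->
  sqi u -> sqi (fun x => c x * u x).
Proof.
move=> mc cM su; apply: (sqint_le mOm _ _ (sqintZ mOm M (u := fun x => `|u x|) _)).
- by apply: measurable_funM => //; case: su.
- by move=> x Ox /=; rewrite normrM ler_wpM2r // cM.
- case: su => mu_ Iu; split; first exact: measurableT_comp.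
  by apply: rintegrable_eq Iu => // x _; rewrite real_normK // num_real.
Qed.

Lemma dot_wmul_le c u M : measurable_fun Om c -> (forall x, Om x -> `|c x| <= M) ->
  sqi u -> dot (fun x => c x * u x) (fun x => c x * u x) <= M ^+ 2 * dot u u.
Proof.
move=> mc cM su; rewrite -RintegralZl //; last exact: sqint_mul.
apply: Rint_le => //.
- by apply: sqint_mul => //; apply: sqint_wmul cM su.
- by apply: rintegrableZ => //; exact: sqint_mul.
move=> x Ox; rewrite mulrACA -!expr2 ler_wpM2r ?sqr_ge0 //.
rewrite -(real_normK (num_real (c x))) lerXn2r // ?nnegrE ?cM //.
exact: le_trans (cM x Ox).
Qed.

Lemma wdot_CS c u v M : 0 <= M -> measurable_fun Om c ->
  (forall x, Om x -> `|c x| <= M) -> sqi u -> sqi v ->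
  `|wdot c u v| <= M * (Num.sqrt (dot u u) * Num.sqrt (dot v v)).
Proof.
move=> M0 mc cM su sv; rewrite wdotE.
have scu := sqint_wmul mc cM su.
rewrite (le_trans (dot_CS mOm scu sv)) // mulrA ler_wpM2r ?sqrtr_ge0 //.
rewrite (le_trans (ler_wsqrtr (dot_wmul_le mc cM su))) //.
by rewrite sqrtrM ?sqr_ge0 // sqrtr_sqr ger0_norm.
Qed.

Lemma dot_bounded_cvg (u_ : nat -> T -> R) u : (forall n, sqi (u_ n)) -> sqi u -> sqcvg u_ u ->
  \forall n \near \oo, dot (u_ n) (u_ n) <= 2 + 2 * dot u u.
Proof.
move=> su_ su /cvgr_lt /(_ 1 ltr01); apply: filterS => n un1.
have su' := sqintB mOm (su_ n) su.
have -> : u_ n = (u_ n - u) + u by rewrite subrK.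
move: un1 su'; move: (u_ n - u) => e e1 se.
rewrite (@le_trans _ _ (2 * dot e e + 2 * dot u u)) //.
  rewrite dotDl ?[dot e (_ + _)]dotDr ?[dot u (_ + _)]dotDr //; last exact: sqintD.
  have := dot_young mOm ltr01 se su; rewrite invr1 !mul1r (dotC _ _ u e).
  by rewrite ler_norml; set X := dot _ _; set Y := dot _ _; set Z := dot _ _; lra.
by rewrite lerD2r -[leRHS]mulr1 ler_pM2l // ltW.
Qed.

Lemma excess_int_cvg0 (w : T -> R) : rintegrable mu Om w ->
  \int[mu]_(x in Om) `|excess n%:R (w x)| @[n --> \oo] --> (0 : R).
Proof.
move=> Iw.
have mw := rintegrable_measurable Iw.
have me n : measurable_fun Om (fun x => `|excess n%:R (w x)|).
  apply: measurableT_comp => //.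
  by apply: measurableT_comp => //; exact: excess_measurable.
have h : forall x, Om x -> `|excess n%:R (w x)| @[n --> \oo] --> (0 : R).
  by move=> x _; rewrite -(normr0 R); apply: cvg_norm; exact: excess_cvg0.
have [|_] := Rint_dominated mOm me h _ (rintegrable_norm Iw).
  by move=> n x _; rewrite normr_id excess_le.
by rewrite Rintegral_cst // mul0r.
Qed.

Lemma comp_almost_lip_measurable kap M u : almost_lip kap M -> sqi u ->
  measurable_fun Om (fun x => kap (u x)).
Proof.
move=> [ck _ _] [mu_ _]; apply: measurableT_comp mu_.
exact: continuous_measurable_fun.
Qed.

(** As [g] is only integrable, it is split at a level [r]. The excess is small in $L^1$ and meets a
    factor at most [2 * M]; on the part bounded by [r] the modulus of [kap] turns the difference
    into the $L^2$ distance of [w_ n] and [w]. *)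
Lemma almost_lip_int_cvg0 kap M (w_ : nat -> T -> R) w (g : T -> R) : almost_lip kap M ->
  (forall n, sqi (w_ n)) -> sqi w -> sqcvg w_ w -> rintegrable mu Om g ->
  \int[mu]_(x in Om) ((kap (w_ n x) - kap (w x)) * g x) @[n --> \oo] --> (0 : R).
Proof.
move=> akap sw_ sw cw Ig; apply: cvg0_eps => e e0.
have [ck kM kl] := akap.
have M0 : 0 <= M by rewrite (le_trans _ (kM 0)).
have e2 : 0 < e / 2 by rewrite divr_gt0.
have M2 : 0 < 2 * M + 1 by lra.
have [r r0 hr] : exists2 r : R, 0 <= r &
    \int[mu]_(x in Om) `|excess r (g x)| <= e / 2 / (2 * M + 1).
  have /cvgrPdist_le /(_ _ (divr_gt0 e2 M2)) [n _ /(_ n (leqnn n))] :=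
    excess_int_cvg0 Ig.
  by rewrite /= sub0r normrN ger0_norm ?Rintegral_ge0 // => h; exists n%:R.
pose m := fine (mu Om).
have m0 : 0 <= m by rewrite fine_ge0.
have rm : 0 < r * m + 1 by rewrite ltr_wpDl // mulr_ge0.
(* [C] is chosen after [r]: the additive error of the modulus is multiplied by [r * m] upon
   integration. The [+ 1] keeps the divisor positive. *)
have [C C0 hC] := kl _ (divr_gt0 e2 rm).
have sqi1 : sqi (fun=> 1).
  by split; [exact: measurable_cst|exact: rintegrable_cst].
pose y_ n := (r * C) * (Num.sqrt (dot (w_ n - w) (w_ n - w)) * Num.sqrt (dot (fun=> 1) (fun=> 1))).
exists y_.
  rewrite -(mulr0 (r * C)); apply: cvgMr.
  by apply: (sqrt_mul_cvg0 cw); apply: nearW => n; exact: lexx.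
apply: nearW => n.
have mk : measurable_fun Om (fun x => kap (w_ n x) - kap (w x)).
  by apply: measurable_funB; apply: comp_almost_lip_measurable akap _.
have sd := sqintB mOm (sw_ n) sw.
have sabs : sqi (fun x => `|w_ n x - w x|).
  apply: (sqint_le mOm _ _ (sqintZ mOm 1 (u := fun x => `|w_ n x - w x|) _)) => //.
  - by apply: measurableT_comp => //; case: sd.
  - by move=> x _; rewrite /= normr_id fctE /GRing.scale /= mul1r.
  case: sd => md Id; split; first exact: measurableT_comp.
  by apply: rintegrable_eq Id => // x _; rewrite real_normK // num_real.
have I1 : rintegrable mu Om (fun x => `|w_ n x - w x|).
  apply: rintegrable_eq (sqint_mul mOm sabs sqi1) => // x _.
  by rewrite mulr1.
have Ie : rintegrable mu Om (fun x => `|excess r (g x)|).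
  apply: (rintegrable_le mOm _ _ (rintegrable_norm Ig)).
    apply: measurableT_comp => //; apply: measurableT_comp.
      exact: excess_measurable.
    exact: rintegrable_measurable Ig.
  by move=> x _; rewrite normr_id excess_le.
have Ib : rintegrable mu Om (fun x => 2 * M * `|excess r (g x)|
     + (r * (e / 2 / (r * m + 1)) + r * C * `|w_ n x - w x|)).
  apply: rintegrableD => //; first exact: rintegrableZ.
  by apply: rintegrableD => //; [exact: rintegrable_cst|exact: rintegrableZ].
have bnd x : Om x -> `|(kap (w_ n x) - kap (w x)) * g x| <=
    2 * M * `|excess r (g x)|
     + (r * (e / 2 / (r * m + 1)) + r * C * `|w_ n x - w x|).
  move=> _; rewrite normrM; set K := `|kap _ - _|.
  have K2 : K <= 2 * M.
    by rewrite (le_trans (ler_normB _ _)) // mulr2n mulrDl !mul1r lerD // kM.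
  have gs : `|g x| <= `|excess r (g x)| + r.
    rewrite -{1}(subrK (excess r (g x)) (g x)) addrC (le_trans (ler_normD _ _)) //.
    by rewrite lerD2l excess_dist_le.
  have h1 := ler_wpM2l (normr_ge0 (kap (w_ n x) - kap (w x))) gs.
  apply: (le_trans h1); rewrite mulrDr lerD //.
    by rewrite ler_wpM2r.
  by rewrite -(mulrA r C) -mulrDr mulrC ler_wpM2l // hC.
rewrite (le_trans (Rint_norm_le mOm _ Ib bnd)) //.
  apply: (rintegrable_le mOm _ bnd Ib); apply: measurable_funM => //.
  exact: rintegrable_measurable Ig.
rewrite RintegralD //; last 2 first.
- exact: rintegrableZ.
- by apply: rintegrableD => //; [exact: rintegrable_cst|exact: rintegrableZ].
rewrite RintegralD //; last 2 first.
- exact: rintegrable_cst.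
- exact: rintegrableZ.
rewrite Rintegral_cst // 2?RintegralZl // addrA lerD //.
  rewrite [leRHS](splitr e) lerD //.
    rewrite (le_trans (ler_wpM2l _ hr)) ?mulr_ge0 //.
    rewrite mulrCA ler_piMr ?ltW // ltr_pdivrMr // mul1r; lra.
  rewrite -/m mulrAC mulrCA ler_piMr ?ltW // ltr_pdivrMr // mul1r; lra.
rewrite /y_ -!mulrA ler_wpM2l // ler_wpM2l //.
have := dot_CS mOm sabs sqi1; rewrite {1}/dot.
under eq_Rintegral do rewrite mulr1.
rewrite ger0_norm; last by apply: Rintegral_ge0.
congr (_ <= Num.sqrt _ * _); apply: Rint_eq => x _.
by rewrite -!expr2 real_normK // num_real.
Qed.

(** Source of measurability in time: applied at each instant to finitely valued approximations, it
    shows that a weighted pairing of measurable curves is a pointwise limit of measurable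
    functions. *)
Lemma wdot_cvg kap M (w_ u_ v_ : nat -> T -> R) w u v : almost_lip kap M ->
  (forall n, sqi (w_ n)) -> sqi w -> sqcvg w_ w ->
  (forall n, sqi (u_ n)) -> sqi u -> sqcvg u_ u ->
  (forall n, sqi (v_ n)) -> sqi v -> sqcvg v_ v ->
  wdot (kap \o w_ n) (u_ n) (v_ n) @[n --> \oo] --> wdot (kap \o w) u v.
Proof.
move=> akap sw_ sw cw su_ su cu sv_ sv cv; apply/subr_cvg0.
have [ck kM kl] := akap.
have M0 : 0 <= M by rewrite (le_trans _ (kM 0)).
have mk w' : sqi w' -> measurable_fun Om (kap \o w').
  exact: comp_almost_lip_measurable akap.
have km w' x : Om x -> `|(kap \o w') x| <= M by rewrite /= kM.
have sdu n := sqintB mOm (su_ n) su.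
have sdv n := sqintB mOm (sv_ n) sv.
have Iw w' a b : sqi w' -> sqi a -> sqi b ->
    rintegrable mu Om (fun x => kap (w' x) * (a x * b x)).
  move=> sw' sa sb.
  have := sqint_mul mOm (sqint_wmul (mk _ sw') (@km w') sa) sb.
  by apply: rintegrable_eq => // x _; rewrite mulrA.
(* Telescoping: [u_ n] is replaced by [u], then [v_ n] by [v], and the weight last, when it meets
   the fixed integrable function [u * v]. *)
have -> : (fun n => wdot (kap \o w_ n) (u_ n) (v_ n) - wdot (kap \o w) u v)
  = (fun n => wdot (kap \o w_ n) (u_ n - u) (v_ n)
    + wdot (kap \o w_ n) (v_ n - v) u
    + \int[mu]_(x in Om) ((kap (w_ n x) - kap (w x)) * (u x * v x))).
  apply/funext => n.
  have I1 := Iw _ _ _ (sw_ n) (sdu n) (sv_ n).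
  have I2 := Iw _ _ _ (sw_ n) (sdv n) su.
  have I3 : rintegrable mu Om (fun x => (kap (w_ n x) - kap (w x)) * (u x * v x)).
    apply: rintegrable_eq (rintegrableB mOm (Iw _ _ _ (sw_ n) su sv)
      (Iw _ _ _ sw su sv)) => // x _.
    by rewrite mulrBl.
  rewrite /wdot -RintegralB //; [|exact: Iw..].
  rewrite -RintegralD // -RintegralD //; last exact: (rintegrableD mOm I1 I2).
  by apply: Rint_eq => x _; rewrite /= !fctE; ring.
have wcvg a_ b_ B : (forall n, sqi (a_ n)) -> (forall n, sqi (b_ n)) ->
    dot (a_ n) (a_ n) @[n --> \oo] --> (0 : R) ->
    (\forall n \near \oo, dot (b_ n) (b_ n) <= B) ->
    wdot (kap \o w_ n) (a_ n) (b_ n) @[n --> \oo] --> (0 : R).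
  move=> sa sb ca bB.
  apply: (@cvg0_le _ _ (fun n => M * (Num.sqrt (dot (a_ n) (a_ n)) *
      Num.sqrt (dot (b_ n) (b_ n))))).
    by rewrite -(mulr0 M); apply: cvgMr; apply: sqrt_mul_cvg0 ca bB.
  by move=> n; exact: (wdot_CS M0 (mk _ (sw_ n)) (@km (w_ n)) (sa n) (sb n)).
rewrite -[X in _ --> X](addr0 0) -[X in _ --> X + _](addr0 0).
apply: cvgD; last first.
  by apply: almost_lip_int_cvg0 akap _ _ cw _ => //; exact: sqint_mul.
apply: cvgD; first exact: (wcvg _ _ _ sdu sv_ cu (dot_bounded_cvg sv_ sv cv)).
by apply: (wcvg _ _ (dot u u) sdv _ cv); [|apply: nearW].
Qed.

End WeightedDot.

(** * Finitely valued functions of time *)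

Section FinitelyValued.
Context d (I : measurableType d).
Variables (D : set I) (mD : measurable D).

(** [V] carries no sigma-algebra, so measurability is asked of an index in a finite type. This makes
    the notion stable under composition with an arbitrary map, in particular with [wgrad] and with
    integrals. *)
Definition fin_valued (V : Type) (g : I -> V) : Prop :=
  exists (K : finType) (i : I -> K) (v : K -> V),
    (forall k, measurable (D `&` i @^-1` [set k])) /\
    forall t, D t -> g t = v (i t).

Lemma fin_valued_cst (V : Type) (a : V) : fin_valued (fun=> a).
Proof.
exists unit, (fun=> tt), (fun=> a); split=> // -[].
rewrite (_ : _ `&` _ = D) //; apply/seteqP; split => [t []//|t Dt]; by split.
Qed.

Lemma fin_valued_comp (V W : Type) (h : V -> W) (g : I -> V) :
  fin_valued g -> fin_valued (h \o g).
Proof.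
move=> [K [i [v [mi gv]]]]; exists K, i, (h \o v); split=> // t Dt /=.
by rewrite gv.
Qed.

Lemma fin_valued_pair (V W : Type) (g : I -> V) (h : I -> W) :
  fin_valued g -> fin_valued h -> fin_valued (fun t => (g t, h t)).
Proof.
move=> [K [i [v [mi gv]]]] [L [j [w [mj hw]]]].
exists (K * L)%type, (fun t => (i t, j t)), (fun k => (v k.1, w k.2)).
split=> [[k l]|t Dt] /=; last by rewrite gv // hw.
rewrite (_ : _ `&` _ = (D `&` i @^-1` [set k]) `&` (D `&` j @^-1` [set l])).
  exact: measurableI.
apply/seteqP; split => [t [Dt [<- <-]]|t [[Dt <-] [_ <-]]] //=.
Qed.

Lemma fin_valued2 (V W X : Type) (h : V -> W -> X) (g : I -> V) (g' : I -> W) :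
  fin_valued g -> fin_valued g' -> fin_valued (fun t => h (g t) (g' t)).
Proof.
by move=> fg fg'; apply: (fin_valued_comp (fun p => h p.1 p.2)
  (fin_valued_pair fg fg')).
Qed.

Lemma fin_valued_measurable (R : realType) (g : I -> R) :
  fin_valued g -> measurable_fun D g.
Proof.
move=> [K [i [v [mi gv]]]] _ Y mY.
rewrite (_ : _ `&` _ = \bigcup_(k in [set k | Y (v k)]) (D `&` i @^-1` [set k])).
  apply: fin_bigcup_measurable => //; exact: finite_finset.
apply/seteqP; split => [t [Dt /=]|t [k /= Yk [Dt ik]]].
  by rewrite gv // => Yv; exists (i t).
by split=> //=; rewrite gv // ik.
Qed.

Lemma fin_valued_bounded (R : realType) (g : I -> R) : fin_valued g ->
  exists M, forall t, D t -> `|g t| <= M.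
Proof.
move=> [K [i [v [mi gv]]]]; exists (\sum_k `|v k|) => t Dt; rewrite gv //.
by rewrite (bigD1 (i t)) //= lerDl sumr_ge0.
Qed.

Lemma fin_valued_integrable (R : realType) (nu : {measure set I -> \bar R})
    (g : I -> R) :
  (nu D < +oo)%E -> fin_valued g -> rintegrable nu D g.
Proof.
move=> finD fg; have [M gM] := fin_valued_bounded fg.
apply: (rintegrable_le mD (fin_valued_measurable fg) gM).
exact: rintegrable_cst.
Qed.

End FinitelyValued.

(** * Measurable curves of square-integrable functions *)

Section Curves.
Context d (T : measurableType d) (R : realType).
Variable mu : {measure set T -> \bar R}.
Variables (Om : set T) (mOm : measurable Om) (finOm : (mu Om < +oo)%E).
Context d' (I : measurableType d').
Variable nu : {measure set I -> \bar R}.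
Variables (D : set I) (mD : measurable D) (finD : (nu D < +oo)%E).
Implicit Types u v w : I -> T -> R.

Local Notation sqi := (sqint mu Om).
Local Notation dot := (L2dot mu Om).

(* strong measurability of [u : I -> L^2(Om)] *)
Definition curve u : Prop := exists g : nat -> I -> T -> R,
  (forall n, fin_valued D (g n)) /\
  forall t, D t -> [/\ sqi (u t), forall n, sqi (g n t) &
    sqcvg mu Om (g ^~ t) (u t)].

Lemma curve_sqint u t : curve u -> D t -> sqi (u t).
Proof. by move=> [g [_ h]] /h[]. Qed.

Lemma curve_fin_valued u : fin_valued D u -> (forall t, D t -> sqi (u t)) ->
  curve u.
Proof.
move=> fu su; exists (fun=> u); split=> // t Dt; split; [exact: su|by move=> _; exact: su|].
rewrite /sqcvg (_ : (fun _ => _) = cst 0); first exact: cvg_cst.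
apply/funext => n; rewrite subrr /L2dot /=.
by under eq_Rintegral do rewrite mulr0; rewrite Rintegral_cst // mul0r.
Qed.

Lemma curve_cst (a : T -> R) : sqi a -> curve (fun=> a).
Proof. by move=> sa; apply: curve_fin_valued => //; exact: fin_valued_cst. Qed.

Lemma curve_eq u v : (forall t, D t -> u t = v t) -> curve u -> curve v.
Proof.
by move=> uv [g [fg h]]; exists g; split=> // t Dt; rewrite -uv //; exact: h.
Qed.

Lemma sqint_lip (h : R -> R) (L : R) (a : T -> R) :
  (forall x y, `|h x - h y| <= L * `|x - y|) -> h 0 = 0 -> sqi a ->
  sqi (h \o a).
Proof.
move=> hL h0 sa.
have sna : sqi (fun x => `|a x|).
  case: sa => ma Ia; split; first exact: measurableT_comp.
  by apply: rintegrable_eq Ia => // x _; rewrite real_normK // num_real.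
apply: (sqint_le mOm _ _ (sqintZ mOm L sna)).
  apply: measurableT_comp; last by case: sa.
  by apply: continuous_measurable_fun; exact: lip_continuous hL.
by move=> x _ /=; have := hL (a x) 0; rewrite h0 !subr0.
Qed.

Lemma dot_lip_le (h : R -> R) (L : R) (a b : T -> R) :
  (forall x y, `|h x - h y| <= L * `|x - y|) -> h 0 = 0 -> sqi a -> sqi b ->
  dot ((h \o a) - (h \o b)) ((h \o a) - (h \o b)) <= L ^+ 2 * dot (a - b) (a - b).
Proof.
move=> hL h0 sa sb; have sab := sqintB mOm sa sb.
have sh := sqintB mOm (sqint_lip hL h0 sa) (sqint_lip hL h0 sb).
rewrite -RintegralZl //; last exact: sqint_mul.
apply: Rint_le => //; first exact: sqint_mul.
  by apply: rintegrableZ => //; exact: sqint_mul.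
move=> x _; rewrite -!expr2 -exprMn -real_normK ?num_real //.
rewrite -[leRHS]real_normK ?num_real // lerXn2r ?nnegrE //.
rewrite (le_trans (hL _ _)) // normrM ler_wpM2r //.
exact: ler_norm.
Qed.

Lemma curve_lip (h : R -> R) (L : R) u :
  (forall x y, `|h x - h y| <= L * `|x - y|) -> h 0 = 0 -> curve u ->
  curve (fun t => h \o u t).
Proof.
move=> hL h0 [g [fg cg]]; exists (fun n t => h \o g n t); split.
  by move=> n; exact: (fin_valued_comp (fun a => h \o a) (fg n)).
move=> t Dt; have [su sg gu] := cg t Dt; split.
- exact: sqint_lip su.
- by move=> n; exact: sqint_lip (sg n).
apply: (@cvg0_le _ _ (fun n => L ^+ 2 * dot (g n t - u t) (g n t - u t))).
  by rewrite -(mulr0 (L ^+ 2)); exact: cvgMr.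
by move=> n; rewrite ger0_norm ?dot_ge0 //; exact: dot_lip_le.
Qed.

Lemma dotD_le (a b : T -> R) : sqi a -> sqi b ->
  dot (a + b) (a + b) <= 2 * dot a a + 2 * dot b b.
Proof.
move=> sa sb; have sab := sqintD mOm sa sb.
rewrite dotDl // [dot a _]dotDr // [dot b _]dotDr // (dotC _ _ b a).
have := dot_young mOm ltr01 sa sb; rewrite invr1 !mul1r ler_norml.
by set X := dot _ _; set Y := dot _ _; set Z := dot _ _; lra.
Qed.

Lemma sqcvgD (a_ b_ : nat -> T -> R) (a b : T -> R) :
  (forall n, sqi (a_ n)) -> (forall n, sqi (b_ n)) -> sqi a -> sqi b ->
  sqcvg mu Om a_ a -> sqcvg mu Om b_ b ->
  sqcvg mu Om (fun n => a_ n + b_ n) (a + b).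
Proof.
move=> sa_ sb_ sa sb ca cb.
apply: (@cvg0_le _ _ (fun n => 2 * dot (a_ n - a) (a_ n - a)
    + 2 * dot (b_ n - b) (b_ n - b))).
  by rewrite -(addr0 0) -(mulr0 2); apply: cvgD; exact: cvgMr.
move=> n; rewrite ger0_norm ?dot_ge0 // opprD addrACA.
by apply: dotD_le; exact: sqintB.
Qed.

Lemma sqcvgZ (k : R) (a_ : nat -> T -> R) (a : T -> R) :
  (forall n, sqi (a_ n)) -> sqi a -> sqcvg mu Om a_ a ->
  sqcvg mu Om (fun n => k *: a_ n) (k *: a).
Proof.
move=> sa_ sa ca; apply: (@cvg0_le _ _ (fun n => k ^+ 2 * dot (a_ n - a) (a_ n - a))).
  by rewrite -(mulr0 (k ^+ 2)); exact: cvgMr.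
move=> n; have sd := sqintB mOm (sa_ n) sa.
rewrite ger0_norm ?dot_ge0 // -scalerBr dotZl //; last exact: sqintZ.
by rewrite dotZr // mulrA.
Qed.

Lemma curveD u v : curve u -> curve v -> curve (fun t => u t + v t).
Proof.
move=> [g [fg cg]] [h [fh ch]]; exists (fun n t => g n t + h n t); split.
  by move=> n; exact: (fin_valued2 (fun a b => a + b) (fg n) (fh n)).
move=> t Dt; have [su sg gu] := cg t Dt; have [sv sh hv] := ch t Dt; split.
- exact: sqintD.
- by move=> n; exact: sqintD.
- exact: sqcvgD.
Qed.

Lemma curveZ (k : R) u : curve u -> curve (fun t => k *: u t).
Proof.
move=> [g [fg cg]]; exists (fun n t => k *: g n t); split.
  by move=> n; exact: (fin_valued_comp (fun a => k *: a) (fg n)).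
move=> t Dt; have [su sg gu] := cg t Dt; split.
- exact: sqintZ.
- by move=> n; exact: sqintZ.
- exact: sqcvgZ.
Qed.

Lemma curveB u v : curve u -> curve v -> curve (fun t => u t - v t).
Proof.
move=> cu cv; apply: (@curve_eq (fun t => u t + (-1) *: v t)).
  by move=> t _; rewrite scaleN1r.
by apply: curveD => //; exact: curveZ.
Qed.

Lemma curve_wdot_measurable (kap : R -> R) (M : R) w u v : almost_lip kap M ->
  curve w -> curve u -> curve v ->
  measurable_fun D (fun t => wdot mu Om (kap \o w t) (u t) (v t)).
Proof.
move=> akap [f [ff cf]] [g [fg cg]] [h [fh ch]].
apply: (@measurable_fun_cvg _ _ _ D
    (fun n t => wdot mu Om (kap \o f n t) (g n t) (h n t))).
  move=> n; apply: fin_valued_measurable => //.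
  exact: (fin_valued2 (fun p c => wdot mu Om (kap \o p.1) p.2 c)
    (fin_valued_pair (ff n) (fg n)) (fh n)).
move=> t Dt; have [su sg gu] := cg t Dt; have [sv sh hv] := ch t Dt.
by have [sw sf fw] := cf t Dt; exact: wdot_cvg akap _ _ fw _ _ gu _ _ hv.
Qed.

Lemma curve_dot_measurable u v : curve u -> curve v ->
  measurable_fun D (fun t => dot (u t) (v t)).
Proof.
move=> cu cv; have := curve_wdot_measurable (almost_lip_cst 1) cu cu cv.
by apply: eq_measurable_fun => t _; rewrite wdot1.
Qed.

Definition curve2 u : Prop :=
  curve u /\ rintegrable nu D (fun t => dot (u t) (u t)).

Lemma curve2_eq u v : (forall t, D t -> u t = v t) -> curve2 u -> curve2 v.
Proof.
move=> uv [cu Iu]; split; first exact: curve_eq cu.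
by apply: rintegrable_eq Iu => // t Dt; rewrite uv.
Qed.

Lemma curve2_fin_valued u : fin_valued D u -> (forall t, D t -> sqi (u t)) ->
  curve2 u.
Proof.
move=> fu su; split; first exact: curve_fin_valued.
by apply: fin_valued_integrable => //; exact: (fin_valued_comp (fun a => dot a a) fu).
Qed.

Lemma curve2D u v : curve2 u -> curve2 v -> curve2 (fun t => u t + v t).
Proof.
move=> [cu Iu] [cv Iv]; have cuv := curveD cu cv; split => //.
apply: (rintegrable_le mD (curve_dot_measurable cuv cuv) _
  (rintegrableD mD (rintegrableZ mD 2 Iu) (rintegrableZ mD 2 Iv))).
move=> t Dt; rewrite ger0_norm ?dot_ge0 //.
by apply: dotD_le; exact: curve_sqint Dt.
Qed.

Lemma curve2Z (k : R) u : curve2 u -> curve2 (fun t => k *: u t).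
Proof.
move=> [cu Iu]; split; first exact: curveZ.
apply: rintegrable_eq (rintegrableZ mD (k * k) Iu) => // t Dt.
have su := curve_sqint cu Dt.
by rewrite dotZl ?dotZr ?mulrA //; exact: sqintZ.
Qed.

Lemma curve2B u v : curve2 u -> curve2 v -> curve2 (fun t => u t - v t).
Proof.
move=> cu cv; apply: (@curve2_eq (fun t => u t + (-1) *: v t)).
  by move=> t _; rewrite scaleN1r.
by apply: curve2D => //; exact: curve2Z.
Qed.

Lemma curve2_lip (h : R -> R) (L : R) u :
  (forall x y, `|h x - h y| <= L * `|x - y|) -> h 0 = 0 -> curve2 u ->
  curve2 (fun t => h \o u t).
Proof.
move=> hL h0 [cu Iu]; have chu := curve_lip hL h0 cu; split=> //.
apply: (rintegrable_le mD (curve_dot_measurable chu chu) _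
  (rintegrableZ mD (L ^+ 2) Iu)).
move=> t Dt; rewrite ger0_norm ?dot_ge0 //.
have su := curve_sqint cu Dt.
have s0 : sqi 0 by have := sqintZ mOm 0 su; rewrite scale0r.
have := dot_lip_le hL h0 su s0.
rewrite subr0 (_ : h \o 0 = 0) ?subr0 //.
by apply/funext => x /=.
Qed.

Lemma curve2_wdot_integrable (kap : R -> R) (M : R) w u v : almost_lip kap M ->
  curve w -> curve2 u -> curve2 v ->
  rintegrable nu D (fun t => wdot mu Om (kap \o w t) (u t) (v t)).
Proof.
move=> akap cw [cu Iu] [cv Iv]; have [_ kM _] := akap.
have M0 : 0 <= M by rewrite (le_trans _ (kM 0)).
apply: (rintegrable_le mD (curve_wdot_measurable akap cw cu cv) _
  (rintegrableZ mD M (rintegrableD mD Iu Iv))) => t Dt.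
have su := curve_sqint cu Dt; have sv := curve_sqint cv Dt.
have mk : measurable_fun Om (kap \o w t).
  exact: comp_almost_lip_measurable akap (curve_sqint cw Dt).
have km x : Om x -> `|(kap \o w t) x| <= M by rewrite /= kM.
rewrite (le_trans (wdot_CS mOm M0 mk km su sv)) //.
rewrite ler_wpM2l //.
have a0 := dot_ge0 mu Om (u t); have b0 := dot_ge0 mu Om (v t).
rewrite -{2}(sqr_sqrtr a0) -{2}(sqr_sqrtr b0).
have := sqr_ge0 (Num.sqrt (dot (u t) (u t)) - Num.sqrt (dot (v t) (v t))).
have := sqrtr_ge0 (dot (u t) (u t)); have := sqrtr_ge0 (dot (v t) (v t)).
by set x := Num.sqrt _; set y := Num.sqrt _; nra.
Qed.

Lemma curve2_dot_integrable u v : curve2 u -> curve2 v ->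
  rintegrable nu D (fun t => dot (u t) (v t)).
Proof.
move=> cu cv; have := curve2_wdot_integrable (almost_lip_cst 1) cu.1 cu cv.
by apply: rintegrable_eq => // t _; rewrite wdot1.
Qed.

Definition curve_dot u v : R := \int[nu]_(t in D) dot (u t) (v t).

Lemma cdot_ge0 u : 0 <= curve_dot u u.
Proof. by apply: Rintegral_ge0 => t _; exact: dot_ge0. Qed.

Lemma curve2_wdot_CS (kap : R -> R) (M : R) w u v : almost_lip kap M ->
  curve w -> curve2 u -> curve2 v ->
  `|\int[nu]_(t in D) wdot mu Om (kap \o w t) (u t) (v t)| <=
  M * (Num.sqrt (curve_dot u u) * Num.sqrt (curve_dot v v)).
Proof.
move=> akap cw cu cv; have [_ kM _] := akap.
have M0 : 0 <= M by rewrite (le_trans _ (kM 0)).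
have Iw := curve2_wdot_integrable akap cw cu cv.
(* Moving [M] under the root gives the product of two roots to which [young_opt] applies. *)
have -> : M * (Num.sqrt (curve_dot u u) * Num.sqrt (curve_dot v v)) =
    Num.sqrt (M ^+ 2 * curve_dot u u) * Num.sqrt (curve_dot v v).
  by rewrite sqrtrM ?sqr_ge0 // sqrtr_sqr ger0_norm // mulrA.
apply: young_opt; rewrite ?mulr_ge0 ?sqr_ge0 ?cdot_ge0 // => s s0.
have [Iu Iv] := (cu.2, cv.2).
have I1 := rintegrableZ mD (M ^+ 2) Iu.
have I2 := rintegrableZ mD s I1; have I3 := rintegrableZ mD s^-1 Iv.
rewrite /curve_dot -!RintegralZl // -RintegralD //.
rewrite -[2 * `|_|]ger0_norm ?mulr_ge0 // normrM normr_id -normrM -RintegralZl //.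
apply: Rint_norm_le => //; [exact: rintegrableZ|exact: rintegrableD|].
move=> t Dt.
have su := curve_sqint cu.1 Dt; have sv := curve_sqint cv.1 Dt.
have mk : measurable_fun Om (kap \o w t).
  exact: comp_almost_lip_measurable akap (curve_sqint cw Dt).
have km x : Om x -> `|(kap \o w t) x| <= M by rewrite /= kM.
rewrite wdotE (le_trans (dot_young mOm s0 (sqint_wmul mOm mk km su) sv)) //.
by rewrite lerD2r ler_wpM2l ?(ltW s0) //; exact: dot_wmul_le.
Qed.

Lemma cdot_CS u v : curve2 u -> curve2 v ->
  `|curve_dot u v| <= Num.sqrt (curve_dot u u) * Num.sqrt (curve_dot v v).
Proof.
move=> cu cv; have h := curve2_wdot_CS (almost_lip_cst 1) cu.1 cu cv.
have e : curve_dot u v = \int[nu]_(t in D) wdot mu Om (fun=> 1) (u t) (v t).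
  by apply: Rint_eq => t _; rewrite wdot1.
have alg (x y : R) : x <= `|1| * y -> x <= y by rewrite normr1 mul1r.
rewrite e; exact: (alg _ _ h).
Qed.

Lemma cdot_young (s : R) u v : 0 < s -> curve2 u -> curve2 v ->
  `|2 * curve_dot u v| <= s * curve_dot u u + s^-1 * curve_dot v v.
Proof.
move=> s0 cu cv; have Iuv := curve2_dot_integrable cu cv.
have [Iu Iv] := (cu.2, cv.2).
rewrite /curve_dot -!RintegralZl // -RintegralD //; try exact: rintegrableZ.
apply: Rint_norm_le => //; try exact: rintegrableZ.
  by apply: rintegrableD => //; exact: rintegrableZ.
by move=> t Dt; apply: dot_young => //; [exact: curve_sqint cu.1 Dt|exact: curve_sqint cv.1 Dt].
Qed.

Lemma cdotBl u v w : curve2 u -> curve2 v -> curve2 w ->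
  curve_dot (fun t => u t - v t) w = curve_dot u w - curve_dot v w.
Proof.
move=> cu cv cw; rewrite /curve_dot -RintegralB //; try exact: curve2_dot_integrable.
apply: Rint_eq => t Dt; rewrite dotBl //.
- exact: curve_sqint cu.1 Dt.
- exact: curve_sqint cv.1 Dt.
- exact: curve_sqint cw.1 Dt.
Qed.

Lemma cdot_cvg (u_ : nat -> I -> T -> R) u v : (forall n, curve2 (u_ n)) ->
  curve2 u -> curve2 v ->
  curve_dot (fun t => u_ n t - u t) (fun t => u_ n t - u t) @[n --> \oo] --> (0 : R) ->
  curve_dot (u_ n) v @[n --> \oo] --> curve_dot u v.
Proof.
move=> cu_ cu cv h; apply/subr_cvg0.
apply: (@cvg0_le _ _ (fun n =>
  Num.sqrt (curve_dot (fun t => u_ n t - u t) (fun t => u_ n t - u t)) *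
  Num.sqrt (curve_dot v v))).
  by apply: (sqrt_mul_cvg0 h); apply: nearW => n; exact: lexx.
move=> n; rewrite -cdotBl //; apply: cdot_CS => //; exact: curve2B.
Qed.

(** Dominated convergence twice: in space at each fixed time, then in time with the bound
    [dot (u t) (u t)]. *)
Lemma curve2_excess_cvg0 u : curve2 u ->
  curve_dot (fun t => excess n%:R \o u t) (fun t => excess n%:R \o u t)
    @[n --> \oo] --> (0 : R).
Proof.
move=> cu; have elip n := fun x y => @excess_lip R n%:R x y (ler0n _ n).
have elip1 n x y : `|excess n%:R x - excess n%:R y| <= 1 * `|x - y| :> R.
  by rewrite mul1r elip.
have e0 n : excess (n%:R : R) 0 = 0 by rewrite excess0.
have cn n := curve2_lip (elip1 n) (e0 n) cu.
have ele n t : D t -> dot (excess n%:R \o u t) (excess n%:R \o u t) <= dot (u t) (u t).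
  move=> Dt; have su := curve_sqint cu.1 Dt.
  apply: Rint_le => //; first by apply: sqint_mul => //; exact: sqint_lip (elip1 n) _ _.
    exact: sqint_mul.
  move=> x _ /=; rewrite -!expr2 -real_normK ?num_real //.
  by rewrite -[leRHS]real_normK ?num_real // lerXn2r ?nnegrE // excess_le.
have [|||_ h] := @Rint_dominated _ _ _ nu D mD
   (fun n t => dot (excess n%:R \o u t) (excess n%:R \o u t)) (fun=> 0)
   (fun t => dot (u t) (u t)) _ _ _ cu.2.
- by move=> n; apply: curve_dot_measurable; exact: (cn n).1.
- move=> t Dt; have su := curve_sqint cu.1 Dt.
  have [|||_] := @Rint_dominated _ _ _ mu Om mOm
    (fun n x => excess n%:R (u t x) * excess n%:R (u t x)) (fun=> 0) (fun x => u t x * u t x) _ _ _ (sqint_mul mOm su su).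
  + move=> n; have := (sqint_lip (elip1 n) (e0 n) su).1 => m1.
    exact: measurable_funM.
  + by move=> x _; rewrite -(mulr0 (0 : R)); apply: cvgM; exact: excess_cvg0.
  + move=> n x _; rewrite normrM; rewrite -[u t x * u t x]ger0_norm; last by rewrite -expr2 sqr_ge0.
    by rewrite normrM ler_pM // excess_le.
  by rewrite Rintegral_cst // mul0r.
- by move=> n t Dt; rewrite ger0_norm ?dot_ge0 // ele.
by move: h; rewrite Rintegral_cst // mul0r.
Qed.

(* Splits the weight difference as in
   [|dk a b| <= (s / 2) a^2 + (1 / (2 s)) (2 (2 M)^2 excess_r(b)^2 + 2 r^2 dk^2)]:
   the first term is small by the bound on [a], the second for [r] large, the
   third by convergence of [w_ n]. *)
Lemma weighted_limit (kap : R -> R) (M A : R) (w_ a_ : nat -> I -> T -> R) w b :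
  almost_lip kap M ->
  (forall n, curve2 (w_ n)) -> curve2 w ->
  (forall n, curve2 (a_ n)) -> curve2 b ->
  curve_dot (fun t => w_ n t - w t) (fun t => w_ n t - w t) @[n --> \oo] --> (0 : R) ->
  (forall n, curve_dot (a_ n) (a_ n) <= A) ->
  \int[nu]_(t in D) (wdot mu Om (kap \o w_ n t) (a_ n t) (b t)
     - wdot mu Om (kap \o w t) (a_ n t) (b t)) @[n --> \oo] --> (0 : R).
Proof.
move=> akap cw_ cw ca cb wcvg aA; have [ck kM kl] := akap.
have M0 : 0 <= M by rewrite (le_trans _ (kM 0)).
have A0 : 0 <= A by rewrite (le_trans _ (aA 0%N)) ?cdot_ge0.
apply: cvg0_eps => e e0.
(* The estimate ends with [2 * |X|] at most [e + e / 3 + e / 3 + c4 * W n]; this [s] makes the term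
   in [a_ n] contribute at most [e]. *)
pose s := e / (A + 1).
have A1 : 0 < A + 1 by rewrite ltr_wpDl.
have s0 : 0 < s by rewrite divr_gt0.
have sA : s * A <= e by rewrite /s mulrAC ler_pdivrMr // ler_wpM2l ?(ltW e0) // lerDl.
pose E r := curve_dot (fun t => excess r \o b t) (fun t => excess r \o b t).
have e3 : 0 < e / 3 by rewrite divr_gt0.
have M8 : 0 < s^-1 * (8 * M ^+ 2) + 1.
  by rewrite ltr_wpDl // mulr_ge0 ?invr_ge0 ?(ltW s0) // mulr_ge0 // sqr_ge0.
have [r r0 hr] : exists2 r : R, 0 <= r & E r <= e / 3 / (s^-1 * (8 * M ^+ 2) + 1).
  have /cvgrPdist_le /(_ _ (divr_gt0 e3 M8)) [n _ /(_ n (leqnn n))] :=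
    curve2_excess_cvg0 cb.
  by rewrite /= sub0r normrN ger0_norm ?cdot_ge0 // => h; exists n%:R.
pose m := fine (mu Om); pose m' := fine (nu D).
have m0 : 0 <= m by rewrite fine_ge0.
have m'0 : 0 <= m' by rewrite fine_ge0.
(* [Q] gathers all factors of [del ^+ 2] after integration in space and time. The constants are
   fixed in the order [s], [r], [del], [C]. *)
pose Q := s^-1 * (4 * r ^+ 2 * m * m').
have Q0 : 0 <= Q.
  by rewrite /Q mulr_ge0 ?invr_ge0 ?(ltW s0) // !mulr_ge0 // sqr_ge0.
have Q1 : 0 < Q + 1 by rewrite ltr_wpDl.
pose del := Num.sqrt (e / 3 / (Q + 1)).
have d0 : 0 < del by rewrite sqrtr_gt0 divr_gt0.
have dQ : Q * del ^+ 2 <= e / 3.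
  have h0 : 0 <= e / 3 / (Q + 1) by rewrite ltW // divr_gt0.
  by rewrite sqr_sqrtr // mulrCA ler_piMr ?(ltW e3) // ler_pdivrMr // mul1r lerDl.
have [C C0 hC] := kl _ d0.
pose W n := curve_dot (fun t => w_ n t - w t) (fun t => w_ n t - w t).
pose c4 := s^-1 * (4 * r ^+ 2 * C ^+ 2).
exists (fun n => c4 * W n); first by rewrite -(mulr0 c4); exact: cvgMr.
apply: nearW => n.
have elip1 x y : `|excess r x - excess r y| <= 1 * `|x - y| :> R.
  by rewrite mul1r excess_lip.
have cex := curve2_lip elip1 (excess0 r0) cb.
have cdw := curve2B (cw_ n) cw.
pose G t := s * dot (a_ n t) (a_ n t) + (s^-1 * (8 * M ^+ 2)
   * dot (excess r \o b t) (excess r \o b t)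
   + (s^-1 * (4 * r ^+ 2 * m * del ^+ 2)
   + c4 * dot (w_ n t - w t) (w_ n t - w t))).
have I1 := rintegrableZ mD s (ca n).2.
have I2 := rintegrableZ mD (s^-1 * (8 * M ^+ 2)) cex.2.
have I3 := rintegrable_cst mD (s^-1 * (4 * r ^+ 2 * m * del ^+ 2)) finD.
have I4 := rintegrableZ mD c4 cdw.2.
have I34 := rintegrableD mD I3 I4.
have I234 := rintegrableD mD I2 I34.
have IG : rintegrable nu D G by exact: (rintegrableD mD I1 I234).
have IF := rintegrableB mD (curve2_wdot_integrable akap (cw_ n).1 (ca n) cb)
  (curve2_wdot_integrable akap cw.1 (ca n) cb).
set X := \int[nu]_(t in D) _.
have XG : `|2 * X| <= \int[nu]_(t in D) G t.
  rewrite -RintegralZl //; apply: Rint_norm_le => //; first exact: rintegrableZ.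
  move=> t Dt.
  have sw := curve_sqint cw.1 Dt; have swn := curve_sqint (cw_ n).1 Dt.
  have sa := curve_sqint (ca n).1 Dt; have sb := curve_sqint cb.1 Dt.
  have sdw := sqintB mOm swn sw.
  pose dk x := kap (w_ n t x) - kap (w t x).
  have mdk : measurable_fun Om dk.
    by apply: measurable_funB; [exact: comp_almost_lip_measurable akap swn
      |exact: comp_almost_lip_measurable akap sw].
  have dkM x : Om x -> `|dk x| <= 2 * M.
    by move=> _; rewrite (le_trans (ler_normB _ _)) // mulr_natl mulr2n lerD.
  have sdkb := sqint_wmul mOm mdk dkM sb.
  have sdka := sqint_wmul mOm mdk dkM sa.
  have sadw : sqi (fun x => `|w_ n t x - w t x|).
    case: sdw => md Id; split; first exact: measurableT_comp.
    by apply: rintegrable_eq Id => // x _; rewrite real_normK // num_real.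
  have Iex := sqint_mul mOm (curve_sqint cex.1 Dt) (curve_sqint cex.1 Dt).
  have Idw := sqint_mul mOm sdw sdw.
  have wI (w' : T -> R) : sqi w' -> rintegrable mu Om (fun x => kap (w' x) * (a_ n t x * b t x)).
    move=> sw'.
    have km x : Om x -> `|(kap \o w') x| <= M by rewrite /= kM.
    have := sqint_mul mOm (sqint_wmul mOm (comp_almost_lip_measurable akap sw') km sa) sb.
    by apply: rintegrable_eq => // x _; rewrite mulrA.
  rewrite /wdot -RintegralB //; [|exact: wI..].
  rewrite (_ : \int[mu]_(x in Om) _ = dot (a_ n t) (fun x => dk x * b t x)); last first.
    by apply: Rint_eq => x _ /=; rewrite /dk; ring.
  rewrite (le_trans (dot_young mOm s0 sa sdkb)) // lerD2l.
  rewrite [leRHS](_ : _ = s^-1 * (8 * M ^+ 2 * dot (excess r \o b t) (excess r \o b t) +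
     (4 * r ^+ 2 * m * del ^+ 2 + 4 * r ^+ 2 * C ^+ 2 * dot (w_ n t - w t) (w_ n t - w t)))).
    2: by rewrite /c4; ring.
  rewrite ler_wpM2l ?invr_ge0 ?(ltW s0) //.
  pose H x := 8 * M ^+ 2 * (excess r (b t x) * excess r (b t x)) + (4 * r ^+ 2 * del ^+ 2
     + 4 * r ^+ 2 * C ^+ 2 * ((w_ n t x - w t x) * (w_ n t x - w t x))).
  have J1 := rintegrableZ mOm (8 * M ^+ 2) Iex.
  have J2 := rintegrable_cst mOm (4 * r ^+ 2 * del ^+ 2) finOm.
  have J3 := rintegrableZ mOm (4 * r ^+ 2 * C ^+ 2) Idw.
  have J23 := rintegrableD mOm J2 J3.
  have -> : 8 * M ^+ 2 * dot (excess r \o b t) (excess r \o b t) +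
     (4 * r ^+ 2 * m * del ^+ 2 + 4 * r ^+ 2 * C ^+ 2 * dot (w_ n t - w t) (w_ n t - w t))
     = \int[mu]_(x in Om) H x.
    rewrite RintegralD // RintegralD // // Rintegral_cst // 2?RintegralZl //.
    by rewrite -/m -/(dot _ _) [4 * r ^+ 2 * m * _]mulrAC.
  apply: Rint_le => //; [exact: sqint_mul|exact: (rintegrableD mOm J1 J23)|].
  move=> x Ox; rewrite /H.
  set g := excess r _; set y := w_ n t x - w t x.
  have h1 := dkM x Ox.
  have h2 : `|dk x| <= del + C * `|y| by exact: hC.
  have h3 : `|b t x| <= `|g| + r.
    rewrite -{1}(subrK g (b t x)) addrC (le_trans (ler_normD _ _)) //.
    by rewrite lerD2l excess_dist_le.
  rewrite -!expr2 -(real_normK (num_real (_ * b t x))) -(real_normK (num_real g))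
    -(real_normK (num_real y)) normrM.
  move: h1 h2 h3 (normr_ge0 (dk x)) (normr_ge0 (b t x)) (normr_ge0 g) (normr_ge0 y).
  set k := `|dk x|; set bb := `|b t x|; set gg := `|g|; set yy := `|y|.
  move=> h1 h2 h3 k0 b0 g0 y0.
  (* The weight difference is bounded by [2 * M] against the excess of [b], and by its modulus
     against the part of [b] bounded by [r]. *)
  have q1 : k * bb <= 2 * M * gg + r * (del + C * yy).
    rewrite (le_trans (ler_wpM2l k0 h3)) // mulrDr lerD //; first exact: ler_wpM2r.
    by rewrite mulrC ler_wpM2l.
  have q2 : (k * bb) ^+ 2 <= (2 * M * gg + r * (del + C * yy)) ^+ 2.
    by rewrite lerXn2r ?nnegrE ?mulr_ge0 // (le_trans _ q1) // mulr_ge0.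
  rewrite (le_trans q2) //.
  have := sqr_ge0 (2 * M * gg - r * (del + C * yy)).
  have := sqr_ge0 (r * (del - C * yy)).
  set p := M * gg; set q := r * del; set z := r * (C * yy).
  have -> : 2 * M * gg = 2 * p by rewrite /p mulrA.
  have -> : r * (del - C * yy) = q - z by rewrite mulrBr.
  have -> : r * (del + C * yy) = q + z by rewrite mulrDr.
  have -> : 8 * M ^+ 2 * gg ^+ 2 = 8 * p ^+ 2 by rewrite /p; ring.
  have -> : 4 * r ^+ 2 * del ^+ 2 = 4 * q ^+ 2 by rewrite /q; ring.
  have -> : 4 * r ^+ 2 * C ^+ 2 * yy ^+ 2 = 4 * z ^+ 2 by rewrite /z; ring.
  by nra.
have IGE : \int[nu]_(t in D) G t = s * curve_dot (a_ n) (a_ n) + (s^-1 * (8 * M ^+ 2) * E r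
    + (Q * del ^+ 2 + c4 * W n)).
  rewrite /G RintegralD // RintegralD // RintegralD // // Rintegral_cst // 3?RintegralZl //.
  - by congr (_ + (_ + (_ + _))); rewrite -/m' /Q; ring.
  - exact: cdw.2.
  - exact: cex.2.
  - exact: (ca n).2.
have : s^-1 * (8 * M ^+ 2) * E r <= e / 3.
  rewrite (le_trans (ler_wpM2l _ hr)) ?mulr_ge0 ?invr_ge0 ?sqr_ge0 ?(ltW s0) //.
  by rewrite mulrCA ler_piMr ?(ltW e3) // ler_pdivrMr // mul1r lerDl.
have : s * curve_dot (a_ n) (a_ n) <= e by rewrite (le_trans _ sA) // ler_wpM2l ?(ltW s0) // aA.
have W0 : 0 <= c4 * W n.
  by rewrite mulr_ge0 ?cdot_ge0 // /c4 mulr_ge0 ?invr_ge0 ?(ltW s0) // !mulr_ge0 ?sqr_ge0.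
move: XG; rewrite normrM ger0_norm // IGE.
move: (s * _) (s^-1 * _ * _) (Q * _) (c4 * _) (`|X|) W0 dQ => x1 x2 x3 x4 x5.
by move=> *; lra.
Qed.

End Curves.

(** * Bump functions and weak derivatives on an interval *)

Section Derivatives.
Context {R : realType}.
Implicit Types f g : R -> R.

Lemma is_derive1E f (x d : R) : is_derive x 1 f d -> derive1 f x = d.
Proof. by move=> h; rewrite derive1E; apply: derive_val. Qed.

Lemma derivable_is_derive f (x : R) : derivable f x 1 -> is_derive x 1 f (derive1 f x).
Proof. by move=> df; apply: DeriveDef => //; rewrite derive1E. Qed.

Lemma derivable_is_continuous f : (forall x : R, derivable f x 1) -> continuous f.
Proof. by move=> df x; apply: differentiable_continuous; exact/derivable1_diffP. Qed.

Lemma FTC_itv (F f : R -> R) (a b : R) : a <= b ->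
  (forall x : R, is_derive x 1 F (f x)) -> continuous f ->
  rintegrable lebesgue_measure `[a, b] f /\
  \int[lebesgue_measure]_(x in `[a, b]) f x = F b - F a.
Proof.
move=> ab dF cf.
have If : rintegrable lebesgue_measure `[a, b] f.
  apply: continuous_compact_integrable; first exact: segment_compact.
  exact: continuous_subspaceT.
split=> //; move: ab; rewrite le_eqVlt => /predU1P[<-|ab].
  by rewrite set_itv1 Rintegral_set1 subrr.
have cF : continuous F by apply: derivable_is_continuous => x; case: (dF x).
rewrite /Rintegral (@continuous_FTC2 _ f F) //.
- exact: continuous_subspaceT.
- split.
  + by move=> x _; case: (dF x).
  + exact/cvg_at_right_filter/cF.
  + exact/cvg_at_left_filter/cF.
- by move=> x _; apply: is_derive1E.
Qed.

Lemma FTC_itvoo (F f : R -> R) (a b : R) : a <= b ->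
  (forall x : R, is_derive x 1 F (f x)) -> continuous f ->
  rintegrable lebesgue_measure `]a, b[ f /\
  \int[lebesgue_measure]_(x in `]a, b[) f x = F b - F a.
Proof.
move=> ab dF cf; have [If <-] := FTC_itv ab dF cf.
have If' : rintegrable lebesgue_measure `]a, b[ f.
  by apply: (integrableS _ _ _ If) => //; exact: subset_itv_oo_cc.
split => //; rewrite Rintegral_itv_bndo_bndc // Rintegral_itv_obnd_cbnd //.
by apply: (integrableS _ _ _ If) => //; exact: subset_itv_oc_cc.
Qed.

(** Recursion on [derive1 f], with [f] varying, gives the induction for sums, products and affine
    changes of variable; [smooth1P] returns to iterated derivatives. *)
Fixpoint nderivable (n : nat) f : Prop :=
  if n is n'.+1 then (forall x : R, derivable f x 1) /\ nderivable n' (derive1 f)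
  else True.

Lemma nderivableW n f : nderivable n.+1 f -> nderivable n f.
Proof. by elim: n f => // n IHn f [df nf]; split=> //; exact: IHn. Qed.

Lemma smooth1P f : smooth1 f <-> forall n, nderivable n f.
Proof.
split=> [sf n|nf n].
  elim: n f sf => // n IHn f sf; split; first exact: (sf 0%N).
  by apply: IHn => k t; rewrite -derive1Sn; exact: sf.
elim: n f nf => [f nf t|n IHn f nf t]; first by have [df _] := nf 1%N.
by rewrite derive1Sn; apply: IHn => k; have [_] := nf k.+1.
Qed.

Lemma nderivableD n f g : nderivable n f -> nderivable n g ->
  nderivable n (fun x => f x + g x).
Proof.
elim: n f g => // n IHn f g [df nf] [dg ng]; split.
  by move=> x; exact: derivableD.
rewrite (_ : derive1 _ = fun x => derive1 f x + derive1 g x); first exact: IHn.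
apply/funext => x; apply: is_derive1E.
by have := derivable_is_derive (df x); have := derivable_is_derive (dg x);
  move=> ? ?; exact: is_deriveD.
Qed.

Lemma nderivableZ n (a : R) f : nderivable n f -> nderivable n (fun x => a * f x).
Proof.
elim: n f => // n IHn f [df nf]; split.
  by move=> x; exact: (@derivableZ _ _ _ f a).
rewrite (_ : derive1 _ = fun x => a * derive1 f x); first exact: IHn.
apply/funext => x; apply: is_derive1E.
by have := derivable_is_derive (df x) => ?; exact: (@is_deriveZ _ _ _ f a).
Qed.

Lemma nderivableM n f g : nderivable n f -> nderivable n g ->
  nderivable n (fun x => f x * g x).
Proof.
elim: n f g => // n IHn f g nf ng; have [df nf'] := nf; have [dg ng'] := ng.
split; first by move=> x; exact: derivableM.
rewrite (_ : derive1 _ = fun x => f x * derive1 g x + g x * derive1 f x).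
  apply: nderivableD; apply: IHn => //; exact: nderivableW.
apply/funext => x; apply: is_derive1E.
by have := derivable_is_derive (df x); have := derivable_is_derive (dg x);
  move=> ? ?; exact: is_deriveM.
Qed.

Lemma is_derive_affine f (a b x d : R) : is_derive (a * x + b) 1 f d ->
  is_derive x 1 (fun y => f (a * y + b)) (a * d).
Proof.
move=> fd; have ha : is_derive x 1 (fun y : R => a * y + b) a.
  apply: is_derive_eq; rewrite ?addr0; by rewrite /GRing.scale /= mulr1.
have -> : a * d = d *: a by rewrite /GRing.scale /= mulrC.
exact: (@is_derive1_comp _ f (fun y : R => a * y + b)).
Qed.

Lemma nderivable_affine n (a b : R) f : nderivable n f ->
  nderivable n (fun x => f (a * x + b)).
Proof.
elim: n f => // n IHn f [df nf]; have h (x : R) : is_derive x 1 (fun y => f (a * y + b))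
    (a * derive1 f (a * x + b)).
  by apply: is_derive_affine; exact: derivable_is_derive.
split; first by move=> x; case: (h x).
rewrite (_ : derive1 _ = fun x => a * derive1 f (a * x + b)).
  by apply: nderivableZ; exact: IHn.
by apply/funext => x; exact: is_derive1E.
Qed.

End Derivatives.

(** * Smooth functions flat at the origin *)

Section FlatFunctions.
Context {R : realType}.

(** [flat 0] is the classical $e^{-1/x}$ extended by zero. The factors $x^{-k}$ close the family
    under differentiation up to linear combinations, so one induction over all [k] gives
    smoothness. *)
Definition flat (k : nat) (x : R) : R :=
  if 0 < x then x^-1 ^+ k * expR (- x^-1) else 0.

(** For positive [k], the inequality [z <= expR z] at [z = y / k], raised to the power [k], whence
    the constant $k^k$. *)
Lemma expR_pow_le (k : nat) : exists2 C : R, 0 <= C &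
  forall y, 0 < y -> y ^+ k <= C * expR y.
Proof.
case: k => [|k].
  by exists 1 => // y y0; rewrite mul1r expr0 -expR0 ler_expR ltW.
exists (k.+1%:R ^+ k.+1) => [|y y0]; first by rewrite exprn_ge0.
have {1}-> : y = k.+1%:R * (y / k.+1%:R) by rewrite mulrCA divff ?mulr1 // pnatr_eq0.
rewrite exprMn ler_wpM2l ?exprn_ge0 //.
have {2}-> : y = k.+1%:R * (y / k.+1%:R) by rewrite mulrCA divff ?mulr1 // pnatr_eq0.
rewrite expRM_natl lerXn2r ?nnegrE ?expR_ge0 ?divr_ge0 ?(ltW y0) //.
by apply: le_trans (expR_ge1Dx _); rewrite lerDr.
Qed.

(** Growth of the exponential against the power [k + 2] of [1 / x]. The quadratic decay makes the
    difference quotient at the origin vanish. *)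
Lemma flat_le (k : nat) : exists2 C : R, 0 <= C &
  forall x, `|flat k x| <= C * x ^+ 2.
Proof.
have [C C0 hC] := expR_pow_le k.+2; exists C => // x.
rewrite /flat; case: ifPn => [x0|_]; last by rewrite normr0 mulr_ge0 ?sqr_ge0.
have y0 : 0 < x^-1 by rewrite invr_gt0.
rewrite ger0_norm ?mulr_ge0 ?expR_ge0 ?exprn_ge0 ?(ltW y0) //.
rewrite expRN ler_pdivrMr ?expR_gt0 //.
have := hC _ y0; rewrite -addn2 exprD => h.
have x2 : 0 < x ^+ 2 by rewrite exprn_gt0.
rewrite -(ler_pM2r (_ : 0 < (x^-1) ^+ 2)) ?exprn_gt0 //.
rewrite (le_trans h) // mulrAC -(mulrA C) -exprMn divff ?gt_eqF //.
by rewrite expr1n mulr1.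
Qed.

Lemma flat_derive (k : nat) (x : R) :
  is_derive x 1 (flat k) (flat k.+2 x - k%:R * flat k.+1 x).
Proof.
have [x0|x0|->] := ltgtP x 0.
- rewrite /flat !ltNge (ltW x0) /= mulr0 subr0.
  apply: (near_eq_is_derive (f := fun=> 0)).
    near=> y; rewrite ltNge ltW //=; near: y.
    by apply: lt_nbhsl.
- have x1 : x != 0 by rewrite gt_eqF.
  apply: (near_eq_is_derive (f := fun y : R => y^-1 ^+ k * expR (- y^-1))).
    near=> y; rewrite /flat ifT //; near: y.
    by apply: lt_nbhsr.
  have dV : is_derive x 1 (fun y : R => y^-1) (- x ^- 2).
    have := @is_deriveV R id x 1 1 x1 (is_derive_id _ _).
    by rewrite /GRing.scale /= mulr1.
  have dE : is_derive x 1 (fun y : R => expR (- y^-1)) (expR (- x^-1) * x ^- 2).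
    apply: (@is_derive1_comp _ expR (fun y => - y^-1)).
    by rewrite -[x ^- 2]opprK; exact: is_deriveN.
  rewrite /flat x0.
  have dX : is_derive x 1 (fun y : R => y^-1 ^+ k) (k%:R * x^-1 ^+ k.-1 * - x ^- 2).
    by have := is_deriveX k dV; rewrite exprfctE.
  have D := is_deriveM dX dE.
  rewrite [X in is_derive _ _ _ X](_ : _ = x^-1 ^+ k *: (expR (- x^-1) * x ^- 2)
    + expR (- x^-1) *: (k%:R * x^-1 ^+ k.-1 * - x ^- 2)); first exact: D.
  rewrite /GRing.scale /=; case: (k) => [|j] /=.
    by rewrite !mul0r mulr0 subr0 addr0 expr0 mul1r mulrC -exprVn.
  by rewrite -!exprVn; move: (x^-1) => y; rewrite !exprS; ring.
have f0 j : flat j 0 = 0 :> R by rewrite /flat ltxx.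
rewrite !f0 mulr0 subr0.
have [C C0 hC] := flat_le k.
have h : h^-1 *: ((flat k \o shift 0) (h *: 1) - flat k 0) @[h --> (0:R)^'] --> (0 : R).
  apply/cvgrPdist_le => e e0; near=> h.
  have h0 : h != 0 by near: h; exact: nbhs_dnbhs_neq.
  rewrite sub0r normrN /= f0 subr0 addr0 /GRing.scale /= mulr1 normrM normfV.
  have hh : 0 < `|h| by rewrite normr_gt0.
  rewrite mulrC ler_pdivrMr // (le_trans (hC _)) // -real_normK ?num_real //.
  rewrite expr2 mulrA ler_wpM2r //.
  have : `|h| <= e / (C + 1).
    near: h; apply: dnbhs0_le; rewrite divr_gt0 // ltr_wpDl //.
  rewrite ler_pdivlMr ?ltr_wpDl // => hC1; apply: (le_trans _ hC1).
  by rewrite mulrC ler_wpM2l // lerDl.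
apply: DeriveDef; first by apply/cvg_ex; exists 0.
exact: cvg_lim.
Unshelve. all: by end_near.
Qed.

Lemma nderivable_flat n k : nderivable n (flat k).
Proof.
elim: n k => // n IHn k; have h x := flat_derive k x.
split; first by move=> x; case: (h x).
rewrite (_ : derive1 _ = fun x => flat k.+2 x + (- k%:R) * flat k.+1 x).
  by apply: nderivableD => //; exact: nderivableZ.
by apply/funext => x; rewrite mulNr; exact: is_derive1E.
Qed.


Lemma flat_ge0 k x : 0 <= flat k x.
Proof.
rewrite /flat; case: ifPn => // x0.
by rewrite mulr_ge0 ?expR_ge0 // exprn_ge0 // invr_ge0 ltW.
Qed.

Lemma flat0_le1 x : flat 0 x <= 1.
Proof.
rewrite /flat; case: ifPn => // x0; rewrite expr0 mul1r -expR0 ler_expR.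
by rewrite oppr_le0 invr_ge0 ltW.
Qed.

Lemma flat_le0 k x : x <= 0 -> flat k x = 0.
Proof. by move=> x0; rewrite /flat ltNge x0. Qed.

Lemma flat0_gt0 x : 0 < x -> 0 < flat 0 x.
Proof. by move=> x0; rewrite /flat x0 expr0 mul1r expR_gt0. Qed.

(* smooth, supported in [[p + 1/n, q - 1/n]] and increasing to the indicator of
   the open interval [(p, q)] *)
Definition plateau (n : nat) (p q x : R) : R :=
  flat 0 (n.+1%:R * (x - p) - 1) * flat 0 (n.+1%:R * (q - x) - 1).

Lemma smooth1_plateau n p q : smooth1 (plateau n p q).
Proof.
apply/smooth1P => k; apply: nderivableM.
- rewrite (_ : (fun x => _) = (fun x => flat 0 (n.+1%:R * x + (- (n.+1%:R * p) - 1)))).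
    by apply: nderivable_affine; exact: nderivable_flat.
  by apply/funext => x; congr flat; ring.
- rewrite (_ : (fun x => _) = (fun x => flat 0 ((- n.+1%:R) * x + (n.+1%:R * q - 1)))).
    by apply: nderivable_affine; exact: nderivable_flat.
  by apply/funext => x; congr flat; ring.
Qed.

Lemma plateau_ge0 n p q x : 0 <= plateau n p q x.
Proof. by rewrite mulr_ge0 // flat_ge0. Qed.

Lemma plateau_le1 n p q x : plateau n p q x <= 1.
Proof. by rewrite mulr_ile1 ?flat_ge0 ?flat0_le1. Qed.

Lemma plateau_out n p q x : ~ [set` `[p + n.+1%:R^-1, q - n.+1%:R^-1]] x ->
  plateau n p q x = 0.
Proof.
move=> /=; rewrite in_itv /= => /negP; rewrite negb_and -!ltNge /plateau.
have n0 : 0 < n.+1%:R :> R by rewrite ltr0n.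
case/orP => h.
  rewrite [X in X * _](@flat_le0 0) ?mul0r //.
  rewrite subr_le0 mulrC -ler_pdivlMr // mul1r lerBlDl; exact: ltW.
rewrite [X in _ * X](@flat_le0 0) ?mulr0 //.
rewrite subr_le0 mulrC -ler_pdivlMr // mul1r lerBlDl -lerBlDr; exact: ltW.
Qed.

Lemma flat0_cvg (a : R) : flat 0 (n.+1%:R * a - 1) @[n --> \oo] -->
  (if 0 < a then 1 else 0 : R).
Proof.
case: ifPn => [a0|]; last first.
  rewrite -leNgt => a0; apply: cvg_near_cst; apply: nearW => n.
  by rewrite flat_le0 // subr_le0 (le_trans _ ler01) // mulr_ge0_le0.
have big : \forall n \near \oo, 2 / a <= n.+1%:R.
  near=> n; apply: (@le_trans _ _ n%:R); last by rewrite ler_nat.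
  by near: n; exact: nbhs_infty_ger.
have cy : (n.+1%:R * a - 1)^-1 @[n --> \oo] --> (0 : R).
  apply: cvg0_eps => e e0; exists (fun n => 2 / a * n.+1%:R^-1).
    by rewrite -(mulr0 (2 / a)); apply: cvgMr; exact: cvg_harmonic.
  apply: filterS big => n; rewrite ler_pdivrMr // => na.
  have n0 : 0 < n.+1%:R :> R by rewrite ltr0n.
  rewrite ger0_norm; last by rewrite invr_ge0; lra.
  apply: ler_wpDl; first exact: ltW.
  rewrite -[2 / a]invf_div -invfM lef_pV2 ?posrE ?mulr_gt0 ?divr_gt0 //; last lra.
  by rewrite mulrC mulrA; lra.
have : expR (- (n.+1%:R * a - 1)^-1) @[n --> \oo] --> (expR (- 0) : R).
  apply: continuous_cvg; first exact: continuous_expR.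
  exact: cvgN.
rewrite oppr0 expR0; apply: cvg_trans; apply: near_eq_cvg.
apply: filterS big => n; rewrite ler_pdivrMr // => na.
by rewrite /flat ifT ?expr0 ?mul1r //; lra.
Unshelve. all: by end_near.
Qed.

Lemma plateau_cvg p q x : plateau n p q x @[n --> \oo] --> (\1_(`]p, q[) x : R).
Proof.
have : plateau n p q x @[n --> \oo] -->
    ((if 0 < x - p then 1 else 0) * (if 0 < q - x then 1 else 0) : R).
  by apply: cvgM; exact: flat0_cvg.
rewrite indicE /= mem_setE in_itv /= !subr_gt0.
by case: ltP => _; case: ltP => _; rewrite ?mulr0 ?mul0r ?mulr1.
Qed.

End FlatFunctions.

(** * Fundamental theorem of calculus for weak derivatives in time *)

Section WeakDerivative.
Context {R : realType}.
Local Notation leb := (@lebesgue_measure R).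

(* an unnormalized mollifier supported in [[0, d]] *)
Definition mollifier (d x : R) : R := flat 0 x * flat 0 (d - x).

Lemma smooth1_mollifier d : smooth1 (mollifier d).
Proof.
apply/smooth1P => k; apply: nderivableM; first exact: nderivable_flat.
rewrite (_ : (fun x => _) = (fun x => flat 0 ((- 1) * x + d))).
  by apply: nderivable_affine; exact: nderivable_flat.
by apply/funext => x; congr flat; ring.
Qed.

Lemma mollifier_continuous d : continuous (mollifier d).
Proof.
by apply: derivable_is_continuous; exact: (@smooth1_mollifier d 0%N).
Qed.

Lemma mollifier_ge0 d x : 0 <= mollifier d x.
Proof. by rewrite mulr_ge0 // flat_ge0. Qed.

Lemma mollifier_le1 d x : mollifier d x <= 1.
Proof. by rewrite mulr_ile1 ?flat_ge0 ?flat0_le1. Qed.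

Lemma mollifier_out d x : x <= 0 \/ d <= x -> mollifier d x = 0.
Proof.
case=> h; rewrite /mollifier.
  by rewrite [X in X * _](@flat_le0 _ 0) ?mul0r.
by rewrite [X in _ * X](@flat_le0 _ 0) ?mulr0 // subr_le0.
Qed.

(* the lower bound [- 1] is arbitrary: the mollifier vanishes on []-oo, 0]] *)
Definition ramp (d x : R) : R := \int[leb]_(y in `[-1, x]) mollifier d y.

Lemma ramp_left d x : x <= 0 -> ramp d x = 0.
Proof.
move=> x0; rewrite /ramp (@Rint_eq _ _ _ _ _ _ (fun=> 0)).
  by rewrite Rintegral_cst // mul0r.
move=> y /=; rewrite in_itv /= => /andP[_ yx]; rewrite mollifier_out //.
by left; exact: le_trans x0.
Qed.

Lemma ramp_derive d (x : R) : is_derive x 1 (ramp d) (mollifier d x).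
Proof.
have [x0|x0] := ltP x 0.
  rewrite mollifier_out ?(ltW x0); last by left.
  apply: (near_eq_is_derive (f := fun=> (0 : R))).
  by near=> y; rewrite ramp_left // ltW //; near: y; exact: lt_nbhsl.
have [||||dF F'] := @continuous_FTC1_closed R (mollifier d) (-1) x (x + 1).
- by rewrite ltrDl.
- apply: continuous_compact_integrable; first exact: segment_compact.
  by apply: continuous_subspaceT; exact: mollifier_continuous.
- by rewrite (lt_le_trans _ x0).
- exact: mollifier_continuous.
by apply: DeriveDef; [exact: dF|rewrite -derive1E; exact: F'].
Unshelve. all: by end_near.
Qed.

Lemma ramp_incr d x y : x <= y -> ramp d x <= ramp d y.
Proof.
move=> xy; have [_] := FTC_itv xy (ramp_derive d) (@mollifier_continuous d).
by move/eqP; rewrite eq_sym subr_eq => /eqP ->; rewrite lerDr Rintegral_ge0 // => z _; exact: mollifier_ge0.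
Qed.

Lemma ramp_right d x : d <= x -> ramp d x = ramp d d.
Proof.
move=> xy; have [_] := FTC_itv xy (ramp_derive d) (@mollifier_continuous d).
rewrite (@Rint_eq _ _ _ _ _ _ (fun=> 0)); last first.
  by move=> y /=; rewrite in_itv /= => /andP[dy _]; rewrite mollifier_out //; right.
by rewrite Rintegral_cst // mul0r => /esym/eqP; rewrite subr_eq0 => /eqP.
Qed.

Lemma ramp_ge0 d x : 0 <= ramp d x.
Proof. by apply: Rintegral_ge0 => y _; exact: mollifier_ge0. Qed.

Lemma ramp_le d x : ramp d x <= ramp d d.
Proof.
have [dx|/ltW xd] := leP d x; first by rewrite (ramp_right dx).
exact: ramp_incr.
Qed.

Lemma ramp_gt0 d : 0 < d -> 0 < ramp d d.
Proof.
move=> d0; rewrite lt_neqAle ramp_ge0 andbT; apply/eqP => r0.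
have rz x : ramp d x = 0.
  by apply/eqP; rewrite eq_le ramp_ge0 r0 ramp_le.
have := is_derive1E (ramp_derive d (d / 2)).
have -> : ramp d = cst 0 by apply/funext => x; rewrite rz.
rewrite derive1_cst /mollifier => /esym/eqP; rewrite mulf_eq0.
by rewrite !gt_eqF //; apply: flat0_gt0; lra.
Qed.

Lemma smooth1_ramp d : smooth1 (ramp d).
Proof.
apply/smooth1P => -[//|n]; split; first by move=> x; case: (ramp_derive d x).
rewrite (_ : derive1 _ = mollifier d); first by have /smooth1P := @smooth1_mollifier d; exact.
by apply/funext => x; apply: is_derive1E; exact: ramp_derive.
Qed.

(* Unfolding these during unification is very costly. *)
Opaque flat mollifier ramp.

Lemma mollifier_shift_integral d c (T : R) : 0 < d -> 0 <= c -> c + d <= T ->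
  rintegrable leb `]0, T[ (fun x => mollifier d (x - c)) /\
  \int[leb]_(x in `]0, T[) mollifier d (x - c) = ramp d d.
Proof.
move=> d0 c0 cT; have T0 : 0 <= T by lra.
have h (x : R) : is_derive x 1 (fun y => ramp d (y - c)) (mollifier d (x - c)).
  have := @is_derive_affine _ (ramp d) 1 (- c) x (mollifier d (1 * x - c)) (ramp_derive d _).
  by rewrite !mul1r; under [X in is_derive _ _ X]eq_fun do rewrite mul1r.
have cm : continuous (fun x => mollifier d (x - c)).
  move=> x; apply: (continuous_comp (f := fun y => y - c)); last exact: mollifier_continuous.
  by apply: continuousB; [exact: cvg_id|exact: cst_continuous].
have [I ->] := FTC_itvoo T0 h cm; split=> //.
rewrite ramp_right; last by lra.
by rewrite (@ramp_left d (0 - c)) ?subr0 // sub0r oppr_le0.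
Qed.

(** The mollifier, divided by its mass [ramp d d], is a weight supported in [[c, c + d]], so only
    the oscillation of [h] there enters. *)
Lemma mollifier_concentrates d c (T e : R) (h : R -> R) : 0 < d -> 0 <= c ->
  c + d <= T -> rintegrable leb `]0, T[ h ->
  (forall x, 0 < x < T -> c <= x <= c + d -> `|h x - h c| <= e) ->
  rintegrable leb `]0, T[ (fun x => mollifier d (x - c) * h x) /\
  `|(ramp d d)^-1 * (\int[leb]_(x in `]0, T[) (mollifier d (x - c) * h x)) - h c| <= e.
Proof.
move=> d0 c0 cT Ih he; have [Im mm] := mollifier_shift_integral d0 c0 cT.
have Imh : rintegrable leb `]0, T[ (fun x => mollifier d (x - c) * h x).
  apply: (rintegrable_le _ _ _ (rintegrable_norm Ih)) => //.
    by apply: measurable_funM; [exact: rintegrable_measurable Im|exact: rintegrable_measurable Ih].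
  move=> x _; rewrite normrM ler_piMl // ger0_norm ?mollifier_ge0 //.
  exact: mollifier_le1.
split=> //; have r0 := ramp_gt0 d0.
have mT : measurable ([set` `]0, T[] : set (measurableTypeR R)) by exact: measurable_itv.
have Ihm := rintegrableZ mT (h c) Im.
have IB : rintegrable leb `]0, T[ (fun x => mollifier d (x - c) * (h x - h c)).
  apply: (rintegrable_eq mT _ (rintegrableB mT Imh Ihm)) => x _.
  have alg (p q r : R) : p * q - r * p = p * (q - r) by ring.
  exact: alg.
have eB : \int[leb]_(x in `]0, T[) (mollifier d (x - c) * (h x - h c)) =
    \int[leb]_(x in `]0, T[) (mollifier d (x - c) * h x) - h c * ramp d d.
  rewrite -mm -(RintegralZl (h c) mT Im) -(RintegralB mT Imh Ihm).
  have alg (p q r : R) : p * (q - r) = p * q - r * p by ring.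
  by apply: Rint_eq => x _; exact: alg.
have bd : `|\int[leb]_(x in `]0, T[) (mollifier d (x - c) * (h x - h c))| <= e * ramp d d.
  rewrite -mm -(RintegralZl e mT Im).
  apply: (Rint_norm_le mT IB (rintegrableZ mT e Im)).
  move=> x /=; rewrite in_itv /= => xT; rewrite normrM ger0_norm ?mollifier_ge0 // mulrC.
  have [xc|xc] := boolP (c <= x <= c + d).
    by rewrite ler_wpM2r ?mollifier_ge0 // he.
  rewrite mollifier_out ?mulr0 ?mul0r //.
  by move: xc; rewrite negb_and -!ltNge => /orP[] ?; [left|right]; lra.
have alg (p q r z : R) : 0 < r -> q = p - z * r -> `|q| <= e * r -> `|r^-1 * p - z| <= e.
  move=> r0' -> h'; have -> : r^-1 * p - z = (p - z * r) / r by field; rewrite gt_eqF.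
  by rewrite normrM normfV (gtr0_norm r0') ler_pdivrMr.
exact: (alg _ _ _ _ r0 eB bd).
Qed.

(** Beyond [b + d] both ramps equal the same constant, so the difference has compact support in []0,
    T[]. Divided by [ramp d d] it is a smooth approximation of an indicator, with derivative
    concentrated near [a] and [b]. *)
Lemma ramp_diff_test d (T a b : R) : 0 < d -> 0 < a -> a <= b -> b + d < T ->
  test_fun1 T (fun x => ramp d (x - a) - ramp d (x - b)) /\
  derive1 (fun x => ramp d (x - a) - ramp d (x - b)) =
    (fun x => mollifier d (x - a) - mollifier d (x - b)).
Proof.
move=> d0 a0 ab bT; split.
  split.
    apply/smooth1P => n.
    have h c : nderivable n (fun x => ramp d (x - c)).
      have /smooth1P /(_ n) := @smooth1_ramp d.
      by move=> /(@nderivable_affine _ n 1 (- c)); under eq_fun do rewrite mul1r.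
    have := nderivableD (h a) (nderivableZ (-1) (h b)).
    by under eq_fun do rewrite mulN1r.
  exists [set` `[a, b + d]]; split.
  - exact: segment_compact.
  - by move=> x /=; rewrite !in_itv /= => /andP[ax xb]; apply/andP; split; lra.
  - move=> x /= /negP; rewrite in_itv /= negb_and -!ltNge => /orP[] h.
      by rewrite !(@ramp_left _ (x - _)) ?subrr //; lra.
    by rewrite !(@ramp_right d (x - _)) ?subrr //; lra.
apply/funext => x; apply: is_derive1E.
have h c : is_derive x 1 (fun y => ramp d (y - c)) (mollifier d (x - c)).
  have := @is_derive_affine _ (ramp d) 1 (- c) x (mollifier d (1 * x - c)) (ramp_derive d _).
  by rewrite !mul1r; under [X in is_derive _ _ X]eq_fun do rewrite mul1r.
exact: is_deriveB.
Qed.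

Lemma ramp_diff_cvg (d : nat -> R) (a b x : R) : a <= b -> (forall n, 0 < d n) ->
  d n @[n --> \oo] --> (0 : R) ->
  (ramp (d n) (d n))^-1 * (ramp (d n) (x - a) - ramp (d n) (x - b)) @[n --> \oo]
    --> (\1_(`]a, b]) x : R).
Proof.
move=> ab d0 /cvgr_lt cd; rewrite indicE /= mem_setE in_itv /=.
have [ax|xa] /= := ltP a x; last first.
  apply: cvg_near_cst; apply: nearW => n.
  by rewrite !(@ramp_left _ (x - _)) ?subrr ?mulr0 //; lra.
have xa0 : 0 < x - a by lra.
have [xb|bx] /= := leP x b.
  apply: cvg_near_cst; apply: filterS (cd _ xa0) => n dx.
  rewrite (@ramp_left _ (x - b)) ?subr0; last by lra.
  by rewrite (ramp_right (ltW dx)) mulVf // gt_eqF // ramp_gt0.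
have xb0 : 0 < x - b by lra.
apply: cvg_near_cst; apply: filterS (cd _ xb0) => n dx.
by rewrite !(@ramp_right _ (x - _)) ?subrr ?mulr0 //; lra.
Qed.

(** Tested with differences of ramps of width [d n], the weak derivative identity compares averages
    of [h] just to the right of [a] and [b] with an approximation of the integral of [v] over []a,
    b]]. *)
Lemma weak_derivative_FTC_interior (T : R) (h v : R -> R) :
  (forall t e, 0 <= t <= T -> 0 < e -> exists2 d, 0 < d &
    forall s, 0 <= s <= T -> `|s - t| < d -> `|h s - h t| < e) ->
  rintegrable leb `]0, T[ h -> rintegrable leb `]0, T[ v ->
  (forall eta, test_fun1 T eta ->
    \int[leb]_(t in `]0, T[) (derive1 eta t * h t) =
    - \int[leb]_(t in `]0, T[) (eta t * v t)) ->
  forall a b, 0 < a -> a <= b -> b < T ->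
    h b - h a = \int[leb]_(t in `]0, T[) (\1_(`]a, b]) t * v t).
Proof.
move=> ch Ih Iv wd a b a0 ab bT.
have Tb0 : 0 < (T - b) / 2 by lra.
(* The factor keeps [b + d n] below [T], so that the support of the test function stays in []0,
   T[]. *)
pose d n := (T - b) / 2 * n.+1%:R^-1.
have d0 n : 0 < d n by rewrite mulr_gt0 ?invr_gt0 ?ltr0n.
have dle n : d n <= (T - b) / 2.
  by rewrite /d ler_piMr ?(ltW Tb0) // invf_le1 ?ltr0n // ler1n.
have cd : d n @[n --> \oo] --> (0 : R).
  by rewrite -(mulr0 ((T - b) / 2)); apply: cvgMr; exact: cvg_harmonic.
pose I n c := (ramp (d n) (d n))^-1 *
  (\int[leb]_(x in `]0, T[) (mollifier (d n) (x - c) * h x)).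
have Ic c : 0 < c -> c <= b -> I n c @[n --> \oo] --> h c.
  move=> c0 cb; apply/cvgrPdist_le => e e0.
  have cT : 0 <= c <= T by lra.
  have [del del0 hdel] := ch c e cT e0.
  near=> n; rewrite distrC.
  have dn : d n < del by near: n; exact: (cvgr_lt _ cd).
  have cdT : c + d n <= T by have := dle n; lra.
  apply: (mollifier_concentrates (d0 n) (ltW c0) cdT Ih _).2 => x xT xc.
  by rewrite ltW // hdel //; [lra|rewrite ger0_norm; lra].
pose J n := \int[leb]_(x in `]0, T[) ((ramp (d n) (d n))^-1 *
  (ramp (d n) (x - a) - ramp (d n) (x - b)) * v x).
have IJ n : I n b - I n a = J n.
  have bd : b + d n < T by have := dle n; lra.
  have [te de] := ramp_diff_test (d0 n) a0 ab bd.
  have := wd _ te; rewrite de => e.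
  have Im c : 0 < c -> c <= b -> rintegrable leb `]0, T[ (fun x => mollifier (d n) (x - c) * h x).
    move=> c0 cb; have cdT : c + d n <= T by lra.
    have [_ _ ] := mollifier_shift_integral (d0 n) (ltW c0) cdT.
    have := mollifier_shift_integral (d0 n) (ltW c0) cdT => -[Im0 _].
    apply: (rintegrable_le _ _ _ (rintegrable_norm Ih)) => //.
      by apply: measurable_funM; [exact: rintegrable_measurable Im0|exact: rintegrable_measurable Ih].
    move=> x _; rewrite normrM ler_piMl // ger0_norm ?mollifier_ge0 //.
    exact: mollifier_le1.
  have Ima := Im a a0 ab; have Imb := Im b (lt_le_trans a0 ab) (lexx b).
  rewrite /I -mulrBr -RintegralB //.
  rewrite (_ : \int[leb]_(x in _) (mollifier (d n) (x - b) * h x - _) =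
     \int[leb]_(x in `]0, T[) ((ramp (d n) (x - a) - ramp (d n) (x - b)) * v x)).
    rewrite /J -RintegralZl //; first by apply: Rint_eq => x _; rewrite mulrA.
    apply: (rintegrable_le _ _ _ (rintegrableZ _ (ramp (d n) (d n)) (rintegrable_norm Iv))) => //.
      apply: measurable_funM; last exact: rintegrable_measurable Iv.
      apply: measurable_funTS; apply: continuous_measurable_fun.
      by apply: derivable_is_continuous; exact: (te.1 0%N).
    move=> x _; rewrite normrM ler_wpM2r // ler_norml.
    have := ramp_ge0 (d n) (x - a); have := ramp_ge0 (d n) (x - b).
    have := ramp_le (d n) (x - a); have := ramp_le (d n) (x - b); lra.
  rewrite -[RHS]opprK -e -[LHS]opprK; congr (- _).
  rewrite -[LHS]mulN1r -RintegralZl //; last exact: (rintegrableB _ Imb Ima).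
  by apply: Rint_eq => x _; ring.
have cI : I n b - I n a @[n --> \oo] --> h b - h a.
  by apply: cvgB; apply: Ic => //; rewrite (lt_le_trans a0).
have [|||||_ cJ] := @Rint_dominated _ _ _ leb `]0, T[ _
  (fun n x => (ramp (d n) (d n))^-1 * (ramp (d n) (x - a) - ramp (d n) (x - b)) * v x)
  (fun x => \1_(`]a, b]) x * v x) (fun x => `|v x|).
- by [].
- move=> n; apply: measurable_funM; last exact: rintegrable_measurable Iv.
  have bd : b + d n < T by have := dle n; lra.
  have [te _] := ramp_diff_test (d0 n) a0 ab bd.
  apply: measurable_funM; first exact: measurable_cst.
  apply: measurable_funTS; apply: continuous_measurable_fun.
  by apply: derivable_is_continuous; exact: (te.1 0%N).
- by move=> x _; apply: cvgMl; exact: ramp_diff_cvg.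
- move=> n x _; rewrite normrM ler_piMl // normrM normfV (gtr0_norm (ramp_gt0 (d0 n))).
  rewrite mulrC ler_pdivrMr ?ramp_gt0 // mul1r ler_norml.
  have := ramp_ge0 (d n) (x - a); have := ramp_ge0 (d n) (x - b).
  have := ramp_le (d n) (x - a); have := ramp_le (d n) (x - b); lra.
- exact: rintegrable_norm.
have e : (fun n => I n b - I n a) = J by apply/funext => n; exact: IJ.
rewrite e in cI; exact: (cvg_unique _ cI cJ).
Unshelve. all: by end_near.
Qed.

(** Test functions do not reach [0] and [T]. The interior identity is applied on []a + d n, b - d
    n]], nonempty by the factor one third in [d], and the continuity of [h] up to the end points
    concludes. *)
Lemma weak_derivative_FTC (T : R) (h v : R -> R) :
  (forall t e, 0 <= t <= T -> 0 < e -> exists2 d, 0 < d &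
    forall s, 0 <= s <= T -> `|s - t| < d -> `|h s - h t| < e) ->
  rintegrable leb `]0, T[ h -> rintegrable leb `]0, T[ v ->
  (forall eta, test_fun1 T eta ->
    \int[leb]_(t in `]0, T[) (derive1 eta t * h t) =
    - \int[leb]_(t in `]0, T[) (eta t * v t)) ->
  forall a b, 0 <= a -> a <= b -> b <= T ->
    h b - h a = \int[leb]_(t in `]a, b[) v t.
Proof.
move=> ch Ih Iv wd a b a0; rewrite le_eqVlt => /predU1P[<- _|ab bT].
  by rewrite subrr set_itvoo0 Rintegral_set0.
have ba0 : 0 < (b - a) / 3 by lra.
pose d n := (b - a) / 3 * n.+1%:R^-1.
have d0 n : 0 < d n by rewrite mulr_gt0 ?invr_gt0 ?ltr0n.
have dle n : d n <= (b - a) / 3.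
  by rewrite /d ler_piMr ?(ltW ba0) // invf_le1 ?ltr0n // ler1n.
have cd : d n @[n --> \oo] --> (0 : R).
  by rewrite -(mulr0 ((b - a) / 3)); apply: cvgMr; exact: cvg_harmonic.
have e n : h (b - d n) - h (a + d n) =
    \int[leb]_(t in `]0, T[) (\1_(`]a + d n, b - d n]) t * v t).
  by apply: (weak_derivative_FTC_interior ch Ih Iv wd); have := dle n; have := d0 n; lra.
have chc c (x : nat -> R) : 0 <= c <= T -> (forall n, 0 <= x n <= T) ->
    (forall n, `|x n - c| <= d n) -> h (x n) @[n --> \oo] --> h c.
  move=> cT xT xd; apply/cvgrPdist_le => eps eps0.
  have [del del0 hdel] := ch c eps cT eps0.
  near=> n; rewrite distrC ltW // hdel // (le_lt_trans (xd n)) //.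
  by near: n; exact: (cvgr_lt _ cd).
have cI : h (b - d n) - h (a + d n) @[n --> \oo] --> h b - h a.
  apply: cvgB; apply: chc; try lra; move=> n; have := dle n; have := d0 n.
  - lra.
  - by move=> *; rewrite ler0_norm; lra.
  - lra.
  - by move=> *; rewrite ger0_norm; lra.
have ind01 (A : set R) x : 0 <= (\1_A x : R) <= 1.
  by rewrite indicE; case: (x \in A); rewrite ?lexx ler01.
have [|||||_ cJ] := @Rint_dominated _ _ _ leb `]0, T[ _
  (fun n x => \1_(`]a + d n, b - d n]) x * v x)
  (fun x => \1_(`]a, b[) x * v x) (fun x => `|v x|).
- by [].
- move=> n; apply: measurable_funM; last exact: rintegrable_measurable Iv.
  exact: measurable_indic.
- move=> x _; apply: cvgMl.
  rewrite [X in _ --> X]indicE /= mem_setE in_itv /=.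
  have [/andP[ax xb]|] := boolP (a < x < b).
    have xa0 : 0 < x - a by lra.
    have bx0 : 0 < b - x by lra.
    apply: cvg_near_cst; near=> n.
    have : d n < x - a by near: n; exact: (cvgr_lt _ cd).
    have : d n < b - x by near: n; exact: (cvgr_lt _ cd).
    by rewrite indicE mem_setE in_itv /= => h1 h2; rewrite (_ : (_ && _) = true) //; lra.
  move=> xab; apply: cvg_near_cst; apply: nearW => n.
  rewrite indicE mem_setE in_itv /= (_ : (_ && _) = false) //.
  by apply: contraNF xab; have := d0 n; lra.
- move=> n x _; have /andP[i0 i1] := ind01 [set` `]a + d n, b - d n]] x.
  by rewrite normrM ler_piMl // ger0_norm.
- exact: rintegrable_norm.
have e2 : (fun n => h (b - d n) - h (a + d n)) =
    (fun n => \int[leb]_(t in `]0, T[) (\1_(`]a + d n, b - d n]) t * v t)).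
  by apply/funext => n; exact: e.
rewrite e2 in cI; rewrite (cvg_unique _ cI cJ) //.
rewrite Rint_indic; congr Rintegral; apply/seteqP.
split=> x /=; rewrite !in_itv /=; first by case.
by move=> /andP[ax xb]; split; lra.
Unshelve. all: by end_near.
Qed.

End WeakDerivative.

(** * Weak gradients and traces on a rectangle *)

Section PlaneMeasure.
Context {R : realType}.
Local Notation leb := (@lebesgue_measure R).
Local Notation TR := (measurableTypeR R).
Local Notation mu2 := (leb \x leb)%E.
Implicit Types (A B : set TR) (f g : TR * TR -> R).

(** The sigma-algebra of the plane is the product one, so an open set is written as the countable
    union of the rational boxes that it contains. *)
Lemma open_measurable2 (U : set (R * R)) : open U -> measurable (U : set (TR * TR)).
Proof.
move=> oU.
pose box (q : rat * rat * (rat * rat)) : set (R * R) :=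
  [set` `]ratr q.1.1, ratr q.1.2[] `*` [set` `]ratr q.2.1, ratr q.2.2[].
have -> : U = \bigcup_q (if `[< box q `<=` U >] then box q else set0).
  apply/seteqP; split => [[x y] Uxy|p [q _]]; last first.
    by case: asboolP => // h; exact: h.
  have [[P Q] /= [nP nQ] PQU] : nbhs (x, y) U by exact: open_nbhs_nbhs.
  have [e /= e0 he] := nP; have [e' /= e'0 he'] := nQ.
  have itv (z d : R) : 0 < d -> exists q : rat * rat,
      ratr q.1 < z < ratr q.2 /\ (forall t, ratr q.1 < t < ratr q.2 -> `|z - t| < d).
    move=> d0.
    have [q1] := @rat_in_itvoo R (z - d) z ltac:(lra).
    have [q2] := @rat_in_itvoo R z (z + d) ltac:(lra).
    rewrite !in_itv /= => /andP[h1 h2] /andP[h3 h4].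
    exists (q1, q2); split; first by apply/andP.
    by move=> t /andP[t1 t2]; rewrite /= ltr_norml; lra.
  have [q1 [xq hq1]] := itv x e e0; have [q2 [yq hq2]] := itv y e' e'0.
  exists (q1, q2) => //.
  case: asboolP => [_|[]]; first by split; rewrite /= in_itv.
  move=> [x' y'] [] /=; rewrite !in_itv /= => hx hy; apply: PQU; split.
    by apply: he; exact: hq1.
  by apply: he'; exact: hq2.
apply: countable_bigcupT_measurable => [|q]; first exact: countableP.
case: ifP => _ //; apply: measurableX => //.
Qed.

Lemma continuous_measurable2 (f : R * R -> R) : continuous f ->
  measurable_fun setT (f : TR * TR -> R).
Proof.
move=> cf; apply: (measurability _ (RGenOInfty.measurableE R)) => //.
move=> _ [_ [a ->] <-]; rewrite setTI; apply: open_measurable2.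
by apply: open_comp => //; exact: interval_open.
Qed.

Lemma rect_finite (a b c d : R) : (mu2 ((`]a, b[ : set TR) `*` `]c, d[) < +oo)%E.
Proof.
have fin (x y : R) : leb `]x, y[ \is a fin_num.
  by rewrite lebesgue_measure_itv /=; case: ifP.
rewrite product_measure1E //; apply: (@lt_le_trans _ _ +oo%E) => //.
by apply: lte_mul_pinfty; rewrite ?measure_ge0 ?fin // ltey_eq fin.
Qed.

Lemma rect_continuous_bounded (f : R * R -> R) (a b c d : R) : continuous f ->
  exists M : R, forall p, (`]a, b[ `*` `]c, d[) p -> `|f p| <= M.
Proof.
move=> cf.
have cK : compact (`[a, b] `*` `[c, d]).
  by apply: compact_setX; exact: segment_compact.
have /compact_bounded [M [_ hM]] : compact (f @` (`[a, b] `*` `[c, d])).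
  by apply: continuous_compact => //; exact: continuous_subspaceT.
exists (M + 1) => -[x y] [/= hx hy]; apply: (hM (M + 1)); first by rewrite ltrDl.
by exists (x, y) => //; split => /=; exact: subset_itv_oo_cc.
Qed.

Lemma rect_continuous_integrable (f : R * R -> R) (a b c d : R) : continuous f ->
  rintegrable mu2 ((`]a, b[ : set TR) `*` `]c, d[) (f : TR * TR -> R).
Proof.
move=> cf; have [M hM] := rect_continuous_bounded a b c d cf.
have mD : measurable ((`]a, b[ : set TR) `*` (`]c, d[ : set TR)) by exact: measurableX.
apply: (rintegrable_le mD _ hM).
  by apply: measurable_funTS; exact: continuous_measurable2.
by apply: rintegrable_cst => //; exact: rect_finite.
Qed.

(** Integrability of every slice over [A] makes the inner real integral agree with the extended one
    at every point of [A]. *)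
Lemma rect_fubini1 A B f : measurable A -> measurable B ->
  rintegrable mu2 (A `*` B) f ->
  (forall x, A x -> rintegrable leb B (fun y => f (x, y))) ->
  \int[mu2]_(p in A `*` B) f p =
  \int[leb]_(x in A) \int[leb]_(y in B) f (x, y).
Proof.
move=> mA mB If Is; have mAB := measurableX mA mB.
rewrite /Rintegral; congr fine.
have If' := (integrable_mkcond _ mAB).1 If.
rewrite integral_mkcond -integral12_prod_meas1 //.
rewrite [RHS]integral_mkcond; apply: eq_integral => x _.
rewrite /fubini_F patchE; case: ifPn => [/set_mem Ax|/negP xA].
  rewrite fineK; last exact: (integrable_fin_num mB (Is x Ax)).
  rewrite [RHS]integral_mkcond; apply: eq_integral => y _.
  rewrite !patchE; case: ifPn => [/set_mem [_ /= By]|].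
    by rewrite mem_set.
  case: ifPn => // /set_mem By /negP; case; exact: mem_set.
apply: integral0_eq => y _; rewrite patchE; case: ifPn => // /set_mem [Ax _].
by case: xA; exact: mem_set.
Qed.

Lemma rect_fubini2 A B f : measurable A -> measurable B ->
  rintegrable mu2 (A `*` B) f ->
  (forall y, B y -> rintegrable leb A (fun x => f (x, y))) ->
  \int[mu2]_(p in A `*` B) f p =
  \int[leb]_(y in B) \int[leb]_(x in A) f (x, y).
Proof.
move=> mA mB If Is; have mAB := measurableX mA mB.
rewrite /Rintegral; congr fine.
have If' := (integrable_mkcond _ mAB).1 If.
rewrite integral_mkcond -integral21_prod_meas1 //.
rewrite [RHS]integral_mkcond; apply: eq_integral => y _.
rewrite /fubini_G patchE; case: ifPn => [/set_mem By|/negP yB].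
  rewrite fineK; last exact: (integrable_fin_num mA (Is y By)).
  rewrite [RHS]integral_mkcond; apply: eq_integral => x _.
  rewrite !patchE; case: ifPn => [/set_mem [/= Ax _]|].
    by rewrite mem_set.
  case: ifPn => // /set_mem Ax /negP; case; exact: mem_set.
apply: integral0_eq => x _; rewrite patchE; case: ifPn => // /set_mem [_ By].
by case: yB; exact: mem_set.
Qed.

Lemma rect_integrable_snd A B (v : R -> R) : measurable A -> measurable B ->
  (leb A < +oo)%E -> rintegrable leb B v ->
  rintegrable mu2 (A `*` B) (fun p => v p.2).
Proof.
move=> mA mB fA Iv; have mAB := measurableX mA mB.
have mv := rintegrable_measurable Iv.
have mv2 : measurable_fun (A `*` B) (fun p => v p.2).
  apply: (measurable_comp (F := B)) => //.
  - by move=> _ [p [_ Bp] <-].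
  - by apply: measurable_funTS; exact: measurable_snd.
apply: (integrable_mkcond _ mAB).2; apply/integrable12ltyP.
  by apply: (measurable_restrictT _ mAB).1; exact/measurable_EFinP.
have /integrableP[_ fv] := Iv.
apply: (@le_lt_trans _ _ (\int[leb]_(x in A) \int[leb]_(y in B) `|(v y)%:E|)%E).
  rewrite [leRHS]integral_mkcond le_eqVlt; apply/orP; left; apply/eqP.
  apply: eq_integral => x _; rewrite patchE; case: ifPn => [/set_mem Ax|/negP xA].
    rewrite [RHS]integral_mkcond; apply: eq_integral => y _.
    rewrite !patchE; case: ifPn => [/set_mem [_ /= By]|].
      by rewrite mem_set.
    case: ifPn => [/set_mem By /negP[]|_ _]; last by rewrite abse0.
    exact: mem_set.
  apply: integral0_eq => y _; rewrite patchE; case: ifPn => [/set_mem [Ax _]|].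
    by case: xA; exact: mem_set.
  by rewrite abse0.
rewrite integral_cst //; apply: lte_mul_pinfty => //.
- by apply: integral_ge0 => y _; exact: abse_ge0.
- by rewrite ge0_fin_numE //; apply: integral_ge0 => y _; exact: abse_ge0.
Qed.

Lemma continuous_slice (f : R * R -> R) (z : R) : continuous f ->
  continuous (fun x => f (x, z)) /\ continuous (fun y => f (z, y)).
Proof.
move=> cf; split=> x.
- apply: (continuous_comp (f := fun x => (x, z))); last exact: cf.
  apply: (@cvg_pair _ _ _ (nbhs x) (nbhs x) (nbhs z)); first exact: cvg_id.
  exact: cvg_cst.
- apply: (continuous_comp (f := fun y => (z, y))); last exact: cf.
  apply: (@cvg_pair _ _ _ (nbhs x) (nbhs z) (nbhs x)); last exact: cvg_id.
  exact: cvg_cst.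
Qed.

Lemma rect_FTC1 (F f : R * R -> R) (a b c d : R) : a <= b ->
  (forall p : R * R, is_derive p.1 1 (fun r : R => F (r, p.2)) (f p)) -> continuous f ->
  \int[mu2]_(p in (`]a, b[ : set TR) `*` (`]c, d[ : set TR)) f p =
  \int[leb]_(y in `]c, d[) (F (b, y) - F (a, y)).
Proof.
move=> ab dF cf.
have cs y := (continuous_slice y cf).1.
have I y := @FTC_itvoo R (fun x => F (x, y)) (fun x => f (x, y)) a b ab (fun x => dF (x, y)) (cs y).
rewrite rect_fubini2 //.
- by apply: Rint_eq => y _; have [_ <-] := I y.
- exact: rect_continuous_integrable.
- by move=> y _; have [] := I y.
Qed.

Lemma rect_FTC2 (F f : R * R -> R) (a b c d : R) : c <= d ->
  (forall p : R * R, is_derive p.2 1 (fun r : R => F (p.1, r)) (f p)) -> continuous f ->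
  \int[mu2]_(p in (`]a, b[ : set TR) `*` (`]c, d[ : set TR)) f p =
  \int[leb]_(x in `]a, b[) (F (x, d) - F (x, c)).
Proof.
move=> cd dF cf.
have cs x := (continuous_slice x cf).2.
have I x := @FTC_itvoo R (fun y => F (x, y)) (fun y => f (x, y)) c d cd (fun y => dF (x, y)) (cs x).
rewrite rect_fubini1 //.
- by apply: Rint_eq => x _; have [_ <-] := I x.
- exact: rect_continuous_integrable.
- by move=> x _; have [] := I x.
Qed.

(** Fubini on the triangle [t < s] of the square: integrating [v s] over [t] first gives
    [(s - a) * v s], over [s] first gives [h b - h t]. No product has to be differentiated
    weakly. *)
Lemma weak_derivative_ibp (h v : R -> R) (a b : R) : a < b ->
  rintegrable leb `]a, b[ h -> rintegrable leb `]a, b[ v ->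
  (forall t, a <= t <= b -> h b - h t = \int[leb]_(s in `]t, b[) v s) ->
  \int[leb]_(s in `]a, b[) ((s - a) * v s) =
  (b - a) * h b - \int[leb]_(s in `]a, b[) h s.
Proof.
move=> ab Ih Iv hv.
pose A : set TR := [set` `]a, b[].
have mA : measurable A by exact: measurable_itv.
have finA : (leb A < +oo)%E.
  by rewrite /A lebesgue_measure_itv /= lte_fin ab -EFinD ltry.
have muA : fine (leb A) = b - a.
  by rewrite /A lebesgue_measure_itv /= lte_fin ab -EFinD.
have mAA := measurableX mA mA.
pose C : set (TR * TR) := [set p | p.1 < p.2].
have mC : measurable C.
  have -> : C = (fun p : TR * TR => p.2 - p.1) @^-1` `]0, +oo[.
    by apply/seteqP; split => p /=; rewrite in_itv /= andbT subr_gt0.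
  rewrite -[X in measurable X]setTI; exact: measurable_funB.
pose F (p : TR * TR) := \1_C p * v p.2.
have IF : rintegrable mu2 (A `*` A) F.
  have I2 := rect_integrable_snd mA mA finA Iv.
  apply: (rintegrable_le mAA _ _ (rintegrable_norm I2)).
    apply: measurable_funM; last exact: rintegrable_measurable I2.
    by apply: measurable_funTS; exact: measurable_indic.
  move=> p _; rewrite normrM ler_piMl // ger0_norm indicE; by case: (p \in C); rewrite ?ler01.
have inC (t s : TR) : ((t, s) \in C) = (t < s).
  by apply/idP/idP => [/set_mem//|ts]; exact: mem_set.
have e1 t : A t -> (fun s => F (t, s)) = (fun s => \1_(`]t, +oo[) s * v s).
  move=> _; apply/funext => s; by rewrite /F !indicE inC mem_setE in_itv /= andbT.
have e2 s : A s -> (fun t => F (t, s)) = (fun t => v s * \1_(`]-oo, s[) t).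
  move=> _; apply/funext => t; by rewrite /F !indicE inC mem_setE in_itv /= mulrC.
have ind_int (B : set TR) (g : TR -> R) : measurable B -> rintegrable leb A g ->
    rintegrable leb A (fun s => \1_B s * g s).
  move=> mB Ig; apply: (rintegrable_le mA _ _ (rintegrable_norm Ig)).
    apply: measurable_funM; last exact: rintegrable_measurable Ig.
    by apply: measurable_funTS; exact: measurable_indic.
  by move=> x _; rewrite normrM ler_piMl // ger0_norm indicE; case: (x \in B); rewrite ?ler01.
have I1 t : A t -> rintegrable leb A (fun s => F (t, s)).
  by move=> At; rewrite e1 //; apply: ind_int.
have I2 s : A s -> rintegrable leb A (fun t => F (t, s)).
  move=> As; rewrite e2 //; apply: rintegrableZ => //.
  have := ind_int [set` `]-oo, s[] (fun=> 1) (measurable_itv _) (rintegrable_cst mA 1 finA).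
  by apply: rintegrable_eq => // x _; rewrite mulr1.
have := rect_fubini1 mA mA IF I1; rewrite (rect_fubini2 mA mA IF I2).
rewrite (@Rint_eq _ _ _ leb A _ (fun s => (s - a) * v s)); last first.
  move=> s As; rewrite e2 // RintegralZl //; last first.
    have := ind_int [set` `]-oo, s[] (fun=> 1) (measurable_itv _) (rintegrable_cst mA 1 finA).
    by apply: rintegrable_eq => // x _; rewrite mulr1.
  rewrite mulrC; congr (_ * _).
  rewrite -(@Rint_eq _ _ _ leb A (fun t => \1_(`]-oo, s[) t * 1)); last first.
    by move=> x _; rewrite mulr1.
  rewrite Rint_indic Rintegral_cst; last exact: measurableI.
  rewrite mul1r (_ : _ `&` _ = [set` `]a, s[]).
    move: As; rewrite /A /= in_itv /= => /andP[as_ _].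
    by rewrite lebesgue_measure_itv /= lte_fin as_ -EFinD.
  move: As; rewrite /A /= in_itv /= => /andP[as_ sb].
  apply/seteqP; split => x /=; rewrite !in_itv /=.
    by move=> [/andP[-> _]].
  by move=> /andP[ax xs]; split; lra.
move=> ->.
rewrite (@Rint_eq _ _ _ leb A _ (fun t => h b - h t)); last first.
  move=> t At; rewrite e1 // Rint_indic hv; last first.
    by move: At; rewrite /A /= in_itv /= => /andP[? ?]; lra.
  congr Rintegral; move: At; rewrite /A /= in_itv /= => /andP[at_ tb].
  apply/seteqP; split => x /=; rewrite !in_itv /= ?andbT.
    by move=> [/andP[_ ->] ->].
  by move=> /andP[ax xs]; split; lra.
rewrite RintegralB //; last exact: rintegrable_cst.
by rewrite Rintegral_cst // muA mulrC.
Qed.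

End PlaneMeasure.

(** * From generating sets to almost everywhere equality *)

Section Dynkin.
Context d (T : measurableType d) (R : realType).
Variable mu : {measure set T -> \bar R}.
Variables (D : set T) (mD : measurable D) (g : T -> R).
Hypothesis Ig : rintegrable mu D g.

Lemma rintegrable_indic (A : set T) : measurable A ->
  rintegrable mu D (fun x => \1_A x * g x).
Proof.
move=> mA; apply: (rintegrable_le mD _ _ (rintegrable_norm Ig)).
  apply: measurable_funM; last exact: rintegrable_measurable Ig.
  by apply: measurable_funTS; exact: measurable_indic.
move=> x _; rewrite normrM ler_piMl // ger0_norm indicE;
  by case: (x \in A); rewrite ?ler01.
Qed.

Lemma indic_ndseq_cvg (F : nat -> set T) x : nondecreasing_seq F ->
  (\1_(F n) x : R) @[n --> \oo] --> (\1_(\bigcup_i F i) x : R).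
Proof.
move=> ndF; apply: cvg_near_cst; have [[k _ Fk]|nF] := pselect ((\bigcup_i F i) x).
  near=> n; rewrite !indicE !mem_set //; first by exists k.
  have kn : (k <= n)%N by near: n; exact: nbhs_infty_ge.
  by have /subsetPset := ndF _ _ kn; apply.
apply: nearW => n; rewrite !indicE !memNset // => Fn; apply: nF; by exists n.
Unshelve. all: by end_near.
Qed.

(** The sets [A] whose preimage gives a zero integral form a lambda-system, monotone limits being
    handled by dominated convergence. The map [m] lets the argument run on one coordinate at a
    time. *)
Lemma dynkin_integral0 d' (T' : measurableType d') (m : T -> T') (G : set (set T')) :
  measurable_fun setT m -> setI_closed G -> @measurable d' T' = <<s G>> ->
  \int[mu]_(x in D) g x = 0 ->
  (forall A, G A -> \int[mu]_(x in D) (\1_(m @^-1` A) x * g x) = 0) ->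
  forall A, measurable A -> \int[mu]_(x in D) (\1_(m @^-1` A) x * g x) = 0.
Proof.
move=> mm GI mG g0 Gg A mA.
have mpre B : measurable B -> measurable (m @^-1` B).
  by move=> mB; rewrite -[X in measurable X]setTI; exact: mm.
pose H : set (set T') := [set B | measurable B /\
  \int[mu]_(x in D) (\1_(m @^-1` B) x * g x) = 0].
suff : H A by case.
have GH : G `<=` H.
  by move=> B GB; split; [rewrite mG; exact: sub_sigma_algebra|exact: Gg].
apply: (@lambda_system_subset _ G GI setT H _ GH); rewrite -?mG //.
split=> //.
- split; first exact: measurableT.
  by rewrite -[RHS]g0; apply: Rint_eq => x _; rewrite indicE mem_set // mul1r.
- move=> B C CB [mB B0] [mC C0]; split; first exact: measurableD.
  rewrite -(subrr (0 : R)) -{1}B0 -C0 -RintegralB //; last 2 first.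
  - by apply: rintegrable_indic; exact: mpre.
  - by apply: rintegrable_indic; exact: mpre.
  apply: Rint_eq => x _; rewrite -mulrBl !indicE; congr (_ * _).
  have [Cx|nCx] := pselect (C (m x)).
    by rewrite (mem_set (A := m @^-1` B) (CB _ Cx)) (mem_set (A := m @^-1` C) Cx) memNset ?subrr // => -[].
  rewrite (memNset (A := m @^-1` C)) // subr0.
  have [Bx|nBx] := pselect (B (m x)); first by rewrite !mem_set.
  by rewrite !memNset // => -[].
- move=> F ndF HF; split.
    by apply: bigcupT_measurable => i; case: (HF i).
  have mF i : measurable (m @^-1` F i) by apply: mpre; case: (HF i).
  have ndF' : nondecreasing_seq (fun n => m @^-1` F n).
    by move=> i j ij; apply/subsetPset => x /=; have /subsetPset := ndF _ _ ij; apply.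
  have [|||_ h] := @Rint_dominated _ _ _ mu D mD
    (fun n x => \1_(m @^-1` F n) x * g x)
    (fun x => \1_(m @^-1` (\bigcup_i F i)) x * g x) (fun x => `|g x|) _ _ _ (rintegrable_norm Ig).
  + by move=> n; exact: rintegrable_measurable (rintegrable_indic (mF n)).
  + move=> x _; apply: cvgMl; rewrite preimage_bigcup.
    exact: indic_ndseq_cvg.
  + move=> n x _; rewrite normrM ler_piMl // ger0_norm indicE;
      by case: (x \in _); rewrite ?ler01.
  have e : (fun n => \int[mu]_(x in D) (\1_(m @^-1` F n) x * g x)) = (fun=> 0).
    by apply/funext => n; case: (HF n).
  rewrite e in h; apply/esym; exact: (cvg_unique _ (@cvg_cst _ 0 _ _ _) h).
Qed.

Lemma ae_zero_of_integrals :
  (forall A, measurable A -> \int[mu]_(x in D) (\1_A x * g x) = 0) ->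
  {ae mu, forall x, D x -> g x = 0}.
Proof.
move=> g0.
have : ae_eq mu D (EFin \o g) (cst 0%E).
  apply: integral_ae_eq => // E ED mE.
  have := g0 E mE; rewrite Rint_indic (_ : D `&` E = E); last exact: setIidr.
  rewrite integral0 => e.
  have IE : rintegrable mu E g by exact: integrableS Ig.
  by rewrite -[LHS](EFin_Rint mE IE) e.
by apply: filterS => x h Dx; have [] := h Dx.
Qed.

End Dynkin.

(** * Functions orthogonal to all test functions of a rectangle *)

Section WeakGradient.
Context {R : realType}.
Local Notation leb := (@lebesgue_measure R).
Local Notation TR := (measurableTypeR R).
Local Notation mu2 := (leb \x leb)%E.

(** The [rect a b] of the problem is [box a b 0 1] by conversion, here over the type that carries
    the Borel structure. *)
Definition box (a b c d : R) : set (TR * TR) :=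
  (`]a, b[%classic : set TR) `*` (`]c, d[%classic : set TR).

Lemma measurable_box a b c d : measurable (box a b c d).
Proof. exact: measurableX. Qed.

Lemma smooth1_derive1 (f : R -> R) : smooth1 f -> smooth1 (derive1 f).
Proof. by move=> sf n t; rewrite -derive1Sn; exact: sf. Qed.

(** Partial derivatives of a tensor product of smooth functions are again such products, which is
    the invariant along the word [s]. *)
Lemma smooth2_tensor (al be : R -> R) : smooth1 al -> smooth1 be ->
  smooth2 (fun p => al p.1 * be p.2).
Proof.
move=> sal sbe s.
have [al' [be' [sal' sbe' ->]]] : exists al' be' : R -> R,
    [/\ smooth1 al', smooth1 be' & foldr pderiv (fun p => al p.1 * be p.2) s =
      (fun p => al' p.1 * be' p.2)].
  elim: s => [|i s [al' [be' [sal' sbe' IH]]]]; first by exists al, be.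
  rewrite /= IH; case: i.
    exists al', (derive1 be'); split; [by []|exact: smooth1_derive1|].
    apply/funext => -[x y]; rewrite /pderiv /slice /coord /=.
    by rewrite derive1Ml //; exact: (sbe' 0%N).
  exists (derive1 al'), be'; split; [exact: smooth1_derive1|by []|].
  apply/funext => -[x y]; rewrite /pderiv /slice /coord /=.
  by rewrite derive1Mr //; exact: (sal' 0%N).
have cal : continuous al' by apply: derivable_is_continuous; exact: (sal' 0%N).
have cbe : continuous be' by apply: derivable_is_continuous; exact: (sbe' 0%N).
split.
  move=> p; apply: continuousM.
    by apply: continuous_comp; [exact: cvg_fst|exact: cal].
  by apply: continuous_comp; [exact: cvg_snd|exact: cbe].
move=> [] [x y]; rewrite /slice /coord /=.
  by apply: derivableM; [exact: derivable_cst|exact: (sbe' 0%N)].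
by apply: derivableM; [exact: (sal' 0%N)|exact: derivable_cst].
Qed.

Definition plateau2 (n : nat) (p q r s : R) : R * R -> R :=
  fun z => plateau n p q z.1 * plateau n r s z.2.

Lemma test_fun2_plateau2 n (p q r s a b c d : R) : a <= p -> q <= b -> c <= r -> s <= d ->
  test_fun2 (box a b c d) (plateau2 n p q r s).
Proof.
move=> ap qb cr sd; split; first by apply: smooth2_tensor; exact: smooth1_plateau.
have n0 : 0 < n.+1%:R^-1 :> R by rewrite invr_gt0 ltr0n.
exists (`[p + n.+1%:R^-1, q - n.+1%:R^-1] `*` `[r + n.+1%:R^-1, s - n.+1%:R^-1]); split.
- by apply: compact_setX; exact: segment_compact.
- move=> [x y] [] /=; rewrite !in_itv /= => /andP[h1 h2] /andP[h3 h4].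
  split=> /=; rewrite in_itv /=.
    rewrite (le_lt_trans ap) ?(lt_le_trans _ h1) ?ltrDl //=.
    by rewrite (lt_le_trans _ qb) // (le_lt_trans h2) // ltrBlDr ltrDl.
  rewrite (le_lt_trans cr) ?(lt_le_trans _ h3) ?ltrDl //=.
  by rewrite (lt_le_trans _ sd) // (le_lt_trans h4) // ltrBlDr ltrDl.
- move=> [x y] /= /not_andP[] h; rewrite /plateau2 /=.
    by rewrite (plateau_out h) mul0r.
  by rewrite [X in _ * X](plateau_out h) mulr0.
Qed.

Lemma plateau2_cvg (p q r s : R) z :
  plateau2 n p q r s z @[n --> \oo] --> (\1_(box p q r s) z : R).
Proof.
have -> : \1_(box p q r s) z = \1_(`]p, q[) z.1 * \1_(`]r, s[) z.2 :> R.
  rewrite !indicE -natrM mulnb; congr (nat_of_bool _)%:R.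
  by apply/idP/andP => [/set_mem[h1 h2]|[/set_mem h1 /set_mem h2]]; [split|]; exact/mem_set.
by apply: cvgM; exact: plateau_cvg.
Qed.

(** Tensor plateaus converge to indicators of boxes, so [g] has zero integral on boxes, hence on
    products of rays. Dynkin's argument then replaces the ray by a measurable set in the first
    coordinate, next in the second, and finally passes from measurable products to all measurable
    sets. *)
Lemma du_bois_reymond2 (a b c d : R) (g : TR * TR -> R) :
  rintegrable mu2 (box a b c d) g ->
  (forall phi, test_fun2 (box a b c d) phi ->
    \int[mu2]_(z in box a b c d) (g z * phi z) = 0) ->
  {ae mu2, forall z, box a b c d z -> g z = 0}.
Proof.
move=> Ig gphi; set D := box a b c d.
have mD : measurable D by exact: measurable_box.
have boxes p q r s : a <= p -> q <= b -> c <= r -> s <= d ->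
    \int[mu2]_(z in D) (\1_(box p q r s) z * g z) = 0.
  move=> ap qb cr sd.
  have [|||_ h] := @Rint_dominated _ _ _ mu2 D mD
    (fun n z => plateau2 n p q r s z * g z)
    (fun z => \1_(box p q r s) z * g z) (fun z => `|g z|) _ _ _ (rintegrable_norm Ig).
  + move=> n; apply: measurable_funM; last exact: rintegrable_measurable Ig.
    apply: measurable_funTS; apply: continuous_measurable2.
    by have [/(_ [::])[]] := test_fun2_plateau2 n ap qb cr sd.
  + by move=> z _; apply: cvgMl; exact: plateau2_cvg.
  + move=> n z _; rewrite normrM ler_piMl // ger0_norm.
      by rewrite mulr_ile1 ?plateau_ge0 ?plateau_le1.
    by rewrite mulr_ge0 ?plateau_ge0.
  have e : (fun n => \int[mu2]_(z in D) (plateau2 n p q r s z * g z)) = (fun=> 0).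
    apply/funext => n; rewrite -[RHS](gphi _ (test_fun2_plateau2 n ap qb cr sd)).
    by apply: Rint_eq => z _; rewrite mulrC.
  rewrite e in h; apply/esym; exact: (cvg_unique _ (@cvg_cst _ 0 _ _ _) h).
pose G : set (set TR) := @RGenOInfty.G R.
have mRay : @measurable _ TR = <<s G>> by exact: RGenOInfty.measurableE.
have RayI : setI_closed G.
  move=> _ _ [x ->] [y ->]; exists (Num.max x y).
  by apply/seteqP; split => z /=; rewrite !in_itv /= !andbT gt_max;
    [move=> [-> ->]|move=> /andP[]].
(* The rays from [a] and from [c] contain the sides of [D]; this provides the case of the whole
   space in Dynkin's argument. *)
have D1 x : D x -> \1_(fst @^-1` [set` `]a, +oo[]) x = 1 :> R.
  by move=> [/= + _]; rewrite in_itv /= => /andP[h _]; rewrite indicE mem_set //= in_itv /= h.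
have D2 x : D x -> \1_(snd @^-1` [set` `]c, +oo[]) x = 1 :> R.
  by move=> [/= _]; rewrite in_itv /= => /andP[h _]; rewrite indicE mem_set //= in_itv /= h.
have rays A B : G A -> G B ->
    \int[mu2]_(z in D) (\1_(fst @^-1` A) z * (\1_(snd @^-1` B) z * g z)) = 0.
  move=> [x ->] [y ->].
  rewrite -[RHS](boxes (Num.max a x) b (Num.max c y) d) ?le_max ?lexx //.
  apply: Rint_eq => z [/= h1 h2]; rewrite mulrA !indicE -natrM mulnb.
  congr ((nat_of_bool _)%:R * _); move: h1 h2; rewrite !in_itv /= => /andP[h1 h2] /andP[h3 h4].
  apply/andP/idP => [[/set_mem /= + /set_mem /=]|/set_mem[] /=].
    rewrite !in_itv /= !andbT => h5 h6; apply/mem_set.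
    by split=> /=; rewrite in_itv /= gt_max ?h1 ?h2 ?h3 ?h4 ?h5 ?h6.
  rewrite !in_itv /= !gt_max => /andP[/andP[_ h5] _] /andP[/andP[_ h6] _].
  by split; apply/mem_set; rewrite /= in_itv /= ?h5 ?h6.
have mpre1 A : measurable A -> measurable (fst @^-1` A : set (TR * TR)).
  by move=> mA; rewrite -[X in measurable X]setTI; exact: measurable_fst.
have mpre2 A : measurable A -> measurable (snd @^-1` A : set (TR * TR)).
  by move=> mA; rewrite -[X in measurable X]setTI; exact: measurable_snd.
have mG A : G A -> measurable A by move=> [x ->]; exact: measurable_itv.
have Ga : G [set` `]a, +oo[] by exists a.
have Gc : G [set` `]c, +oo[] by exists c.
have S1 A B : G B -> measurable A ->
    \int[mu2]_(z in D) (\1_(fst @^-1` A) z * (\1_(snd @^-1` B) z * g z)) = 0.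
  move=> GB; apply: (dynkin_integral0 mD _ _ RayI mRay).
  - by apply: rintegrable_indic => //; apply: mpre2; exact: mG.
  - exact: measurable_fst.
  - rewrite -[RHS](rays _ _ Ga GB); apply: Rint_eq => z Dz.
    by rewrite D1 // mul1r.
  - by move=> A' GA'; exact: rays.
have S2 A B : measurable A -> measurable B ->
    \int[mu2]_(z in D) (\1_(snd @^-1` B) z * (\1_(fst @^-1` A) z * g z)) = 0.
  move=> mA; apply: (dynkin_integral0 mD _ _ RayI mRay).
  - by apply: rintegrable_indic => //; exact: mpre1.
  - exact: measurable_snd.
  - rewrite -[RHS](S1 A _ Gc mA); apply: Rint_eq => z Dz.
    by rewrite D2 // mul1r.
  - move=> B' GB'; rewrite -[RHS](S1 A _ GB' mA); apply: Rint_eq => z _.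
    by rewrite mulrCA.
apply: (ae_zero_of_integrals mD Ig).
have := @dynkin_integral0 _ _ _ mu2 D mD g Ig _ (TR * TR)%type id
  [set A `*` B | A in @measurable _ TR & B in @measurable _ TR].
apply=> //.
- move=> _ _ [A mA [B mB <-]] [A' mA' [B' mB' <-]].
  exists (A `&` A'); first exact: measurableI.
  by exists (B `&` B'); [exact: measurableI|rewrite setXI].
- exact: measurable_prod_measurableType.
- rewrite -[RHS](S1 _ _ Gc (mG _ Ga)); apply: Rint_eq => z Dz.
  by rewrite D1 // D2 // !mul1r.
- move=> _ [A mA [B mB <-]]; rewrite -[RHS](S2 _ _ mA mB).
  apply: Rint_eq => z _; rewrite mulrA !indicE -natrM mulnb; congr ((nat_of_bool _)%:R * _).
  by apply/idP/andP => [/set_mem[h1 h2]|[/set_mem h1 /set_mem h2]]; [split|]; exact/mem_set.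
Qed.

End WeakGradient.

Lemma cvg0_scale (R : realType) (C : R) (x_ : nat -> R) :
  x_ n @[n --> \oo] --> (0 : R) -> C * x_ n @[n --> \oo] --> (0 : R).
Proof. by move=> cx; rewrite -(mulr0 C); exact: cvgMr. Qed.

(** * Weak gradients, Green's formula and traces *)

Section WeakGradientRect.
Context {R : realType}.
Local Notation leb := (@lebesgue_measure R).
Local Notation TR := (measurableTypeR R).
Local Notation mu2 := (leb \x leb)%E.
Variables (a b : R).
Hypothesis ab : a < b.

Local Notation Om := (box a b 0 1).
Local Notation sqi := (sqint mu2 Om).
Local Notation dot := (L2dot mu2 Om).
Implicit Types (u v : R * R -> R).

Lemma ip_dot u v : ip (rect a b) u v = dot u v.
Proof. by []. Qed.

Let mOm : measurable Om. Proof. exact: measurable_box. Qed.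
Let finOm : (mu2 Om < +oo)%E. Proof. exact: rect_finite. Qed.

Lemma sqint_continuous (f : R * R -> R) : continuous f -> sqi f.
Proof.
move=> cf; split.
  by apply: measurable_funTS; exact: continuous_measurable2.
apply: rect_continuous_integrable => p.
by apply: continuousM; exact: cf.
Qed.

Lemma sqint_rintegrable u : sqi u -> rintegrable mu2 Om u.
Proof.
move=> su; have s1 : sqi (fun=> 1) by apply: sqint_continuous; exact: cst_continuous.
by apply: rintegrable_eq (sqint_mul mOm su s1) => // x _; rewrite mulr1.
Qed.

Lemma test_fun2_sqint phi : test_fun2 Om phi ->
  [/\ sqi phi, sqi (pderiv false phi) & sqi (pderiv true phi)].
Proof.
move=> [sphi _]; split; apply: sqint_continuous.
- by case: (sphi [::]).
- by case: (sphi [:: false]).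
- by case: (sphi [:: true]).
Qed.

(** Makes [wgrad], a choice among weak gradients, computable and linear up to null sets. *)
Lemma weak_grad_unique u g h : is_weak_grad Om u g -> is_weak_grad Om u h ->
  {ae mu2, forall x, Om x -> g.1 x = h.1 x} /\
  {ae mu2, forall x, Om x -> g.2 x = h.2 x}.
Proof.
move=> [sg1 sg2 wg] [sh1 sh2 wh].
have key (x y : R * R -> R) : sqi x -> sqi y ->
    (forall phi, test_fun2 Om phi -> dot x phi = dot y phi) ->
    {ae mu2, forall z, Om z -> x z = y z}.
  move=> sx sy xy; have sd := sqintB mOm sx sy.
  have h0 : {ae mu2, forall z, Om z -> (x - y) z = 0}.
    apply: du_bois_reymond2; first exact: sqint_rintegrable.
    move=> phi tphi; have [sphi _ _] := test_fun2_sqint tphi.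
    by rewrite -/(dot (x - y) phi) dotBl // xy // subrr.
  by apply: filterS h0 => z h0 Oz; apply/eqP; rewrite -subr_eq0; apply/eqP; exact: h0.
split; apply: key => // phi tphi.
  have [[e _] [e' _]] := (wg _ tphi, wh _ tphi).
  by apply: oppr_inj; rewrite -[LHS]e -[RHS]e'.
have [[_ e] [_ e']] := (wg _ tphi, wh _ tphi).
by apply: oppr_inj; rewrite -[LHS]e -[RHS]e'.
Qed.

Lemma wgrad_spec u : W12 Om u -> is_weak_grad Om u (wgrad Om u).
Proof. by move=> [_ [g wg]]; apply: xgetPex; exists g. Qed.

Lemma is_weak_grad_linear k u v g h : sqi u -> sqi v ->
  is_weak_grad Om u g -> is_weak_grad Om v h ->
  is_weak_grad Om (k *: u + v) (k *: g.1 + h.1, k *: g.2 + h.2).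
Proof.
move=> su sv [sg1 sg2 wg] [sh1 sh2 wh].
split=> [||phi tphi] /=.
- exact: (sqintD mOm (sqintZ mOm k sg1) sh1).
- exact: (sqintD mOm (sqintZ mOm k sg2) sh2).
have [sphi s1 s2] := test_fun2_sqint tphi.
have [[e1 e2] [e1' e2']] := (wg _ tphi, wh _ tphi).
have alg (p q x y z w : R) : p = k * x + y -> q = k * z + w -> x = - z -> y = - w -> p = - q.
  by move=> -> -> -> ->; rewrite mulrN opprD.
split.
  exact: (alg _ _ _ _ _ _ (dot_combl mOm k su sv s1) (dot_combl mOm k sg1 sh1 sphi) e1 e1').
exact: (alg _ _ _ _ _ _ (dot_combl mOm k su sv s2) (dot_combl mOm k sg2 sh2 sphi) e2 e2').
Qed.

Lemma W12_linear k u v : W12 Om u -> W12 Om v -> W12 Om (k *: u + v).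
Proof.
move=> [su [g wg]] [sv [h wh]]; split.
  by apply: (sqintD mOm _ sv); exact: sqintZ.
by exists (k *: g.1 + h.1, k *: g.2 + h.2); exact: is_weak_grad_linear.
Qed.

Lemma W12B u v : W12 Om u -> W12 Om v -> W12 Om (u - v).
Proof.
by move=> wu wv; rewrite addrC -scaleN1r; exact: W12_linear.
Qed.

(** The function and its two partial derivatives as one family, so that statements on $W^{1,2}$ are
    proved once, componentwise in $L^2$. *)
Definition wcomp (i : option bool) u : R * R -> R :=
  match i with
  | None => u | Some false => (wgrad Om u).1 | Some true => (wgrad Om u).2
  end.

Lemma wcomp_sqint i u : W12 Om u -> sqi (wcomp i u).
Proof.
by move=> wu; have [s1 s2 _] := wgrad_spec wu; case: i => [[]|] //; case: wu.
Qed.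

Lemma wcomp_linear i k u v : W12 Om u -> W12 Om v ->
  {ae mu2, forall z, Om z ->
    wcomp i (k *: u + v) z = (k *: wcomp i u + wcomp i v) z}.
Proof.
move=> wu wv; case: i => [i|]; last by apply: aeW.
have [su _] := wu; have [sv _] := wv.
have [h1 h2] := weak_grad_unique (wgrad_spec (W12_linear k wu wv))
  (is_weak_grad_linear k su sv (wgrad_spec wu) (wgrad_spec wv)).
by case: i.
Qed.

Lemma wcompB i u v : W12 Om u -> W12 Om v ->
  {ae mu2, forall z, Om z -> wcomp i (u - v) z = (wcomp i u - wcomp i v) z}.
Proof.
move=> wu wv; have := wcomp_linear i (-1) wv wu.
have -> : u - v = (-1) *: v + u by rewrite scaleN1r addrC.
by have -> : wcomp i u - wcomp i v = (-1) *: wcomp i v + wcomp i u by rewrite scaleN1r addrC.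
Qed.

Lemma W12norm_sqr u : W12norm Om u ^+ 2 =
  dot (wcomp None u) (wcomp None u) + dot (wcomp (Some false) u) (wcomp (Some false) u)
  + dot (wcomp (Some true) u) (wcomp (Some true) u).
Proof.
rewrite /W12norm sqr_sqrtr; last by rewrite !addr_ge0 // sqr_ge0.
by rewrite /L2norm !sqr_sqrtr //; exact: dot_ge0.
Qed.

Lemma wcomp_le i u : dot (wcomp i u) (wcomp i u) <= W12norm Om u ^+ 2.
Proof.
rewrite W12norm_sqr; have h j := dot_ge0 mu2 Om (wcomp j u).
case: i => [[]|].
- by rewrite lerDr addr_ge0.
- by rewrite -addrA addrCA lerDl addr_ge0.
- by rewrite -addrA lerDl addr_ge0.
Qed.

Lemma wcompB_le i u v : W12 Om u -> W12 Om v ->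
  dot (wcomp i u - wcomp i v) (wcomp i u - wcomp i v) <= W12norm Om (u - v) ^+ 2.
Proof.
move=> wu wv; have su := wcomp_sqint i wu; have sv := wcomp_sqint i wv.
have sd := wcomp_sqint i (W12B wu wv); have sB := sqintB mOm su sv.
have e := wcompB i wu wv.
by rewrite -(dot_ae_eq mOm sd sB sd sB e e); exact: wcomp_le.
Qed.

Lemma smooth2_is_derive (f : R * R -> R) i p : smooth2 f ->
  is_derive (Defs.coord i p) 1 (slice i f p) (pderiv i f p).
Proof.
by move=> sf; have [_ df] := sf [::]; apply: derivable_is_derive; exact: df.
Qed.

Lemma smooth2_continuous (f : R * R -> R) : smooth2 f -> continuous f.
Proof. by move=> sf; case: (sf [::]). Qed.

Lemma pderiv_continuous (f : R * R -> R) i : smooth2 f -> continuous (pderiv i f).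
Proof. by move=> sf; case: (sf [:: i]). Qed.

(** The derivative of [f * phi] integrates to its boundary values, which vanish because the support
    of [phi] lies in the open rectangle. *)
Lemma smooth2_weak_grad (f : R * R -> R) : smooth2 f ->
  is_weak_grad Om f (pderiv false f, pderiv true f).
Proof.
move=> sf; split.
- by apply: sqint_continuous; exact: pderiv_continuous.
- by apply: sqint_continuous; exact: pderiv_continuous.
move=> phi tphi; have [sphi [K [cK KO phi0]]] := tphi.
have [sqphi s1 s2] := test_fun2_sqint tphi.
have sqf := sqint_continuous (smooth2_continuous sf).
have cprod i : continuous (fun p => f p * pderiv i phi p + phi p * pderiv i f p).
  move=> p; apply: (@continuousD _ _ _ (fun p => f p * pderiv i phi p)).
    apply: continuousM; [exact: smooth2_continuous|exact: pderiv_continuous].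
  by apply: continuousM; [exact: smooth2_continuous|exact: pderiv_continuous].
have key i : \int[mu2]_(p in Om) (f p * pderiv i phi p + phi p * pderiv i f p) = 0 ->
    ip Om f (pderiv i phi) = - ip Om (pderiv i f) phi.
  have sqe : sqi (pderiv i phi) by case: (i).
  have sqd : sqi (pderiv i f) by apply: sqint_continuous; exact: pderiv_continuous.
  rewrite RintegralD //; [|exact: sqint_mul..].
  move=> /eqP; rewrite addr_eq0 => /eqP e; rewrite [LHS]e; congr (- _).
  by rewrite -/(dot phi (pderiv i f)) dotC.
split; apply: key.
  have dF (p : R * R) : is_derive p.1 1 (fun r : R => f (r, p.2) * phi (r, p.2))
      (f p * pderiv false phi p + phi p * pderiv false f p).
    case: p => x y; exact: (is_deriveM (@smooth2_is_derive f false (x, y) sf)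
      (@smooth2_is_derive phi false (x, y) sphi)).
  rewrite (@rect_FTC1 R (fun p => f p * phi p) _ a b 0 1 (ltW ab) dF (cprod false)).
  rewrite (@Rint_eq _ _ _ _ _ _ (fun=> 0)) ?Rintegral_cst ?mul0r // => y _.
  rewrite !phi0 ?mulr0 ?subrr //.
    by move=> /KO[/=]; rewrite in_itv /= ltxx.
  by move=> /KO[/=]; rewrite in_itv /= ltxx andbF.
have dF (p : R * R) : is_derive p.2 1 (fun r : R => f (p.1, r) * phi (p.1, r))
    (f p * pderiv true phi p + phi p * pderiv true f p).
  case: p => x y; exact: (is_deriveM (@smooth2_is_derive f true (x, y) sf)
    (@smooth2_is_derive phi true (x, y) sphi)).
rewrite (@rect_FTC2 R (fun p => f p * phi p) _ a b 0 1 ler01 dF (cprod true)).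
rewrite (@Rint_eq _ _ _ _ _ _ (fun=> 0)) ?Rintegral_cst ?mul0r // => y _.
rewrite !phi0 ?mulr0 ?subrr //.
  by move=> /KO[_ /=]; rewrite in_itv /= ltxx.
by move=> /KO[_ /=]; rewrite in_itv /= ltxx andbF.
Qed.

Lemma smooth2_W12 (f : R * R -> R) : smooth2 f -> W12 Om f.
Proof.
move=> sf; split; first by apply: sqint_continuous; exact: smooth2_continuous.
by exists (pderiv false f, pderiv true f); exact: smooth2_weak_grad.
Qed.

(* [green s c u] is the integral over [0 < y < c] of the trace of [u] on the
   side [s], written as the integral of [d/dx (eta u)] with [eta] affine in [x],
   equal to [0] on one vertical side and to [+-1] on the other. *)
Definition green_weight (s : side) (c : R) (p : R * R) : R :=
  \1_([set q : TR * TR | q.2 < c]) p *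
  ((p.1 - (if s is Right then a else b)) * (b - a)^-1).

Definition green_weight0 (c : R) (p : R * R) : R :=
  \1_([set q : TR * TR | q.2 < c]) p * (b - a)^-1.

Definition green (s : side) (c : R) u : R :=
  dot (wcomp (Some false) u) (green_weight s c) + dot u (green_weight0 c).

Let mlow (c : R) : measurable [set q : TR * TR | q.2 < c].
Proof.
have -> : [set q : TR * TR | q.2 < c] = snd @^-1` [set` `]-oo, c[].
  by apply/seteqP; split => p /=; rewrite in_itv /=.
by rewrite -[X in measurable X]setTI; exact: measurable_snd.
Qed.

Let sqint_low c (f : R * R -> R) : continuous f ->
  sqi (fun p => \1_([set q : TR * TR | q.2 < c]) p * f p).
Proof.
move=> cf; have sf := sqint_continuous cf.
apply: (sqint_wmul mOm (M := 1)) => //.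
by move=> p _; rewrite indicE; case: (p \in _); rewrite ?normr1 ?normr0.
Qed.

Lemma continuous_affine1 (e k : R) : continuous (fun p : R * R => (p.1 - e) * k).
Proof.
move=> p; have h : {for p, continuous (fun p : R * R => p.1 - e)}.
  apply: (@continuousB _ _ _ (fst : R * R -> R) (cst e)); first exact: cvg_fst.
  exact: cst_continuous.
exact: (continuousM h (@cst_continuous _ _ k p)).
Qed.

Lemma green_weight_sqint s c : sqi (green_weight s c).
Proof.
apply: (@sqint_low c (fun p => (p.1 - (if s is Right then a else b)) * (b - a)^-1)).
exact: continuous_affine1.
Qed.

Lemma green_weight0_sqint c : sqi (green_weight0 c).
Proof. by apply: (@sqint_low c (fun=> (b - a)^-1)); exact: cst_continuous. Qed.

Lemma green_linear s c k u v : W12 Om u -> W12 Om v ->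
  green s c (k *: u + v) = k * green s c u + green s c v.
Proof.
move=> wu wv; have s1 := green_weight_sqint s c; have s0 := green_weight0_sqint c.
have su := wcomp_sqint (Some false) wu; have sv := wcomp_sqint (Some false) wv.
have [su0 sv0] := (wcomp_sqint None wu, wcomp_sqint None wv).
have sw := wcomp_sqint (Some false) (W12_linear k wu wv).
have sl : sqi (k *: wcomp (Some false) u + wcomp (Some false) v).
  by apply: sqintD => //; exact: sqintZ.
have L1 : dot (wcomp (Some false) (k *: u + v)) (green_weight s c) =
    k * dot (wcomp (Some false) u) (green_weight s c) + dot (wcomp (Some false) v) (green_weight s c).
  rewrite (dot_ae_eq mOm sw sl s1 s1 (wcomp_linear _ k wu wv)); last exact: aeW.
  exact: (dot_combl mOm k su sv s1).
have L2 : dot (k *: u + v) (green_weight0 c) =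
    k * dot u (green_weight0 c) + dot v (green_weight0 c).
  exact: (dot_combl mOm k su0 sv0 s0).
rewrite /green L1 L2.
have alg (x y z t : R) : k * x + y + (k * z + t) = k * (x + z) + (y + t) by ring.
exact: alg.
Qed.

Lemma green_smooth s c (w : R * R -> R) : (s = Left) \/ (s = Right) -> 0 < c < 1 ->
  smooth2 w -> green s c w =
  \int[leb]_(y in `]0, 1[) (\1_(`]-oo, c[) y * w (side_pt a b s y)).
Proof.
move=> hs c01 sw; have [c0 c1] := andP c01.
have ww := smooth2_W12 sw.
have ba0 : b - a != 0 by rewrite subr_eq0 gt_eqF.
have cw := smooth2_continuous sw; have cdw := @pderiv_continuous w false sw.
have [e1 _] := weak_grad_unique (wgrad_spec ww) (smooth2_weak_grad sw).
have s1 := green_weight_sqint s c; have s0 := green_weight0_sqint c.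
rewrite /green (dot_ae_eq mOm (wcomp_sqint (Some false) ww)
  (sqint_continuous cdw) s1 s1 e1); last exact: aeW.
rewrite -RintegralD //; last 2 first.
- by apply: sqint_mul => //; exact: sqint_continuous.
- by apply: sqint_mul => //; exact: sqint_continuous.
pose e0 := if s is Right then a else b.
pose eta (p : R * R) := (p.1 - e0) * (b - a)^-1.
pose dF (p : R * R) := w p * (b - a)^-1 + eta p * pderiv false w p.
rewrite (@Rint_eq _ _ _ _ _ _ (fun p => \1_([set q : TR * TR | q.2 < c]) p * dF p)); last first.
  have alg (i x y z k : R) : y * (i * (x * k)) + z * (i * k) = i * (z * k + x * k * y).
    by ring.
  by move=> p _; exact: alg.
have ceta : continuous eta by exact: continuous_affine1.
have cdF : continuous dF.
  move=> p; apply: (@continuousD _ _ _ (fun p => w p * (b - a)^-1)).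
    by apply: continuousM; [exact: cw|exact: cst_continuous].
  by apply: continuousM; [exact: ceta|exact: cdw].
rewrite Rint_indic (_ : _ `&` _ = box a b 0 c); last first.
  apply/seteqP; split => [[x y] /= [[h1 /=]]|[x y] [/= h1]]; rewrite in_itv /=.
    by move=> /andP[y0 _] yc; split=> //=; rewrite in_itv /= y0.
  move=> /andP[y0 yc]; split=> //; split=> //=.
  by rewrite in_itv /= y0 (lt_trans yc).
have dwe (p : R * R) : is_derive p.1 1 (fun r : R => w (r, p.2) * eta (r, p.2)) (dF p).
  case: p => x y; have d1 := @smooth2_is_derive w false (x, y) sw.
  have d2 : is_derive x 1 (fun r : R => eta (r, y)) (b - a)^-1.
    have -> : (fun r : R => eta (r, y)) = (fun r => (b - a)^-1 * r + - (e0 * (b - a)^-1)).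
      by apply/funext => r; rewrite /eta /=; ring.
    have := @is_derive_affine R id (b - a)^-1 (- (e0 * (b - a)^-1)) x 1 (is_derive_id _ _).
    by rewrite mulr1.
  exact: (is_deriveM d1 d2).
rewrite (@rect_FTC1 R (fun p => w p * eta p) dF a b 0 c (ltW ab) dwe cdF).
rewrite Rint_indic (_ : _ `&` _ = [set` `]0, c[]); last first.
  apply/seteqP; split => y /=; rewrite !in_itv /=.
    by move=> [/andP[-> _] ->].
  by move=> /andP[y0 yc]; rewrite y0 (lt_trans yc).
apply: Rint_eq => y _; rewrite /eta /e0 /=.
(* On the left side [eta] is [-1], which cancels the sign of the lower end point; both sides thus
   yield the trace with the same sign. *)
case: hs => -> /=; rewrite !subrr !mul0r mulr0.
  by rewrite sub0r -mulrN -mulNr opprB divff // mulr1.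
by rewrite divff // mulr1 subr0.
Qed.

Lemma green_le s c : exists2 C, 0 <= C & forall u, W12 Om u ->
  `|green s c u| <= C * W12norm Om u.
Proof.
have s1 := green_weight_sqint s c; have s0 := green_weight0_sqint c.
exists (Num.sqrt (dot (green_weight s c) (green_weight s c)) +
  Num.sqrt (dot (green_weight0 c) (green_weight0 c))).
  by rewrite addr_ge0 // sqrtr_ge0.
move=> u wu.
have bd i (z : R * R -> R) : sqi z ->
    `|dot (wcomp i u) z| <= Num.sqrt (dot z z) * W12norm Om u.
  move=> sz; rewrite (le_trans (dot_CS mOm (wcomp_sqint i wu) sz)) //.
  rewrite mulrC ler_wpM2l ?sqrtr_ge0 // -[leRHS]ger0_norm ?sqrtr_ge0 //.
  by rewrite -sqrtr_sqr ler_wsqrtr // wcomp_le.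
by rewrite (le_trans (ler_normD _ _)) // mulrDl lerD //; [exact: bd|exact: (bd None)].
Qed.

Lemma greenB s c u v : W12 Om u -> W12 Om v ->
  green s c (u - v) = green s c u - green s c v.
Proof.
move=> wu wv; have := green_linear s c (-1) wv wu.
by rewrite scaleN1r addrC => ->; rewrite mulN1r addrC.
Qed.

(** Green's formula for the smooth approximations that define the trace: its left-hand side is
    continuous for the $W^{1,2}$ norm, its right-hand side for the $L^2$ norm on the side. *)
Lemma green_trace s c u g : (s = Left) \/ (s = Right) -> 0 < c < 1 ->
  has_trace a b u g ->
  rintegrable leb `]0, 1[ (g s) /\
  green s c u = \int[leb]_(y in `]0, 1[) (\1_(`]-oo, c[) y * g s y).
Proof.
move=> hs c01 [wu gL2 [w [sw wcvg tcvg]]].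
have sdom : side_dom a b s = [set` `]0, 1[] by case: hs => ->.
have m01 : measurable ([set` `]0, 1[] : set TR) by exact: measurable_itv.
have fin01 : (leb [set` `]0%R, 1%R[] < +oo)%E by rewrite lebesgue_measure_itv /= lte_fin ltr01 -EFinD ltry.
have sg : sqint leb `]0, 1[ (g s) by have := gL2 s; rewrite sdom => -[].
have s1 : sqint leb `]0, 1[ (fun=> 1 : R).
  split; first exact: measurable_cst.
  exact: rintegrable_cst.
have swn n : sqint leb `]0, 1[ (fun y => w n (side_pt a b s y)).
  have cs : continuous (fun y => w n (side_pt a b s y)).
    by case: hs => ->; [exact: (continuous_slice a (smooth2_continuous (sw n))).2
      |exact: (continuous_slice b (smooth2_continuous (sw n))).2].
  have cs2 : continuous (fun y => w n (side_pt a b s y) ^+ 2).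
    by move=> y; apply: (@continuousM _ _ _ _ _ (cs y) (cs y)).
  split; first by apply: measurable_funTS; exact: continuous_measurable_fun.
  have I01 : rintegrable leb `[0, 1] (fun y => w n (side_pt a b s y) ^+ 2).
    apply: continuous_compact_integrable; first exact: segment_compact.
    exact: continuous_subspaceT.
  by apply: (integrableS _ _ _ I01) => //; exact: subset_itv_oo_cc.
have Ig : rintegrable leb `]0, 1[ (g s).
  by apply: rintegrable_eq (sqint_mul m01 sg s1) => // y _; rewrite mulr1.
split=> //.
have sind : sqint leb `]0, 1[ (\1_(`]-oo, c[) : R -> R).
  split; first by apply: measurable_funTS; exact: measurable_indic.
  apply: (rintegrable_le m01 _ _ (rintegrable_cst m01 1 fin01)).
    apply: measurable_funX; apply: measurable_funTS; exact: measurable_indic.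
  by move=> y _; rewrite indicE; case: (y \in _); rewrite ?expr1n ?normr1 ?expr0n ?normr0.
have cg : green s c (w n) @[n --> \oo] --> green s c u.
  apply/subr_cvg0; have [C C0 hC] := green_le s c.
  apply: (@cvg0_le _ _ (fun n => C * W12norm Om (w n - u))).
    exact: (@cvg0_scale R C (fun n => W12norm Om (w n - u)) wcvg).
  by move=> n; have ww := smooth2_W12 (sw n); rewrite -greenB //; apply: hC; exact: W12B.
have ct : \int[leb]_(y in `]0, 1[) (\1_(`]-oo, c[) y * w n (side_pt a b s y)) @[n --> \oo] -->
    \int[leb]_(y in `]0, 1[) (\1_(`]-oo, c[) y * g s y).
  have sd n : sqint leb `]0, 1[ ((fun y => w n (side_pt a b s y)) - g s).
    exact: sqintB.
  have tc := tcvg s; rewrite sdom in tc.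
  have [||_ tc0] := @ereal_int_cvg0 _ _ _ leb [set` `]0, 1[]
    (fun n y => (w n (side_pt a b s y) - g s y) ^+ 2) _ _ tc.
  - by move=> n; case: (sd n) => md _; apply: measurable_funX.
  - by move=> n y _; exact: sqr_ge0.
  apply/subr_cvg0.
  apply: (@cvg0_le _ _ (fun n => Num.sqrt (L2dot leb `]0, 1[ (\1_(`]-oo, c[)) (\1_(`]-oo, c[)))
     * Num.sqrt (\int[leb]_(y in `]0, 1[) ((w n (side_pt a b s y) - g s y) ^+ 2)))).
    exact: (cvg0_scale _ (sqrt_cvg0 tc0)).
  move=> n; rewrite -/(L2dot leb `]0, 1[ (\1_(`]-oo, c[)) (g s)).
  rewrite -/(L2dot leb `]0, 1[ (\1_(`]-oo, c[)) (fun y => w n (side_pt a b s y))) -dotBr //.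
  exact: dot_CS.
have e : (fun n => green s c (w n)) =
    (fun n => \int[leb]_(y in `]0, 1[) (\1_(`]-oo, c[) y * w n (side_pt a b s y))).
  by apply/funext => n; exact: green_smooth.
rewrite e in cg; exact: (cvg_unique _ cg ct).
Qed.

End WeakGradientRect.

(** * Boundedness of weakly convergent sequences *)

Section GlidingHump.
Context (R : realType) (V : Type) (X : set V) (comb : R -> V -> V -> V).
Variables (nrm : V -> R) (beta : nat -> V -> R) (x : nat -> V).
Hypothesis beta_lin : forall n a u v, X u -> X v ->
  beta n (comb a u v) = a * beta n u + beta n v.
Hypothesis beta_le : forall n v, X v -> `|beta n v| <= nrm v.
Hypothesis Xx : forall n, X (x n).
Hypothesis beta_x : forall n, beta n (x n) = nrm (x n).

(** With ratio one third, the terms after rank [k] sum to half of the bound on the [k]-th term, so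
    they cannot compensate it. *)
Let th : R := 3^-1.

(* The sign is chosen so that the new term does not cancel the previous ones
   at [x (idx k)]. *)
Fixpoint hump (idx : nat -> nat) (k : nat) (v : V) : R :=
  if k is k'.+1 then
    hump idx k' v + (if 0 <= hump idx k' (x (idx k')) then 1 else -1) *
      th ^+ k' * beta (idx k') v
  else 0.

Let th0 : 0 < th. Proof. by rewrite invr_gt0. Qed.
Let thE : th * 3 = 1. Proof. by rewrite mulVf. Qed.

Lemma hump_lin idx k a u v : X u -> X v ->
  hump idx k (comb a u v) = a * hump idx k u + hump idx k v.
Proof.
move=> Xu Xv; elim: k => [|k IHk] /=; first by rewrite mulr0 addr0.
by rewrite IHk beta_lin //; ring.
Qed.

Lemma hump_step idx k v : X v -> `|hump idx k.+1 v - hump idx k v| <= th ^+ k * nrm v.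
Proof.
move=> Xv /=; rewrite addrC addKr !normrM.
rewrite [X in X * _ * _](_ : _ = 1); last by case: ifP; rewrite ?normrN normr1.
by rewrite mul1r ger0_norm ?exprn_ge0 ?(ltW th0) // ler_wpM2l ?exprn_ge0 ?(ltW th0) // beta_le.
Qed.

Lemma hump_tail idx k m v : X v ->
  `|hump idx (k + m) v - hump idx k v| <= 3 / 2 * (th ^+ k - th ^+ (k + m)) * nrm v.
Proof.
move=> Xv; elim: m => [|m IHm]; first by rewrite addn0 !subrr normr0 mulr0 mul0r.
rewrite addnS -(subrK (hump idx (k + m) v) (hump idx (k + m).+1 v)) -addrA.
rewrite (le_trans (ler_normD _ _)) // (le_trans (lerD (hump_step idx (k + m) Xv) IHm)) //.
rewrite exprS; have := thE; move: (th ^+ (k + m)) (th ^+ k) (nrm v) => p q r e.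
have -> : 3 / 2 * (q - th * p) * r = 3 / 2 * q * r - (th * 3) * p * r / 2 by field.
rewrite e; have -> : p * r + 3 / 2 * (q - p) * r = 3 / 2 * q * r - 1 * p * r / 2 by field.
exact: lexx.
Qed.

Lemma nrm_ge0 v : X v -> 0 <= nrm v.
Proof. by move=> Xv; exact: le_trans (beta_le 0 Xv). Qed.

Lemma hump_tail_le idx k m v : X v -> (k <= m)%N ->
  `|hump idx m v - hump idx k v| <= 3 / 2 * th ^+ k * nrm v.
Proof.
move=> Xv km; rewrite -(subnKC km) (le_trans (hump_tail idx k _ Xv)) //.
rewrite ler_wpM2r ?nrm_ge0 // ler_wpM2l // lerBlDr lerDl exprn_ge0 //.
exact: ltW.
Qed.

Lemma th_cvg0 : th ^+ n @[n --> \oo] --> (0 : R).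
Proof. by apply: cvg_expr; rewrite ger0_norm ?(ltW th0) // /th; lra. Qed.

Lemma hump_cvg idx v : X v -> cvgn (fun k => hump idx k v).
Proof.
(* Subtracting the bound on the geometric tail makes the sequence monotone and bounded, hence
   convergent. *)
move=> Xv; pose a k := hump idx k v - 3 / 2 * th ^+ k * nrm v.
have ca : cvgn a.
  apply: nondecreasing_is_cvgn.
    move=> k m km; rewrite -(subnKC km); have := hump_tail idx k (m - k) Xv.
    by rewrite /a ler_norml => /andP[h _]; move: h; rewrite mulrBr mulrBl; lra.
  exists (3 / 2 * nrm v) => _ [k _ <-]; have := hump_tail_le idx Xv (leq0n k).
  rewrite subr0 expr0 mulr1 ler_norml => /andP[_ h].
  rewrite /a (le_trans _ h) // gerBl mulr_ge0 ?nrm_ge0 // mulr_ge0 //.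
  by rewrite exprn_ge0 // ltW.
have -> : (fun k => hump idx k v) = (fun k => a k + 3 / 2 * nrm v * th ^+ k).
  by apply/funext => k; rewrite /a; ring.
apply: is_cvgD => //; apply: is_cvgMr; apply/cvg_ex; exists (0 : R).
exact: th_cvg0.
Qed.

Definition hump_lim idx v : R := limn (fun k => hump idx k v).

Lemma hump_lim_le idx k v : X v ->
  `|hump_lim idx v - hump idx k v| <= 3 / 2 * th ^+ k * nrm v.
Proof.
move=> Xv; have c := @hump_cvg idx v Xv.
have : `|hump idx m v - hump idx k v| @[m --> \oo] --> `|hump_lim idx v - hump idx k v|.
  by apply: cvg_norm; apply: cvgB => //; exact: cvg_cst.
move/cvgr_to_le; apply; near=> m; apply: hump_tail_le => //.
by near: m; exact: nbhs_infty_ge.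
Unshelve. all: by end_near.
Qed.

(** If the norms were unbounded, indices could be chosen with [nrm (x (idx k))] above
    [2 * 3 ^+ k * k]. At [x (idx k)] the partial sum through term [k] has size at least
    [th ^+ k * nrm (x (idx k))] and the tail at most half of it, so the limit functional exceeds
    every [k]. Completeness is used only for real series; the space [V] enters through [comb]
    alone. *)
Lemma gliding_hump :
  (forall l : V -> R,
    (forall a u v, X u -> X v -> l (comb a u v) = a * l u + l v) ->
    (exists C, forall v, X v -> `|l v| <= C * nrm v) ->
    exists B, forall n, `|l (x n)| <= B) ->
  exists B, forall n, nrm (x n) <= B.
Proof.
move=> bl; apply: contrapT => unb.
have [idx hidx] : exists idx : nat -> nat, forall k, 2 * 3 ^+ k * k%:R < nrm (x (idx k)).
  suff h : forall k, exists n, 2 * 3 ^+ k * k%:R < nrm (x n).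
    by have [f hf] := choice h; exists f.
  move=> k; apply: contrapT => h; apply: unb; exists (2 * 3 ^+ k * k%:R) => n.
  by rewrite leNgt; apply/negP => ?; apply: h; exists n.
have [||B hB] := bl (hump_lim idx).
- move=> a u v Xu Xv; apply: cvg_lim => //.
  rewrite (_ : (fun k => _) = (fun k => a * hump idx k u + hump idx k v)).
    by apply: cvgD; [apply: cvgMr|]; exact: hump_cvg.
  by apply/funext => k; exact: hump_lin.
- exists (3 / 2) => v Xv; have := hump_lim_le idx 0 Xv.
  by rewrite /= subr0 expr0 mulr1.
have [k _ /(_ k (leqnn k)) kB] : \forall k \near \oo, B < k%:R by exact: nbhs_infty_gtr.
have Xk := Xx (idx k).
have h1 := hump_lim_le idx k.+1 Xk.
have h2 : th ^+ k * nrm (x (idx k)) <= `|hump idx k.+1 (x (idx k))|.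
  rewrite /= beta_x; have p0 : 0 <= th ^+ k * nrm (x (idx k)).
    by rewrite mulr_ge0 ?nrm_ge0 // exprn_ge0 // ltW.
  case: ifP => [h0|/negbT]; first by rewrite mul1r ger0_norm ?addr_ge0 // lerDr.
  by rewrite -ltNge => h0; rewrite mulN1r mulNr ler0_norm; lra.
have h3 : k%:R <= th ^+ k * nrm (x (idx k)) / 2.
  have e3 : th ^+ k * 3 ^+ k = 1 by rewrite -exprMn thE expr1n.
  have := ltW (hidx k); rewrite -(ler_pM2l (_ : 0 < th ^+ k)) ?exprn_gt0 //.
  have -> : th ^+ k * (2 * 3 ^+ k * k%:R) = 2 * k%:R * (th ^+ k * 3 ^+ k) by ring.
  by rewrite e3; lra.
have h4 : 3 / 2 * th ^+ k.+1 * nrm (x (idx k)) = th ^+ k * nrm (x (idx k)) / 2.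
  rewrite exprS; have -> : 3 / 2 * (th * th ^+ k) * nrm (x (idx k)) =
     (th * 3) * (th ^+ k * nrm (x (idx k)) / 2) by field.
  by rewrite thE mul1r.
rewrite h4 in h1; have h5 := hB (idx k).
have : `|hump idx k.+1 (x (idx k))| <= `|hump_lim idx (x (idx k))| +
    `|hump_lim idx (x (idx k)) - hump idx k.+1 (x (idx k))|.
  rewrite [X in _ <= _ + X]distrC -{1}(subrK (hump_lim idx (x (idx k))) (hump idx k.+1 _)) addrC.
  exact: ler_normD.
by move: h1 h2 h3 h5 kB; lra.
Qed.

End GlidingHump.

(** * Lipschitz bounds and uniform moduli from derivatives *)

Section UniformModulus.
Context {R : realType}.

Lemma C1_lipschitz (g : R -> R) (L : R) : C1 g -> (forall x, `|derive1 g x| <= L) ->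
  forall x y, `|g x - g y| <= L * `|x - y|.
Proof.
move=> [dg _] gL x y.
have L0 : 0 <= L by exact: le_trans (gL 0).
wlog xy : x y / x <= y.
  move=> h; have [/h //|/ltW /h] := leP x y.
  by rewrite distrC [`|y - x|]distrC.
move: xy; rewrite le_eqVlt => /predU1P[->|xy]; first by rewrite !subrr normr0 mulr0.
have cg := derivable_is_continuous dg.
have [z _ e] := @MVT R g (derive1 g) x y xy (fun z _ => derivable_is_derive (dg z))
  (@continuous_subspaceT _ _ _ _ cg).
rewrite distrC e normrM [`|x - y|]distrC; exact: ler_wpM2r.
Qed.

(* A bounded increasing function oscillates by less than [e] outside a compact
   interval, and a [C1] function is Lipschitz on that interval. *)
Lemma C1_incr_almost_lip (k : R -> R) (m M : R) : C1 k -> 0 <= m ->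
  (forall x, 0 < derive1 k x) -> (forall x, m <= k x < M) -> almost_lip k M.
Proof.
move=> [dk ck'] m0 k'0 kb.
have ck := derivable_is_continuous dk.
have k_incr x y : x <= y -> k x <= k y.
  rewrite le_eqVlt => /predU1P[->|xy] //.
  have [z _ e] := @MVT R k (derive1 k) x y xy (fun z _ => derivable_is_derive (dk z))
    (@continuous_subspaceT _ _ _ _ ck).
  by rewrite -subr_ge0 e mulr_ge0 ?(ltW (k'0 _)) // subr_ge0 ltW.
split=> // [x|e e0].
  by have /andP[h1 h2] := kb x; rewrite ger0_norm ?(ltW h2) // (le_trans m0).
pose E := range k.
have sE : has_sup E.
  by split; [exists (k 0), 0|exists M => _ [x _ <-]; have /andP[_ /ltW] := kb x].
have iE : has_inf E.
  by split; [exists (k 0), 0|exists m => _ [x _ <-]; have /andP[] := kb x].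
have e2 : 0 < e / 2 by rewrite divr_gt0.
have [_ [B _ <-] hB] := sup_adherent e2 sE.
have [_ [A _ <-] hA] := inf_adherent e2 iE.
have kA x : k A <= k x + e / 2.
  rewrite (le_trans (ltW hA)) // lerD2r; apply: ge_inf; last by exists x.
  by case: iE.
have kB x : k x <= k B + e / 2.
  rewrite -lerBlDr (le_trans _ (ltW hB)) // lerD2r; apply: ub_le_sup; last by exists x.
  by case: sE.
(* [A] and [B] are points where [k] is nearly minimal and nearly maximal; the choice by [sup] and
   [inf] does not order them. *)
pose A' := Num.min A B; pose B' := Num.max A B.
have AB : A' <= B' by rewrite /A' /B' ge_min le_max lexx.
have [c _ hc] := @EVT_max R (fun x => derive1 k x) A' B' AB (@continuous_subspaceT _ _ _ _ ck').
pose L := derive1 k c.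
have L0 : 0 <= L by rewrite ltW // k'0.
exists L => // x y.
wlog xy : x y / x <= y.
  move=> h; have [/h //|/ltW /h] := leP x y.
  by rewrite distrC [`|y - x|]distrC.
pose cl z := clamp A' B' z.
have clA z : A' <= cl z by have /andP[] := clamp_bounds z AB.
have clB z : cl z <= B' by have /andP[] := clamp_bounds z AB.
have cl_incr z t : z <= t -> cl z <= cl t.
  by move=> /(clamp_incr A' B') /andP[]; rewrite subr_ge0.
have cl_lip z t : z <= t -> cl t - cl z <= t - z.
  by move=> /(clamp_incr A' B') /andP[].
(* Moving a point into [[A', B']] changes [k] by at most [e / 2]; each of the two points costs this
   once. *)
have k1 z : k z <= k (cl z) + e / 2.
  have [zB|Bz] := leP z B'.
    have : k z <= k (cl z) by apply: k_incr; rewrite /cl /clamp min_l // le_max lexx orbT.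
    by move/le_trans; apply; rewrite lerDl ltW.
  rewrite (le_trans (kB z)) // lerD2r; apply: k_incr.
  by rewrite /cl /clamp min_r ?(ltW Bz) // max_r // /B' le_max lexx orbT.
have k2 z : k (cl z) <= k z + e / 2.
  have [Az|zA] := leP A' z.
    have : k (cl z) <= k z by apply: k_incr; rewrite /cl /clamp ge_max Az ge_min lexx.
    by move/le_trans; apply; rewrite lerDl ltW.
  rewrite (le_trans _ (kA z)) //; apply: k_incr.
  by rewrite /cl /clamp min_l ?max_l ?(ltW zA) ?(le_trans (ltW zA)) // /A' ge_min lexx.
rewrite distrC ger0_norm ?subr_ge0 ?k_incr // [`|x - y|]distrC ger0_norm ?subr_ge0 //.
have kcl : k (cl y) - k (cl x) <= L * (y - x).
  have := cl_incr _ _ xy; rewrite le_eqVlt => /predU1P[->|clxy].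
    by rewrite subrr mulr_ge0 // subr_ge0.
  have [z zxy ->] := @MVT R k (derive1 k) _ _ clxy (fun z _ => derivable_is_derive (dk z))
    (@continuous_subspaceT _ _ _ _ ck).
  rewrite (le_trans (ler_wpM2r _ (hc z _))) ?subr_ge0 ?(ltW clxy) //.
    move: zxy; rewrite !in_itv /= => /andP[h1 h2].
    by rewrite (le_trans (clA x) (ltW h1)) (le_trans (ltW h2) (clB y)).
  by rewrite ler_wpM2l // cl_lip.
have := k1 y; have := k2 x; lra.
Qed.

End UniformModulus.

(** * Functions on a side determined by integrals below rational heights *)

Section OneDimensionalTrace.
Context {R : realType}.
Local Notation leb := (@lebesgue_measure R).
Local Notation TR := (measurableTypeR R).

(** Countably many conditions suffice: a real height is approached from below by rational ones under
    dominated convergence, and the rays generate the Borel sets. *)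
Lemma ae_zero_of_rational_rays (g : R -> R) : rintegrable leb `]0, 1[ g ->
  (forall q : rat, 0 < (ratr q : R) < 1 ->
    \int[leb]_(y in `]0, 1[) (\1_(`]-oo, ratr q[) y * g y) = 0) ->
  {ae leb, forall y, 0 < y < 1 -> g y = 0}.
Proof.
move=> Ig gq; pose D : set TR := [set` `]0, 1[].
have mD : measurable D by exact: measurable_itv.
have gc c : 0 < c <= 1 -> \int[leb]_(y in D) (\1_(`]-oo, c[) y * g y) = 0.
  move=> /andP[c0 c1].
  (* The lower bound is already nonnegative at [n = 0], so every chosen rational lies in []0,
     1[]. *)
  have hq n : exists q : rat, c - c * n.+1%:R^-1 < ratr q < c.
    have n0 : 0 < n.+1%:R^-1 :> R by rewrite invr_gt0 ltr0n.
    have cc : c - c * n.+1%:R^-1 < c by rewrite ltrBlDr ltrDl mulr_gt0.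
    by have [q] := rat_in_itvoo cc; rewrite in_itv /=; exists q.
  have [q hq'] := choice hq.
  have cn : c - c * n.+1%:R^-1 @[n --> \oo] --> c.
    rewrite -[X in _ --> X]subr0; apply: cvgB; first exact: cvg_cst.
    by apply: cvg0_scale; exact: cvg_harmonic.
  have [|||_ h] := @Rint_dominated _ _ _ leb D mD
    (fun n y => \1_(`]-oo, ratr (q n)[) y * g y)
    (fun y => \1_(`]-oo, c[) y * g y) (fun y => `|g y|) _ _ _ (rintegrable_norm Ig).
  - move=> n; exact: rintegrable_measurable (rintegrable_indic mD Ig (measurable_itv _)).
  - move=> y _; apply: cvgMl; rewrite [X in _ --> X]indicE mem_setE in_itv /=.
    have [yc|cy] := ltP y c.
      apply: cvg_near_cst; near=> n; rewrite indicE mem_setE in_itv /=.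
      have /andP[h1 _] := hq' n; rewrite (lt_trans _ h1) //.
      by near: n; exact: (cvgr_gt _ cn).
    apply: cvg_near_cst; apply: nearW => n; rewrite indicE mem_setE in_itv /=.
    by have /andP[_ h1] := hq' n; rewrite ltNge (le_trans (ltW h1)).
  - move=> n y _; rewrite normrM ler_piMl // ger0_norm indicE;
      by case: (y \in _); rewrite ?ler01.
  have e : (fun n => \int[leb]_(y in D) (\1_(`]-oo, ratr (q n)[) y * g y)) = (fun=> 0).
    apply/funext => n; apply: gq; have /andP[h1 h2] := hq' n.
    rewrite (lt_le_trans h2 c1) andbT (le_lt_trans _ h1) // subr_ge0.
    by rewrite ler_piMr ?(ltW c0) // invf_le1 ?ltr0n // ler1n.
  rewrite e in h; apply/esym; exact: (cvg_unique _ (@cvg_cst _ 0 _ _ _) h).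
have g0 : \int[leb]_(y in D) g y = 0.
  rewrite -[RHS](gc 1) ?ltr01 ?lexx //; apply: Rint_eq => y.
  by rewrite /D /= in_itv /= => /andP[_ y1]; rewrite indicE mem_set ?mul1r //= in_itv.
have : {ae leb, forall y, D y -> g y = 0}.
  apply: (ae_zero_of_integrals mD Ig).
  have := @dynkin_integral0 _ _ _ leb D mD g Ig _ TR id (@RGenInftyO.G R).
  apply=> //.
  - move=> _ _ [x ->] [y ->]; exists (Num.min x y).
    by apply/seteqP; split => z /=; rewrite !in_itv /= lt_min;
      [move=> [-> ->]|move=> /andP[]].
  - exact: RGenInftyO.measurableE.
  - move=> _ [c ->]; have [c0|c0] := leP c 0.
      rewrite (@Rint_eq _ _ _ _ _ _ (fun=> 0)) ?Rintegral_cst ?mul0r // => y.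
      rewrite /D /= in_itv /= => /andP[y0 _].
      by rewrite indicE memNset ?mul0r //= in_itv /= ltNge (ltW (le_lt_trans c0 y0)).
    have [c1|c1] := leP c 1; first by apply: gc; rewrite c0.
    rewrite -[RHS]g0; apply: Rint_eq => y; rewrite /D /= in_itv /= => /andP[_ y1].
    by rewrite indicE mem_set ?mul1r //= in_itv /= (lt_trans y1).
by apply: filterS => y h y01; apply: h; rewrite /D /= in_itv.
Unshelve. all: by end_near.
Qed.

End OneDimensionalTrace.

(** * Multiplication by scalar functions of time *)

Section TimeWeights.
Context d (T : measurableType d) (R : realType).
Variable mu : {measure set T -> \bar R}.
Variables (Om : set T) (mOm : measurable Om) (finOm : (mu Om < +oo)%E).
Context d' (I : measurableType d').
Variable nu : {measure set I -> \bar R}.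
Variables (D : set I) (mD : measurable D) (finD : (nu D < +oo)%E).

Local Notation sqi := (sqint mu Om).
Local Notation dot := (L2dot mu Om).
Local Notation curve := (curve mu Om D).
Local Notation curve2 := (curve2 mu Om nu D).

(** Provides the affine weights of the piecewise affine interpolation, which are limits of finitely
    valued functions without being finitely valued. *)
Lemma curve2_mul (th_ : nat -> I -> R) (th : I -> R) (u : I -> T -> R) :
  (forall n, fin_valued D (th_ n)) ->
  (forall t, D t -> th_ n t @[n --> \oo] --> th t) ->
  (forall t, D t -> `|th t| <= 1) -> curve2 u ->
  curve2 (fun t => th t *: u t).
Proof.
move=> fth cth th1 [[g [fg cg]] Iu].
have cv : curve (fun t => th t *: u t).
  exists (fun n t => th_ n t *: g n t); split.
    by move=> n; exact: (fin_valued2 (fun a b => a *: b) (fth n) (fg n)).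
  move=> t Dt; have [su sg gu] := cg t Dt; split.
  - exact: sqintZ.
  - by move=> n; exact: sqintZ.
  apply: (@cvg0_le _ _ (fun n => 2 * (th_ n t ^+ 2 * dot (g n t - u t) (g n t - u t))
     + 2 * ((th_ n t - th t) ^+ 2 * dot (u t) (u t)))).
    rewrite -(addr0 0); apply: cvgD.
      apply: cvg0_scale; rewrite -(mulr0 (th t ^+ 2)); apply: cvgM => //.
      by rewrite expr2; apply: cvgM; exact: cth.
    apply: cvg0_scale; rewrite -(mul0r (dot (u t) (u t))); apply: cvgMl.
    rewrite -(mulr0 (0 : R)); apply: cvgM.
      by apply/subr_cvg0; exact: cth.
    by apply/subr_cvg0; exact: cth.
  move=> n; rewrite ger0_norm ?dot_ge0 //.
  have -> : th_ n t *: g n t - th t *: u t =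
      th_ n t *: (g n t - u t) + (th_ n t - th t) *: u t.
    by rewrite scalerBr scalerBl addrA subrK.
  have sd := sqintB mOm (sg n) su.
  rewrite (le_trans (dotD_le mOm (sqintZ mOm _ sd) (sqintZ mOm _ su))) //.
  by rewrite !dotZl ?dotZr //; [rewrite !mulrA|exact: sqintZ..].
split; first exact: cv.
have mcv := curve_dot_measurable mOm finOm cv cv.
apply: (rintegrable_le mD mcv _ Iu) => t Dt; have [su _ _] := cg t Dt.
rewrite ger0_norm ?dot_ge0 // dotZl ?dotZr //; last exact: sqintZ.
rewrite mulrA ler_piMl ?dot_ge0 // -expr2 -real_normK ?num_real //.
by rewrite expr_le1 // th1.
Qed.

End TimeWeights.

Lemma cvg0_sqr (R : realType) (x_ : nat -> R) :
  x_ n @[n --> \oo] --> (0 : R) -> x_ n * x_ n @[n --> \oo] --> (0 : R).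
Proof. by move=> cx; rewrite -(mulr0 (0 : R)); exact: cvgM. Qed.

(** * Bochner spaces *)

Section BochnerCurves.
Context {R : realType}.
Local Notation leb := (@lebesgue_measure R).
Local Notation TR := (measurableTypeR R).
Local Notation mu2 := (leb \x leb)%E.
Variables (a b T : R).
Hypotheses (ab : a < b) (T0 : 0 < T).
Local Notation E := (R * R -> R).
Local Notation Om := (box a b 0 1).
Local Notation D := ([set` `]0, T[] : set TR).
Local Notation sqi := (sqint mu2 Om).
Local Notation dot := (L2dot mu2 Om).
Local Notation curve := (curve mu2 Om D).
Local Notation curve2 := (curve2 mu2 Om leb D).
Local Notation cdot := (curve_dot mu2 Om leb D).
Local Notation wcomp := (wcomp a b).
Local Notation N := (W12norm Om).
Implicit Types (u v : R -> E).

Let mOm : measurable Om. Proof. exact: measurable_box. Qed.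
Let finOm : (mu2 Om < +oo)%E. Proof. exact: rect_finite. Qed.
Let mD : measurable D. Proof. exact: measurable_itv. Qed.
Let finD : (leb D < +oo)%E.
Proof. by rewrite lebesgue_measure_itv /= lte_fin T0 -EFinD ltry. Qed.

Lemma time_itvE t : D t = (0 < t < T).
Proof. by rewrite /= in_itv. Qed.

(* [L^2(0,T; W^{1,2})], with each component a curve in [L^2]: all inner products
   below are then measurable functions of time. *)
Definition W12curve u : Prop :=
  (forall t, D t -> W12 Om (u t)) /\ forall i, curve2 (fun t => wcomp i (u t)).

Lemma W12curve_fin_valued u : fin_valued D u -> (forall t, D t -> W12 Om (u t)) ->
  W12curve u.
Proof.
move=> fu wu; split=> // i; apply: curve2_fin_valued => //.
  exact: (fin_valued_comp (fun x => wcomp i x) fu).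
by move=> t Dt; apply: wcomp_sqint; exact: wu.
Qed.

Definition nrmT2 u : R :=
  cdot (fun t => wcomp None (u t)) (fun t => wcomp None (u t)) +
  cdot (fun t => wcomp (Some false) (u t)) (fun t => wcomp (Some false) (u t)) +
  cdot (fun t => wcomp (Some true) (u t)) (fun t => wcomp (Some true) (u t)).

Lemma nrmT2_ge0 u : 0 <= nrmT2 u.
Proof. by rewrite !addr_ge0 // cdot_ge0. Qed.

Lemma nrmT2E u : W12curve u -> \int[leb]_(t in D) (N (u t) ^+ 2) = nrmT2 u.
Proof.
move=> [_ cu]; have I i := (cu i).2.
have I2 := rintegrableD mD (I None) (I (Some false)).
transitivity (\int[leb]_(t in D) (dot (wcomp None (u t)) (wcomp None (u t)) +
    dot (wcomp (Some false) (u t)) (wcomp (Some false) (u t)) +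
    dot (wcomp (Some true) (u t)) (wcomp (Some true) (u t)))).
  by apply: Rint_eq => t _; rewrite W12norm_sqr.
rewrite (RintegralD mD I2 (I (Some true))).
by rewrite (RintegralD mD (I None) (I (Some false))).
Qed.

Lemma L2TnormE u : W12curve u -> L2Tnorm T N u = Num.sqrt (nrmT2 u).
Proof. by move=> wu; rewrite /L2Tnorm -nrmT2E. Qed.

Definition dotT u v : R :=
  cdot (fun t => wcomp None (u t)) (fun t => wcomp None (v t)) +
  cdot (fun t => wcomp (Some false) (u t)) (fun t => wcomp (Some false) (v t)) +
  cdot (fun t => wcomp (Some true) (u t)) (fun t => wcomp (Some true) (v t)).

Lemma dotT_CS u v : W12curve u -> W12curve v ->
  `|dotT u v| <= Num.sqrt (nrmT2 u) * Num.sqrt (nrmT2 v).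
Proof.
move=> [_ cu] [_ cv]; apply: young_opt; [exact: nrmT2_ge0..|] => s s0.
have y i := cdot_young mOm finOm mD s0 (cu i) (cv i).
rewrite -[2]ger0_norm // -normrM /dotT /nrmT2.
have := y None; have := y (Some false); have := y (Some true) => {y}.
have alg (p q r p1 q1 r1 p2 q2 r2 : R) : `|2 * r| <= s * r1 + s^-1 * r2 ->
    `|2 * q| <= s * q1 + s^-1 * q2 -> `|2 * p| <= s * p1 + s^-1 * p2 ->
    `|2 * (p + q + r)| <= s * (p1 + q1 + r1) + s^-1 * (p2 + q2 + r2).
  move=> h1 h2 h3; rewrite !mulrDr (le_trans (ler_normD _ _)) //.
  have h4 : `|2 * p + 2 * q| <= `|2 * p| + `|2 * q| by exact: ler_normD.
  by move: h1 h2 h3 h4; lra.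
move=> h1 h2 h3; exact: (alg _ _ _ _ _ _ _ _ _ h1 h2 h3).
Qed.

Lemma cdot_comb i k u v z : W12curve u -> W12curve v -> curve2 z ->
  cdot z (fun t => wcomp i (fun p => k * u t p + v t p)) =
  k * cdot z (fun t => wcomp i (u t)) + cdot z (fun t => wcomp i (v t)).
Proof.
move=> [wu cu] [wv cv] cz.
have Iu := curve2_dot_integrable mOm finOm mD cz (cu i).
have Iv := curve2_dot_integrable mOm finOm mD cz (cv i).
rewrite /curve_dot -RintegralZl // -RintegralD //; last exact: rintegrableZ.
apply: Rint_eq => t Dt.
have sz := curve_sqint cz.1 Dt.
have su := wcomp_sqint i (wu t Dt); have sv := wcomp_sqint i (wv t Dt).
have sk := wcomp_sqint i (W12_linear k (wu t Dt) (wv t Dt)).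
have sl : sqi (k *: wcomp i (u t) + wcomp i (v t)).
  by apply: sqintD => //; exact: sqintZ.
rewrite -dotZr // -dotDr //; last exact: sqintZ.
apply: dot_ae_eq => //; first exact: aeW.
exact: (wcomp_linear i k (wu t Dt) (wv t Dt)).
Qed.

Lemma dotT_comb k u v w : W12curve u -> W12curve v -> W12curve w ->
  dotT w (fun t p => k * u t p + v t p) = k * dotT w u + dotT w v.
Proof.
move=> wu wv ww; have e i := cdot_comb i k wu wv (ww.2 i).
have alg (p q r x y z x1 y1 z1 : R) : p = k * x + x1 -> q = k * y + y1 ->
    r = k * z + z1 -> p + q + r = k * (x + y + z) + (x1 + y1 + z1).
  by move=> -> -> ->; ring.
exact: (alg _ _ _ _ _ _ _ _ _ (e None) (e (Some false)) (e (Some true))).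
Qed.

Lemma W12_0 : W12 Om 0.
Proof.
apply: smooth2_W12 => //; have s0 : smooth1 (fun _ : R => 0 : R).
  apply/smooth1P => n; have := nderivableZ 0 (@nderivable_flat R n 0).
  by under eq_fun do rewrite mul0r.
have := smooth2_tensor s0 s0.
by rewrite (_ : (fun p => _) = 0) //; apply/funext => p; rewrite mul0r.
Qed.

Section SimpleFunctions.
Variable X : set E.
Hypothesis XW : X `<=` W12 Om.

Lemma simple_fun_fin_valued (s : simple X) : fin_valued D (simple_fun s).
Proof.
(* The sets of a simple function may overlap, so the index records which of them contain [t]. *)
exists {ffun 'I_(s_size s) -> bool}, (fun t => [ffun i => t \in s_set i]),
  (fun (c : {ffun 'I_(s_size s) -> bool}) p => \sum_(i < s_size s) (c i)%:R * s_val i p).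
split=> [c|t _]; last first.
  by apply/funext => p; apply: eq_bigr => i _; rewrite ffunE indicE.
rewrite (_ : _ @^-1` _ = \bigcap_(i in [set: 'I_(s_size s)])
    (if c i then s_set i else ~` s_set i)).
  apply: measurableI => //; apply: fin_bigcap_measurable => //.
  by move=> i _; case: (c i); [|apply: measurableC]; exact: s_setP.
apply/seteqP; split => t /=.
  move=> <- i _; rewrite ffunE; case: ifPn => [/set_mem//|/negP h Ai].
  by apply: h; exact: mem_set.
move=> h; apply/ffunP => i; rewrite ffunE; have := h i I.
by case: (c i) => Ai; [rewrite mem_set|rewrite memNset].
Qed.

Lemma simple_fun_W12 (s : simple X) t : W12 Om (simple_fun s t).
Proof.
rewrite (_ : simple_fun s t = \sum_(i < s_size s) (\1_(s_set i) t : R) *: s_val i); last first.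
  by apply/funext => p; rewrite /simple_fun fct_sumE.
elim/big_ind : _ => [|x y wx wy|i _]; first exact: W12_0.
  by rewrite -[x]scale1r; exact: W12_linear.
by rewrite -[_ *: _]addr0; apply: W12_linear; [exact: XW (s_valP i)|exact: W12_0].
Qed.

Lemma strongly_measurable_W12 u t : strongly_measurable T X N u -> D t -> W12 Om (u t).
Proof. by move=> [Xu _]; rewrite time_itvE => /Xu; exact: XW. Qed.

(** The $W^{1,2}$ norm controls each component, so the components of the simple functions
    approximate those of [u] in $L^2$ at every time. *)
Lemma strongly_measurable_curve u i : strongly_measurable T X N u ->
  curve (fun t => wcomp i (u t)).
Proof.
move=> su; have [Xu [s scvg]] := su.
exists (fun n t => wcomp i (simple_fun (s n) t)); split.
  by move=> n; exact: (fin_valued_comp (fun x => wcomp i x) (simple_fun_fin_valued (s n))).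
move=> t Dt; have wu := strongly_measurable_W12 su Dt.
split.
- exact: wcomp_sqint.
- by move=> n; apply: wcomp_sqint; exact: simple_fun_W12.
have Dt' : 0 < t < T by rewrite -time_itvE.
have gen (x : nat -> E) : (forall n, W12 Om (x n)) -> N (x n - u t) @[n --> \oo] --> (0 : R) ->
    sqcvg mu2 Om (fun n => wcomp i (x n)) (wcomp i (u t)).
  move=> wx /cvg0_sqr cx; apply: (cvg0_le cx) => n.
  by rewrite ger0_norm ?dot_ge0 // -expr2; exact: wcompB_le.
exact: (gen (fun n => simple_fun (s n) t) (fun n => simple_fun_W12 (s n) t) (scvg t Dt')).
Qed.

Lemma L2T_W12curve u : L2T T X N u -> W12curve u.
Proof.
move=> [su Iu]; split=> [t Dt|i]; first exact: strongly_measurable_W12 su Dt.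
have cu := strongly_measurable_curve i su; split=> //.
apply: (rintegrable_le mD (curve_dot_measurable mOm finOm cu cu) _ Iu) => t Dt.
by rewrite ger0_norm ?dot_ge0 //; exact: wcomp_le.
Qed.

End SimpleFunctions.

End BochnerCurves.

Lemma cvg_ext (R : realType) (x_ y_ : nat -> R) (l : R) :
  x_ n @[n --> \oo] --> l -> (forall n, x_ n = y_ n) -> y_ n @[n --> \oo] --> l.
Proof. by move=> cx xy; have <- : x_ = y_ by exact/funext. Qed.

Lemma cvg_perturb (R : realType) (x_ y_ z_ w_ : nat -> R) (l : R) :
  x_ n @[n --> \oo] --> (0 : R) -> y_ n @[n --> \oo] --> (0 : R) ->
  z_ n @[n --> \oo] --> l -> (forall n, x_ n + y_ n + z_ n = w_ n) ->
  w_ n @[n --> \oo] --> l.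
Proof.
move=> cx cy cz xyz; have <- : (fun n => x_ n + y_ n + z_ n) = w_ by exact/funext.
have -> : l = 0 + 0 + l by rewrite !add0r.
by apply: cvgD => //; exact: cvgD.
Qed.

(** The case [s = 0], where the quotient is [0], covers members of the sequence of norm zero when
    pairings are normalized; [sqr_divr] does the same for the attained value. *)
Lemma normr_div_le (R : realType) (p q s : R) : 0 <= s -> 0 <= q -> `|p| <= s * q ->
  `|p / s| <= q.
Proof.
rewrite le_eqVlt => /predU1P[<- q0 _|s0 _ h]; first by rewrite invr0 mulr0 normr0.
by rewrite normrM normfV (gtr0_norm s0) ler_pdivrMr // mulrC.
Qed.

Lemma sqr_divr (R : realType) (s : R) : s ^+ 2 / s = s.
Proof.
by have [->|s0] := eqVneq s 0; [rewrite invr0 mulr0|rewrite expr2 mulfK].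
Qed.

(** * The time discretization *)

Section TimeGrid.
Context {R : realType}.
Local Notation leb := (@lebesgue_measure R).
Local Notation TR := (measurableTypeR R).
Variables (T : R).
Hypothesis T0 : 0 < T.
Local Notation D := ([set` `]0, T[] : set TR).

Lemma dt_gt0 N : (0 < N)%N -> 0 < dt T N.
Proof. by move=> N0; rewrite /dt divr_gt0 // ltr0n. Qed.

Lemma dtN N : (0 < N)%N -> N%:R * dt T N = T.
Proof. by move=> N0; rewrite /dt mulrCA divff ?mulr1 // pnatr_eq0 -lt0n. Qed.

Lemma stepE N k t : (0 < N)%N -> k%:R * dt T N < t <= k.+1%:R * dt T N ->
  step T N t = k.+1.
Proof.
move=> N0; have d0 := dt_gt0 N0.
rewrite -ltr_pdivlMr // -ler_pdivrMr // => h.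
rewrite /step (@ceil_def _ _ k.+1%:Z) //.
by have -> : k.+1%:Z - 1 = k%:Z by rewrite intS addrAC subrr add0r.
Qed.

Lemma step_bounds N t : (0 < N)%N -> 0 < t <= T -> exists k,
  [/\ (k < N)%N, step T N t = k.+1 & k%:R * dt T N < t <= k.+1%:R * dt T N].
Proof.
move=> N0 /andP[t0 tT]; have d0 := dt_gt0 N0.
have x0 : 0 < t / dt T N by rewrite divr_gt0.
have hc := ceil_ge (t / dt T N); have hc' := ceilB1_lt (t / dt T N).
have c0 : 0 < Num.ceil (t / dt T N) by rewrite ceil_gt0.
case: (Num.ceil (t / dt T N)) c0 hc hc' => [[//|k]|//] _ hc hc'.
have hk : k%:R * dt T N < t <= k.+1%:R * dt T N.
  rewrite -ltr_pdivlMr // -ler_pdivrMr //; move: hc hc'.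
  by rewrite intrD mulrN1z => -> /=; rewrite -pmulrn -natr1 addrK => ->.
exists k; split=> //; last exact: stepE.
case/andP: hk => hk _; rewrite -(ltr_nat R) -(ltr_pM2r d0) dtN //.
exact: lt_le_trans tT.
Qed.

Lemma step_ae N t : (0 < N)%N -> D t -> exists k,
  [/\ (k < N)%N, step T N t = k.+1 & k%:R * dt T N < t <= k.+1%:R * dt T N].
Proof.
move=> N0; rewrite /= in_itv /= => /andP[t0 tT].
by apply: step_bounds => //; rewrite t0 ltW.
Qed.

Lemma fin_valued_step (V : Type) (g : nat -> V) N : (0 < N)%N ->
  fin_valued D (fun t => g (step T N t)).
Proof.
move=> N0; exists 'I_N.+1, (fun t => inord (step T N t)), (fun k : 'I_N.+1 => g k); split; last first.
  by move=> t /(step_ae N0)[k [kN -> _]]; rewrite inordK.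
move=> k; rewrite (_ : _ `&` _ =
    D `&` (if (0 < k)%N then [set` `]k.-1%:R * dt T N, k%:R * dt T N]] else set0)).
  by apply: measurableI; first exact: measurable_itv; case: ifP.
apply/seteqP; split => t [Dt] h; split=> //; have [j [jN e hj]] := step_ae N0 Dt.
  have <- : inord (step T N t) = k by exact: h.
  by rewrite e inordK //= in_itv.
move: h; case: ifP => // k0; rewrite /= in_itv /= => h.
rewrite (@stepE N k.-1 t) ?prednK // inord_val //.
Qed.

Lemma step_cvg (N : nat -> nat) t : (forall n, (0 < N n)%N) ->
  dt T (N n) @[n --> \oo] --> (0 : R) -> D t ->
  (step T (N n) t)%:R * dt T (N n) @[n --> \oo] --> t.
Proof.
move=> N0 cN Dt; apply/subr_cvg0; apply: (cvg0_le cN) => n.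
have [k [kN -> /andP[h1 h2]]] := step_ae (N0 n) Dt.
by rewrite ger0_norm ?subr_ge0 // -natr1 mulrDl mul1r lerBlDr addrC lerD2l ltW.
Qed.

End TimeGrid.

(** * Bounds and limits for weakly convergent sequences *)

Section WeakLimits.
Context {R : realType}.
Local Notation leb := (@lebesgue_measure R).
Local Notation TR := (measurableTypeR R).
Local Notation mu2 := (leb \x leb)%E.
Variables (a b T : R).
Hypotheses (ab : a < b) (T0 : 0 < T).
Local Notation E := (R * R -> R).
Local Notation Om := (box a b 0 1).
Local Notation D := ([set` `]0, T[] : set TR).
Local Notation sqi := (sqint mu2 Om).
Local Notation dot := (L2dot mu2 Om).
Local Notation curve := (curve mu2 Om D).
Local Notation curve2 := (curve2 mu2 Om leb D).
Local Notation cdot := (curve_dot mu2 Om leb D).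
Local Notation wcomp := (wcomp a b).
Local Notation N := (W12norm Om).
Local Notation W12curve := (W12curve a b T).
Local Notation nrmT2 := (nrmT2 a b T).
Local Notation dotT := (dotT a b T).
Variable X : set E.
Hypothesis XW : X `<=` W12 Om.

Let mOm : measurable Om. Proof. exact: measurable_box. Qed.
Let finOm : (mu2 Om < +oo)%E. Proof. exact: rect_finite. Qed.
Let mD : measurable D. Proof. exact: measurable_itv. Qed.
Let finD : (leb D < +oo)%E.
Proof. by rewrite lebesgue_measure_itv /= lte_fin T0 -EFinD ltry. Qed.

(** [W12curve] contains [L2T] and is expressed by components, which makes linearity and bounds easy
    to check there. *)
Lemma dual_W12curve (l : (R -> E) -> R) :
  (forall k u v, W12curve u -> W12curve v ->
     l (fun t p => k * u t p + v t p) = k * l u + l v) ->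
  (exists C, forall u, W12curve u -> `|l u| <= C * Num.sqrt (nrmT2 u)) ->
  dual_L2T T X N l.
Proof.
move=> l1 [C l2]; split.
  by move=> k u v Lu Lv; exact: (l1 k _ _ (L2T_W12curve ab XW Lu) (L2T_W12curve ab XW Lv)).
by exists C => u Lu; have wu := L2T_W12curve ab XW Lu; rewrite L2TnormE //; exact: l2.
Qed.

(** The Hilbert structure supplies explicit norming functionals, the pairings with [x_ n] divided by
    its norm; each continuous functional is bounded along [x_] because its values converge. *)
Lemma weak_cvg_bounded (x_ : nat -> R -> E) u : (forall n, W12curve (x_ n)) ->
  weak_cvg T X N x_ u -> exists B, forall n, nrmT2 (x_ n) <= B.
Proof.
move=> wx cx.
have [|||||B hB] := @gliding_hump R (R -> E) [set u | W12curve u]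
  (fun k u v t p => k * u t p + v t p) (fun u => Num.sqrt (nrmT2 u))
  (fun n v => dotT (x_ n) v / Num.sqrt (nrmT2 (x_ n))) x_.
- move=> n k u' v wu wv /=; rewrite (dotT_comb k wu wv (wx n)).
  by rewrite mulrDl mulrA.
- move=> n v wv /=; have := dotT_CS (wx n) wv.
  exact: (normr_div_le (sqrtr_ge0 _) (sqrtr_ge0 _)).
- exact: wx.
- move=> n /=; have : dotT (x_ n) (x_ n) = Num.sqrt (nrmT2 (x_ n)) ^+ 2.
    by rewrite sqr_sqrtr // nrmT2_ge0.
  by move=> ->; exact: sqr_divr.
- move=> l l1 l2; have cl := cx l (dual_W12curve l1 l2).
  have [M [_ hM]] := cvg_seq_bounded (cvgP _ cl).
  exists (M + 1) => n; apply: (hM (M + 1)); [by rewrite ltrDl|by []].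
exists (B ^+ 2) => n; have := hB n.
have s0 := sqrtr_ge0 (nrmT2 (x_ n)) => h.
rewrite -(sqr_sqrtr (nrmT2_ge0 a b T (x_ n))) lerXn2r ?nnegrE //.
exact: le_trans h.
Qed.

Definition diffT (kap : R -> R) (w u v : R -> E) : R :=
  \int[leb]_(t in D) (wdot mu2 Om (kap \o w t) (wcomp (Some false) (u t)) (wcomp (Some false) (v t)) +
    wdot mu2 Om (kap \o w t) (wcomp (Some true) (u t)) (wcomp (Some true) (v t))).

Lemma grad_ipE (kap : R -> R) (M : R) (w u v : E) : almost_lip kap M -> sqi w ->
  W12 Om u -> W12 Om v -> grad_ip Om (kap \o w) u v =
  wdot mu2 Om (kap \o w) (wcomp (Some false) u) (wcomp (Some false) v) +
  wdot mu2 Om (kap \o w) (wcomp (Some true) u) (wcomp (Some true) v).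
Proof.
move=> akap sw wu wv; have [_ kM _] := akap.
have mk := comp_almost_lip_measurable akap sw.
have I i : rintegrable mu2 Om (fun p => (kap \o w) p * (wcomp i u p * wcomp i v p)).
  have km x : Om x -> `|(kap \o w) x| <= M by rewrite /= kM.
  have := sqint_mul mOm (sqint_wmul mOm mk km (wcomp_sqint i wu)) (wcomp_sqint i wv).
  by apply: rintegrable_eq => // x _; rewrite mulrA.
rewrite /wdot -(RintegralD mOm (I (Some false)) (I (Some true))).
by apply: Rint_eq => p _; rewrite -mulrDr.
Qed.

Lemma diffT_integrable kap M w u v i : almost_lip kap M -> curve w ->
  W12curve u -> W12curve v ->
  rintegrable leb D (fun t => wdot mu2 Om (kap \o w t) (wcomp i (u t)) (wcomp i (v t))).
Proof. by move=> akap cw [_ cu] [_ cv]; exact: (curve2_wdot_integrable mOm finOm mD akap). Qed.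

Lemma wdot_comb (kap : R -> R) (M : R) i k (w u v z : E) : almost_lip kap M -> sqi w ->
  W12 Om u -> W12 Om v -> W12 Om z ->
  wdot mu2 Om (kap \o w) (wcomp i (k *: u + v)) (wcomp i z) =
  k * wdot mu2 Om (kap \o w) (wcomp i u) (wcomp i z) +
  wdot mu2 Om (kap \o w) (wcomp i v) (wcomp i z).
Proof.
move=> akap sw wu wv wz; have [_ kM _] := akap.
have mk := comp_almost_lip_measurable akap sw.
have km x : Om x -> `|(kap \o w) x| <= M by rewrite /= kM.
have s x : sqi x -> sqi (fun p => (kap \o w) p * x p).
  by move=> sx; exact: (sqint_wmul mOm mk km sx).
have su := wcomp_sqint i wu; have sv := wcomp_sqint i wv.
have sk := wcomp_sqint i (W12_linear k wu wv).
have sz := wcomp_sqint i wz.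
rewrite !wdotE -(dotZl mOm k (s _ su) sz) -(dotDl mOm (sqintZ mOm k (s _ su)) (s _ sv) sz).
apply: (dot_ae_eq mOm (s _ sk) _ sz sz); last exact: aeW.
  exact: (sqintD mOm (sqintZ mOm k (s _ su)) (s _ sv)).
apply: filterS (wcomp_linear i k wu wv) => p h Op; rewrite h // !fctE.
by rewrite /GRing.scale /=; ring.
Qed.

Lemma dual_diffT kap M w v : almost_lip kap M -> curve w -> W12curve v ->
  dual_L2T T X N (fun u => diffT kap w u v).
Proof.
move=> akap cw wv; have [_ kM _] := akap.
have M0 : 0 <= M by rewrite (le_trans _ (kM 0)).
apply: dual_W12curve.
  move=> k u u' wu wu'.
  have I i := diffT_integrable i akap cw wu wv.
  have I' i := diffT_integrable i akap cw wu' wv.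
  have ID := rintegrableD mD (I (Some false)) (I (Some true)).
  have ID' := rintegrableD mD (I' (Some false)) (I' (Some true)).
  rewrite /diffT -(RintegralZl k mD ID) -(RintegralD mD (rintegrableZ mD k ID) ID').
  apply: Rint_eq => t Dt; have sw := curve_sqint cw Dt.
  have e i := wdot_comb i k akap sw (wu.1 t Dt) (wu'.1 t Dt) (wv.1 t Dt).
  have alg (p q x y x1 y1 : R) : p = k * x + x1 -> q = k * y + y1 ->
     p + q = k * (x + y) + (x1 + y1) by move=> -> ->; ring.
  exact: (alg _ _ _ _ _ _ (e (Some false)) (e (Some true))).
pose cn i (u : R -> E) := cdot (fun t => wcomp i (u t)) (fun t => wcomp i (u t)).
exists (M * Num.sqrt (cn (Some false) v) + M * Num.sqrt (cn (Some true) v)) => u wu.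
have I i := diffT_integrable i akap cw wu wv.
have CS i := curve2_wdot_CS mOm finOm mD akap cw (wu.2 i) (wv.2 i).
have nle i : Num.sqrt (cn i u) <= Num.sqrt (nrmT2 u).
  have h j : 0 <= cn j u by exact: cdot_ge0.
  rewrite ler_wsqrtr // /nrmT2 -!/(cn _ u); case: i => [[]|].
  - by rewrite lerDr addr_ge0.
  - by rewrite -addrA addrCA lerDl addr_ge0.
  - by rewrite -addrA lerDl addr_ge0.
rewrite /diffT (RintegralD mD (I (Some false)) (I (Some true))).
have bd i : `|\int[leb]_(t in D) wdot mu2 Om (kap \o w t) (wcomp i (u t)) (wcomp i (v t))| <=
    M * Num.sqrt (cn i v) * Num.sqrt (nrmT2 u).
  have alg (p x y z : R) : 0 <= y -> p <= M * (x * y) -> x <= z -> p <= M * y * z.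
    move=> y0 h xz; rewrite (le_trans h) // -mulrA ler_wpM2l // mulrC.
    exact: ler_wpM2l.
  exact: (alg _ _ _ _ (sqrtr_ge0 _) (CS i) (nle i)).
rewrite (le_trans (ler_normD _ _)) // mulrDl; apply: lerD; exact: bd.
Qed.

(** The weight is exchanged first, uniformly over the bounded [u_]; only then is the limit weight
    frozen into a fixed functional of [u_]. *)
Lemma diffT_cvg kap M (w_ u_ : nat -> R -> E) w u v : almost_lip kap M ->
  (forall n, curve2 (w_ n)) -> curve2 w ->
  cdot (fun t => w_ n t - w t) (fun t => w_ n t - w t) @[n --> \oo] --> (0 : R) ->
  (forall n, W12curve (u_ n)) -> W12curve v -> weak_cvg T X N u_ u ->
  diffT kap (w_ n) (u_ n) v @[n --> \oo] --> diffT kap w u v.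
Proof.
move=> akap cw_ cw ww wu wv cu.
have [B hB] := weak_cvg_bounded wu cu.
have h0 := cu _ (dual_diffT akap cw.1 wv).
have hi i : \int[leb]_(t in D) (wdot mu2 Om (kap \o w_ n t) (wcomp i (u_ n t)) (wcomp i (v t))
     - wdot mu2 Om (kap \o w t) (wcomp i (u_ n t)) (wcomp i (v t))) @[n --> \oo] --> (0 : R).
  apply: (weighted_limit mOm finOm mD finD akap cw_ cw (A := B)) ww _.
  - by move=> n; exact: (wu n).2.
  - exact: wv.2.
  - move=> n; apply: le_trans (hB n).
    have h j : 0 <= cdot (fun t => wcomp j (u_ n t)) (fun t => wcomp j (u_ n t)) by exact: cdot_ge0.
    rewrite /nrmT2; case: i => [[]|].
    + by rewrite lerDr addr_ge0.
    + by rewrite -addrA addrCA lerDl addr_ge0.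
    + by rewrite -addrA lerDl addr_ge0.
apply: (cvg_perturb (hi (Some false)) (hi (Some true)) h0) => n.
have I i := diffT_integrable i akap cw.1 (wu n) wv.
have I_ i := diffT_integrable i akap (cw_ n).1 (wu n) wv.
rewrite /diffT (RintegralD mD (I (Some false)) (I (Some true))).
rewrite (RintegralD mD (I_ (Some false)) (I_ (Some true))).
have e i := RintegralB mD (I_ i) (I i).
have alg (p q x y x1 y1 : R) : p = x - x1 -> q = y - y1 -> p + q + (x1 + y1) = x + y.
  by move=> -> ->; ring.
exact: (alg _ _ _ _ _ _ (e (Some false)) (e (Some true))).
Qed.

End WeakLimits.

Lemma Rint_itv_split {R : realType} (F : R -> R) (x y : R) : 0 <= x -> x < y ->
  rintegrable lebesgue_measure `]0, y[ F ->
  \int[lebesgue_measure]_(t in `]0, y[) F t =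
  \int[lebesgue_measure]_(t in `]0, x[) F t + \int[lebesgue_measure]_(t in `]x, y[) F t.
Proof.
move=> x0 xy IF.
have := @Rintegral_itvB R F (BRight 0) (BLeft y) x IF; rewrite !bnd_simp => <- //.
have Ix : rintegrable lebesgue_measure `]0, x[ F.
  apply: integrableS IF; try exact: measurable_itv.
  by apply: subset_itvl; rewrite bnd_simp ltW.
rewrite -(@Rintegral_itv_bndo_bndc R (BRight 0) x F Ix).
have alg (p q : R) : p = q + (p - q) by ring.
exact: alg.
Qed.

Lemma cvg0D_lt (R : realType) (c e : R) (x_ y_ : nat -> R) :
  x_ n @[n --> \oo] --> (0 : R) -> y_ n @[n --> \oo] --> (0 : R) -> 0 < e ->
  \forall n \near \oo, c * x_ n + c * y_ n < e.
Proof.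
move=> cx cy e0; have h : c * x_ n + c * y_ n @[n --> \oo] --> (0 : R).
  by rewrite -(addr0 0); apply: cvgD; exact: cvg0_scale.
exact: (cvgr_lt _ h).
Qed.

(** * Scalar pairings of Bochner integrals and weak time derivatives *)

Section BochnerPairing.
Context {R : realType}.
Local Notation leb := (@lebesgue_measure R).
Local Notation TR := (measurableTypeR R).
Local Notation mu2 := (leb \x leb)%E.
Variables (a b T : R).
Hypotheses (ab : a < b) (T0 : 0 < T).
Local Notation E := (R * R -> R).
Local Notation Om := (box a b 0 1).
Local Notation D := ([set` `]0, T[] : set TR).
Local Notation sqi := (sqint mu2 Om).
Local Notation dot := (L2dot mu2 Om).
Local Notation curve := (curve mu2 Om D).
Local Notation curve2 := (curve2 mu2 Om leb D).
Local Notation cdot := (curve_dot mu2 Om leb D).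
Local Notation wcomp := (wcomp a b).
Local Notation N := (W12norm Om).
Local Notation W12curve := (W12curve a b T).
Variable X : set E.
Hypothesis XW : X `<=` W12 Om.

Let mOm : measurable Om. Proof. exact: measurable_box. Qed.
Let finOm : (mu2 Om < +oo)%E. Proof. exact: rect_finite. Qed.
Let mD : measurable D. Proof. exact: measurable_itv. Qed.
Let finD : (leb D < +oo)%E.
Proof. by rewrite lebesgue_measure_itv /= lte_fin T0 -EFinD ltry. Qed.

Lemma W12_sqint u : W12 Om u -> sqi u. Proof. by move=> wu; exact: (wcomp_sqint None wu). Qed.

Lemma dot_W12norm_le g u : sqi g -> W12 Om u -> `|dot g u| <= Num.sqrt (dot g g) * N u.
Proof.
move=> sg wu; rewrite (le_trans (dot_CS mOm sg (W12_sqint wu))) //.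
rewrite ler_wpM2l ?sqrtr_ge0 // -[leRHS]ger0_norm ?sqrtr_ge0 // -sqrtr_sqr ler_wsqrtr //.
exact: (wcomp_le a b None u).
Qed.

Lemma dot_simple g (s : simple X) t : sqi g ->
  dot g (simple_fun s t) = \sum_(i < s_size s) (\1_(s_set i) t : R) * dot g (s_val i).
Proof.
move=> sg; have sv i : sqi (s_val (s:=s) i) by apply: W12_sqint; apply: XW; exact: s_valP.
rewrite -(eq_bigr _ (fun i _ => dotZr mOm _ sg (sv i))).
rewrite -Rint_sum //; last first.
  by move=> i; apply: sqint_mul => //; exact: sqintZ.
by apply: Rint_eq => p _; rewrite /simple_fun mulr_sumr.
Qed.

Lemma dot_simple_int g (s : simple X) : sqi g ->
  dot g (simple_int T s) = \sum_(i < s_size s) fine (leb (s_set i `&` D)) * dot g (s_val i).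
Proof.
move=> sg; have sv i : sqi (s_val (s:=s) i) by apply: W12_sqint; apply: XW; exact: s_valP.
rewrite -(eq_bigr _ (fun i _ => dotZr mOm _ sg (sv i))).
rewrite -Rint_sum //; last first.
  by move=> i; apply: sqint_mul => //; exact: sqintZ.
by apply: Rint_eq => p _; rewrite /simple_int mulr_sumr.
Qed.

Lemma simple_int_W12 (s : simple X) : W12 Om (simple_int T s).
Proof.
rewrite (_ : simple_int T s = \sum_(i < s_size s) (fine (leb (s_set i `&` D))) *: s_val i); last first.
  by apply/funext => p; rewrite /simple_int fct_sumE.
elim/big_ind : _ => [|x y wx wy|i _]; first exact: W12_0.
  by rewrite -[x]scale1r; exact: W12_linear.
by rewrite -[_ *: _]addr0; apply: W12_linear; [exact: XW (s_valP i)|exact: W12_0].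
Qed.

Lemma Rint_dot_simple g (s : simple X) : sqi g ->
  rintegrable leb D (fun t => dot g (simple_fun s t)) /\
  \int[leb]_(t in D) dot g (simple_fun s t) = dot g (simple_int T s).
Proof.
move=> sg.
have Ii i : rintegrable leb D (fun t => (\1_(s_set (s:=s) i) t : R) * dot g (s_val i)).
  apply: rintegrable_indic => //; [exact: rintegrable_cst|exact: s_setP].
split.
  apply: (@rintegrable_eq _ _ _ leb D mD
    (fun t => \sum_(i < s_size s) (\1_(s_set i) t : R) * dot g (s_val i))).
    by move=> t _; rewrite dot_simple.
  exact: rintegrable_sum.
rewrite dot_simple_int //.
transitivity (\int[leb]_(t in D) (\sum_(i < s_size s) (\1_(s_set i) t : R) * dot g (s_val i))).
  by apply: Rint_eq => t _; exact: dot_simple.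
rewrite Rint_sum //; apply: eq_bigr => i _.
have mi := s_setP (s:=s) i.
by rewrite Rint_indic Rintegral_cst; [rewrite mulrC setIC|exact: measurableI].
Qed.

(** For simple functions this is finite additivity. Pairing with [g] is bounded by the $W^{1,2}$
    norm, so the two convergences in the definition of the Bochner integral carry it over to [u]. *)
Lemma Bochner_int_dot g u I : sqi g -> is_Bochner_int T X N u I ->
  rintegrable leb D (fun t => dot g (u t)) /\
  \int[leb]_(t in D) dot g (u t) = dot g I.
Proof.
move=> sg [su XI [s [scvg Icvg]]].
have wu t : D t -> W12 Om (u t) by exact: (strongly_measurable_W12 XW su).
have cu i := strongly_measurable_curve ab XW i su.
have cs n i : curve (fun t => wcomp i (simple_fun (s n) t)).
  apply: curve_fin_valued => //.
    by apply: (fin_valued_comp (fun x => wcomp i x)); exact: simple_fun_fin_valued.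
  by move=> t _; apply: wcomp_sqint; exact: simple_fun_W12.
(* The definition of the Bochner integral does not state this measurability; the norm is rewritten
   through differences of components, which are measurable curves. *)
have mN n : measurable_fun D (fun t => N (simple_fun (s n) t - u t)).
  have md i : measurable_fun D (fun t => dot (wcomp i (simple_fun (s n) t) - wcomp i (u t))
      (wcomp i (simple_fun (s n) t) - wcomp i (u t))).
    by apply: (curve_dot_measurable mOm finOm); apply: curveB.
  have m3 := measurable_funD (measurable_funD (md None) (md (Some false))) (md (Some true)).
  have ms := measurableT_comp (continuous_measurable_fun (@sqrt_continuous R)) m3.
  apply: eq_measurable_fun ms => t /set_mem Dt /=.
  have ws := simple_fun_W12 ab XW (s n) t.
  have e i : dot (wcomp i (simple_fun (s n) t - u t)) (wcomp i (simple_fun (s n) t - u t)) =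
      dot (wcomp i (simple_fun (s n) t) - wcomp i (u t))
        (wcomp i (simple_fun (s n) t) - wcomp i (u t)).
    have eB := wcompB i ws (wu t Dt).
    have s1 := wcomp_sqint i (W12B ws (wu t Dt)).
    have s2 := sqintB mOm (wcomp_sqint i ws) (wcomp_sqint i (wu t Dt)).
    exact: (dot_ae_eq mOm s1 s2 s1 s2 eB eB).
  transitivity (Num.sqrt (N (simple_fun (s n) t - u t) ^+ 2)); last first.
    by rewrite sqrtr_sqr ger0_norm // sqrtr_ge0.
  rewrite W12norm_sqr; apply/esym.
  have alg (x y z x' y' z' : R) : x = x' -> y = y' -> z = z' ->
    Num.sqrt (x + y + z) = Num.sqrt (x' + y' + z') by move=> -> -> ->.
  exact: (alg _ _ _ _ _ _ (e None) (e (Some false)) (e (Some true))).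
have [IN cN] := ereal_int_cvg0 mN (fun n t _ => sqrtr_ge0 _) scvg.
have cg : curve (fun=> g) by exact: curve_cst.
have mg : measurable_fun D (fun t => dot g (u t)).
  exact: (curve_dot_measurable mOm finOm cg (cu None)).
pose c := Num.sqrt (dot g g).
have le n t : D t -> `|dot g (simple_fun (s n) t) - dot g (u t)| <= c * N (simple_fun (s n) t - u t).
  move=> Dt; have ws := simple_fun_W12 ab XW (s n) t.
  rewrite -dotBr //; [|exact: W12_sqint|exact: W12_sqint (wu t Dt)].
  by apply: dot_W12norm_le => //; apply: W12B => //; exact: wu.
(* The distances to the simple functions are integrable from rank [n0] on; one such rank already
   gives integrability of the pairing. *)
have [n0 _ hn0] := IN.
have Iu : rintegrable leb D (fun t => dot g (u t)).
  have [Is _] := Rint_dot_simple (s n0) sg.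
  apply: (rintegrable_le mD mg _ (rintegrableD mD (rintegrable_norm Is)
    (rintegrableZ mD c (hn0 n0 (leqnn n0))))) => t Dt.
  have := le n0 t Dt; rewrite -[X in _ -> `|X| <= _](subrK (dot g (simple_fun (s n0) t))).
  rewrite distrC => h; rewrite (le_trans (ler_normD _ _)) // addrC lerD2l //.
split=> //; apply/eqP; rewrite -subr_eq0 -normr_eq0 eq_le normr_ge0 andbT.
apply/ler_addgt0Pl => e e0; rewrite addr0.
have [n1 _ hn1] := cvg0D_lt c cN Icvg e0.
pose n := maxn n0 n1; have {}hn1 : c * _ + c * _ < e := hn1 n (leq_maxr _ _).
have [Is eI] := Rint_dot_simple (s n) sg.
have wI : W12 Om I by exact: XW.
have wsI := simple_int_W12 (s n).
apply: le_trans (ltW hn1).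
set J := \int[leb]_(t in D) dot g (u t).
have -> : J - dot g I = - (\int[leb]_(t in D) dot g (simple_fun (s n) t) - J)
    + (dot g (simple_int T (s n)) - dot g I).
  by rewrite eI; ring.
rewrite (le_trans (ler_normD _ _)) // normrN; apply: lerD.
  have h1 := hn0 n (leq_maxl _ _).
  rewrite -(RintegralB mD Is Iu) -(RintegralZl c mD h1).
  by apply: (Rint_norm_le mD); [exact: rintegrableB|exact: rintegrableZ|exact: le].
rewrite -dotBr //; [|exact: W12_sqint..].
by apply: dot_W12norm_le => //; exact: W12B.
Qed.

(** Pairing with a fixed [g] reduces the vector-valued weak derivative to [weak_derivative_FTC]; the
    continuous representative required by [W12T] supplies the continuity. *)
Lemma W12T_FTC g u v : sqi g -> W12T T X N u v ->
  forall x y, 0 <= x -> x <= y -> y <= T ->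
  dot g (u y) - dot g (u x) = \int[leb]_(t in `]x, y[) dot g (v t).
Proof.
move=> sg [Lu Lv uv [Xu cu]].
have wu := L2T_W12curve ab XW Lu; have wv := L2T_W12curve ab XW Lv.
have cg : curve2 (fun=> g) by apply: curve2_fin_valued => //; exact: fin_valued_cst.
have Iu := curve2_dot_integrable mOm finOm mD cg (wu.2 None).
have Iv := curve2_dot_integrable mOm finOm mD cg (wv.2 None).
apply: (weak_derivative_FTC _ Iu Iv).
  move=> t e tT e0; pose c := Num.sqrt (dot g g) + 1.
  have c0 : 0 < c by rewrite ltr_wpDl // sqrtr_ge0.
  have [d d0 hd] := cu t (e / c) tT (divr_gt0 e0 c0).
  exists d => // s sT st; have := hd s sT st.
  have [ws wt] := (XW (Xu s sT), XW (Xu t tT)).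
  rewrite -dotBr //; [|exact: W12_sqint..].
  rewrite ltr_pdivlMr // => h; apply: le_lt_trans h.
  rewrite (le_trans (dot_W12norm_le sg (W12B ws wt))) // mulrC ler_wpM2l ?sqrtr_ge0 //.
  by rewrite lerDl.
move=> eta teta; have [I [B1 B2]] := uv eta teta.
have [_ e1] := Bochner_int_dot sg B1; have [_ e2] := Bochner_int_dot sg B2.
have [_ XI _] := B1; have sI := W12_sqint (XW XI).
have -> : \int[leb]_(t in `]0, T[) (derive1 eta t * dot g (u t)) = dot g I.
  rewrite -e1; apply: Rint_eq => t Dt.
  by rewrite -dotZr //; exact: W12_sqint (wu.1 t Dt).
have -> : \int[leb]_(t in `]0, T[) (eta t * dot g (v t)) = dot g (- I).
  rewrite -e2; apply: Rint_eq => t Dt.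
  by rewrite -dotZr //; exact: W12_sqint (wv.1 t Dt).
by rewrite -(scaleN1r I) (dotZr mOm (-1) sg sI) mulN1r opprK.
Qed.

End BochnerPairing.

(** * Integration by parts in time against step data *)

Section TimeTerm.
Context {R : realType}.
Local Notation leb := (@lebesgue_measure R).
Local Notation TR := (measurableTypeR R).
Local Notation mu2 := (leb \x leb)%E.
Variables (a b T : R).
Hypotheses (ab : a < b) (T0 : 0 < T).
Local Notation E := (R * R -> R).
Local Notation Om := (box a b 0 1).
Local Notation D := ([set` `]0, T[] : set TR).
Local Notation sqi := (sqint mu2 Om).
Local Notation dot := (L2dot mu2 Om).
Local Notation curve := (curve mu2 Om D).
Local Notation curve2 := (curve2 mu2 Om leb D).
Local Notation cdot := (curve_dot mu2 Om leb D).
Local Notation N := (W12norm Om).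
Variable X : set E.
Hypothesis XW : X `<=` W12 Om.

Let mOm : measurable Om. Proof. exact: measurable_box. Qed.
Let finOm : (mu2 Om < +oo)%E. Proof. exact: rect_finite. Qed.
Let mD : measurable D. Proof. exact: measurable_itv. Qed.
Let finD : (leb D < +oo)%E.
Proof. by rewrite lebesgue_measure_itv /= lte_fin T0 -EFinD ltry. Qed.

Variables (M : nat) (s : nat -> E).
Hypotheses (M0 : (0 < M)%N) (ss : forall k, (k <= M)%N -> sqi (s k)).

Local Notation d := (dt T M).
Let d0 : 0 < d. Proof. exact: dt_gt0. Qed.

(** With [S \o psi k] for [s k] this is [S_hat] by conversion. *)
Definition pw_affine (t : R) : E :=
  let k := step T M t in s k.-1 + ((t - k.-1%:R * d) / d) *: (s k - s k.-1).

Definition increment (t : R) : E := let k := step T M t in s k - s k.-1.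

Lemma dt_cvg0_inS : dt T n.+1 @[n --> \oo] --> (0 : R).
Proof. by apply: cvg0_scale; exact: cvg_harmonic. Qed.

Lemma step_curve2 : curve2 (fun t => s (step T M t)).
Proof.
apply: curve2_fin_valued => //; first exact: fin_valued_step.
by move=> t /(step_ae T0 M0)[k [kM -> _]]; exact: ss.
Qed.

Lemma increment_curve2 : curve2 increment.
Proof.
apply: curve2_fin_valued => //.
  exact: (fin_valued_step T0 (fun k => s k - s k.-1) M0).
move=> t /(step_ae T0 M0)[k [kM e _]]; rewrite /increment e.
by apply: sqintB => //; apply: ss => //; exact: ltnW.
Qed.

Lemma pw_affine_curve2 : curve2 pw_affine.
Proof.
apply: curve2D => //.
  apply: curve2_fin_valued => //; first exact: (fin_valued_step T0 (fun k => s k.-1) M0).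
  by move=> t /(step_ae T0 M0)[k [kM -> _]]; apply: ss => //; exact: ltnW.
(* In the affine weight the time [t] is replaced by the right end point of its step in the grid of
   [n.+1] steps, which is finitely valued and converges to [t]. *)
apply: (curve2_mul mOm finOm mD (th_ := fun n t =>
   ((step T n.+1 t)%:R * dt T n.+1 - (step T M t).-1%:R * d) / d) _ _ _ increment_curve2).
- move=> n; apply: (fin_valued2 (fun x y => (x - y) / d)).
    exact: (fin_valued_step T0 (fun k => k%:R * dt T n.+1) (ltn0Sn n)).
  exact: (fin_valued_step T0 (fun k => k.-1%:R * d) M0).
- move=> t Dt; apply: cvgMl; apply: cvgB; last exact: cvg_cst.
  apply: (step_cvg T0 (N := succn)) => //; exact: dt_cvg0_inS.
- move=> t Dt; have [k [kM -> /andP[h1 h2]]] := step_ae T0 M0 Dt.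
  rewrite normrM normfV (gtr0_norm d0) ler_pdivrMr // mul1r ger0_norm ?subr_ge0 ?(ltW h1) //.
  by rewrite /= lerBlDr -{1}[d]mul1r -mulrDl addrC natr1.
Qed.

Variables (phi dphi : R -> E).
Hypothesis Wphi : W12T T X N phi dphi.

(** Formally the time derivative of the pairing of [pw_affine t] with [phi t] inside a step, by the
    product rule. *)
Let F t := d^-1 * dot (increment t) (phi t) + dot (pw_affine t) (dphi t).

(** On the step, [pw_affine] is [s k] plus an affine multiple of the jump [g]. The constant part is
    the fundamental theorem for [s k]; the affine part is [weak_derivative_ibp] for [g], whose
    integral term cancels the difference quotient. *)
Lemma time_term_step k : (k < M)%N ->
  \int[leb]_(t in `]k%:R * d, k.+1%:R * d[) F t =
  dot (s k.+1) (phi (k.+1%:R * d)) - dot (s k) (phi (k%:R * d)).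
Proof.
move=> kM; have [Lu Lv _ [Xu _]] := Wphi.
have wu := L2T_W12curve ab XW Lu; have wv := L2T_W12curve ab XW Lv.
pose J : set TR := [set` `]k%:R * d, k.+1%:R * d[].
have mJ : measurable J by exact: measurable_itv.
have kd : k.+1%:R * d = k%:R * d + d by rewrite -natr1 mulrDl mul1r.
have k0 : 0 <= k%:R * d by rewrite mulr_ge0 // ltW.
have kT : k.+1%:R * d <= T by rewrite -[leRHS](dtN T M0) ler_pM2r // ler_nat.
have klt : k%:R * d < k.+1%:R * d by rewrite kd ltrDl.
have JD : J `<=` D.
  move=> t; rewrite /J /= !in_itv /= => /andP[h1 h2].
  by rewrite (le_lt_trans k0 h1) (lt_le_trans h2 kT).
have s1 := ss kM; have s2 := ss (ltnW kM).
pose g := s k.+1 - s k; have sg : sqi g by exact: sqintB.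
have I (z : E) (w : R -> E) : sqi z -> W12curve a b T w -> rintegrable leb J (fun t => dot z (w t)).
  move=> sz ww; have cz : curve2 (fun=> z) by apply: curve2_fin_valued => //; exact: fin_valued_cst.
  exact: (integrableS _ _ JD (curve2_dot_integrable mOm finOm mD cz (ww.2 None))).
have FTC z (sz : sqi z) := W12T_FTC ab T0 XW sz Wphi.
have Ih := I g phi sg wu; have Iv := I g dphi sg wv; have Ik := I (s k) dphi s2 wv.
have Itv : rintegrable leb J (fun t => (t - k%:R * d) * dot g (dphi t)).
  apply: (rintegrable_le mJ _ _ (rintegrableZ mJ d (rintegrable_norm Iv))).
    apply: measurable_funM; last exact: rintegrable_measurable Iv.
    by apply: measurable_funB => //; exact: measurable_id.
  move=> t; rewrite /J /= in_itv /= => /andP[h1 h2]; rewrite normrM ler_wpM2r //.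
  by rewrite ger0_norm ?subr_ge0 ?(ltW h1) // lerBlDr addrC -kd ltW.
have ibp : \int[leb]_(t in J) ((t - k%:R * d) * dot g (dphi t)) =
    d * dot g (phi (k.+1%:R * d)) - \int[leb]_(t in J) dot g (phi t).
  have ed : k.+1%:R * d - k%:R * d = d by rewrite kd addrAC subrr add0r.
  rewrite -{2}ed; apply: (@weak_derivative_ibp R (fun t => dot g (phi t)) (fun t => dot g (dphi t))
    (k%:R * d) (k.+1%:R * d) klt Ih Iv) => t /andP[h1 h2].
  by apply: FTC => //; exact: le_trans h1.
have e1 : \int[leb]_(t in J) F t =
    \int[leb]_(t in J) ((d^-1 * dot g (phi t) + dot (s k) (dphi t)) +
      d^-1 * ((t - k%:R * d) * dot g (dphi t))).
  apply: Rint_eq => t Jt; have e : step T M t = k.+1.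
    by apply: stepE => //; move: Jt; rewrite /J /= in_itv /= => /andP[-> /ltW].
  have sv := wv.2 None; have sd := wcomp_sqint None (wv.1 t (JD t Jt)).
  rewrite /F /increment /pw_affine e /= -/g.
  rewrite (dotDl mOm s2 (sqintZ mOm _ sg) sd) (dotZl mOm _ sg sd).
  have alg (x y z w v : R) : x * y + (z + w * x * v) = x * y + z + x * (w * v) by ring.
  exact: alg.
have eT := FTC (s k) s2 (k%:R * d) (k.+1%:R * d) k0 (ltW klt) kT.
have I1 := rintegrableZ mJ d^-1 Ih; have I2 := rintegrableD mJ I1 Ik.
rewrite -/J e1 (RintegralD mJ I2 (rintegrableZ mJ d^-1 Itv)) (RintegralD mJ I1 Ik).
rewrite (RintegralZl d^-1 mJ Ih) (RintegralZl d^-1 mJ Itv) ibp -eT.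
have [spk spk1] : sqi (phi (k%:R * d)) /\ sqi (phi (k.+1%:R * d)).
  by split; apply: W12_sqint => //; apply: XW; apply: Xu;
    rewrite ?k0 ?(le_trans k0 (ltW klt)) ?kT ?(le_trans (ltW klt) kT).
rewrite [dot g (phi (k.+1%:R * d))](dotBl mOm s1 s2 spk1).
have alg (x y z w v : R) : x != 0 ->
    x^-1 * y + (z - w) + x^-1 * (x * (v - z) - y) = v - w by move=> x0; field.
by apply: alg; rewrite gt_eqF.
Qed.

Lemma F_integrable : rintegrable leb D F.
Proof.
have [Lu Lv _ _] := Wphi.
have wu := L2T_W12curve ab XW Lu; have wv := L2T_W12curve ab XW Lv.
apply: (rintegrableD mD).
  apply: (rintegrableZ mD).
  exact: (curve2_dot_integrable mOm finOm mD increment_curve2 (wu.2 None)).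
exact: (curve2_dot_integrable mOm finOm mD pw_affine_curve2 (wv.2 None)).
Qed.

Lemma time_term_sum k : (k <= M)%N -> \int[leb]_(t in `]0, k%:R * d[) F t =
  dot (s k) (phi (k%:R * d)) - dot (s 0%N) (phi 0).
Proof.
elim: k => [|k IHk] kM.
  by rewrite mul0r subrr set_itvoo0 Rintegral_set0.
have k0 : 0 <= k%:R * d by rewrite mulr_ge0 // ltW.
have klt : k%:R * d < k.+1%:R * d by rewrite ltr_pM2r // ltr_nat.
have kT : k.+1%:R * d <= T by rewrite -[leRHS](dtN T M0) ler_pM2r // ler_nat.
have IF : rintegrable leb `]0, k.+1%:R * d[ F.
  apply: (integrableS _ _ _ F_integrable); try exact: measurable_itv.
  by apply: subset_itvl; rewrite bnd_simp.
have alg (x y z w v : R) : x = y + z -> y = w - v -> forall r, z = r - w -> x = r - v.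
  by move=> -> -> r ->; ring.
exact: (alg _ _ _ _ _ (Rint_itv_split k0 klt IF) (IHk (ltnW kM)) _ (time_term_step kM)).
Qed.

(* Integrating by parts on each step turns the difference quotient into the
   piecewise affine interpolation; the boundary terms telescope. *)
Lemma time_term : d^-1 * cdot increment phi =
  dot (s M) (phi T) - dot (s 0%N) (phi 0) - cdot pw_affine dphi.
Proof.
have [Lu Lv _ _] := Wphi.
have wu := L2T_W12curve ab XW Lu; have wv := L2T_W12curve ab XW Lv.
have I1 := curve2_dot_integrable mOm finOm mD increment_curve2 (wu.2 None).
have I2 := curve2_dot_integrable mOm finOm mD pw_affine_curve2 (wv.2 None).
have := time_term_sum (leqnn M); rewrite (dtN T M0) => <-.
rewrite (RintegralD mD (rintegrableZ mD d^-1 I1) I2) (RintegralZl d^-1 mD I1).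
by rewrite -/(cdot pw_affine dphi) addrK.
Qed.

End TimeTerm.

Lemma bounded_of_continuous_itv (R : realType) (T : R) (h : R -> R) : 0 < T ->
  (forall t e, 0 <= t <= T -> 0 < e -> exists2 d, 0 < d &
    forall s, 0 <= s <= T -> `|s - t| < d -> `|h s - h t| < e) ->
  exists B, forall t, 0 <= t <= T -> h t <= B.
Proof.
(* Composition with the clamp extends [h] continuously to the whole line, where the extreme value
   theorem applies. *)
move=> T0 ch; pose cl t := clamp 0 T t.
have cl0T t : 0 <= cl t <= T by exact: clamp_bounds (ltW T0).
have cc : continuous (h \o cl).
  move=> t; apply/cvgrPdist_lt => e e0.
  have [d d0 hd] := ch (cl t) e (cl0T t) e0.
  have : \forall s \near t, `|t - s| < d by apply: (@cvgr_dist_lt _ _ _ (nbhs t) _ id t (@cvg_id _ (nbhs t))).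
  apply: filterS => s ts; rewrite /= distrC; apply: hd => //.
  by rewrite (le_lt_trans (clamp_lip _ _ s t)) // distrC.
have [c _ hc] := @EVT_max R (h \o cl) 0 T (ltW T0) (@continuous_subspaceT _ _ _ _ cc).
exists (h (cl c)) => t tT; have := hc t; rewrite /= in_itv /= {1}/cl (clamp_id tT).
exact.
Qed.

(** * Sources sampled on the grid and Green functionals in time *)

Section TimeLimits.
Context {R : realType}.
Local Notation leb := (@lebesgue_measure R).
Local Notation TR := (measurableTypeR R).
Local Notation mu2 := (leb \x leb)%E.
Variables (a b T : R).
Hypotheses (ab : a < b) (T0 : 0 < T).
Local Notation E := (R * R -> R).
Local Notation Om := (box a b 0 1).
Local Notation D := ([set` `]0, T[] : set TR).
Local Notation sqi := (sqint mu2 Om).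
Local Notation dot := (L2dot mu2 Om).
Local Notation curve := (curve mu2 Om D).
Local Notation curve2 := (curve2 mu2 Om leb D).
Local Notation cdot := (curve_dot mu2 Om leb D).
Local Notation wcomp := (wcomp a b).
Local Notation N := (W12norm Om).
Local Notation W12curve := (W12curve a b T).

Let mOm : measurable Om. Proof. exact: measurable_box. Qed.
Let finOm : (mu2 Om < +oo)%E. Proof. exact: rect_finite. Qed.
Let mD : measurable D. Proof. exact: measurable_itv. Qed.
Let finD : (leb D < +oo)%E.
Proof. by rewrite lebesgue_measure_itv /= lte_fin T0 -EFinD ltry. Qed.

Lemma L2norm_sqr (u : E) : L2norm Om u ^+ 2 = dot u u.
Proof. by rewrite /L2norm sqr_sqrtr // ip_dot dot_ge0. Qed.

Lemma strong_cvg_cdot (u_ : nat -> R -> E) u : (forall n, curve2 (u_ n)) -> curve2 u ->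
  strong_cvg T (L2norm Om) u_ u ->
  cdot (fun t => u_ n t - u t) (fun t => u_ n t - u t) @[n --> \oo] --> (0 : R).
Proof.
move=> cu_ cu su.
have [|||_ h] := @ereal_int_cvg0 _ _ _ leb D
    (fun n t => dot (u_ n t - u t) (u_ n t - u t)).
- move=> n; have c := curve2B mOm finOm mD (cu_ n) cu.
  exact: (curve_dot_measurable mOm finOm c.1 c.1).
- by move=> n t _; exact: dot_ge0.
- apply: cvg_trans su; apply: near_eq_cvg; apply: nearW => n.
  by apply: eq_integral => t _; rewrite L2norm_sqr.
- exact: h.
Qed.

Section ContinuousInTime.
Variable f : R -> E.
Hypothesis cf : CT T (L2 Om) (L2norm Om) f.

Let sf t : 0 <= t <= T -> sqi (f t). Proof. by case: cf => h _; exact: h. Qed.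

Lemma CT_dot_bounded : exists B, forall t, 0 <= t <= T -> dot (f t) (f t) <= B.
Proof.
apply: bounded_of_continuous_itv => // t e tT e0.
pose c := Num.sqrt (dot (f t) (f t)).
have c0 : 0 <= c by exact: sqrtr_ge0.
(* Since [r <= 1], the change of the squared norm is at most [r ^+ 2 + 2 * r * c], hence at most
   [r * (1 + 2 * c)], which is below [e]. *)
pose r := Num.min 1 (e / (2 + 2 * c)).
have c2 : 0 < 2 + 2 * c by lra.
have r0 : 0 < r by rewrite /r lt_min ltr01 divr_gt0.
have re : r * (1 + 2 * c) < e.
  have : r * (2 + 2 * c) <= e by rewrite -ler_pdivlMr // /r ge_min lexx orbT.
  by move: r0; nra.
have r1 : r <= 1 by rewrite /r ge_min lexx.
case: cf => _ /(_ t r tT r0)[d d0 hd]; exists d => // s sT st.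
have := hd s sT st; have [ss st'] := (sf sT, sf tT).
have sd := sqintB mOm ss st'.
have -> : dot (f s) (f s) - dot (f t) (f t) =
    dot (f s - f t) (f s - f t) + 2 * dot (f s - f t) (f t).
  have alg (p q x y z w v u : R) : p = x - y -> x = z - w -> y = v - u -> q = w - u ->
      v = w -> z - u = p + 2 * q by move=> -> -> -> -> ->; ring.
  exact: (alg _ _ _ _ _ _ _ _ (dotBl mOm ss st' sd) (dotBr mOm ss st' ss)
    (dotBr mOm ss st' st') (dotBl mOm ss st' st') (dotC mu2 Om (f t) (f s))).
have := dot_CS mOm sd st'; rewrite -L2norm_sqr -/c.
have := sqrtr_ge0 (dot (f s - f t) (f s - f t)).
rewrite -[Num.sqrt (dot (f s - f t) _)]/(L2norm Om (f s - f t)).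
move: (L2norm Om _) (dot (f s - f t) (f t)) => x y x0 xy xr.
rewrite (le_lt_trans (ler_normD _ _)) // ger0_norm ?sqr_ge0 // normrM ger0_norm //.
apply: le_lt_trans re; move: xy; rewrite sqrtr_sqr (ger0_norm x0) => xy.
have h1 : x ^+ 2 <= r by rewrite expr2; nra.
have h2 : x * c <= r * c by rewrite ler_wpM2r // ltW.
by move: xy h1 h2; lra.
Qed.

Lemma CT_seq_cvg (t_ : nat -> R) t : (forall n, 0 <= t_ n <= T) -> 0 <= t <= T ->
  t_ n @[n --> \oo] --> t ->
  dot (f (t_ n) - f t) (f (t_ n) - f t) @[n --> \oo] --> (0 : R).
Proof.
move=> t_T tT ct; apply/cvgrPdist_lt => e e0.
have s0 : 0 < Num.sqrt e by rewrite sqrtr_gt0.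
case: cf => _ /(_ t _ tT s0)[d d0 hd]; near=> n.
have : L2norm Om (f (t_ n) - f t) < Num.sqrt e.
  apply: hd => //; rewrite distrC.
  by near: n; move/cvgrPdist_lt: ct; exact.
rewrite sub0r normrN ger0_norm ?dot_ge0 // -L2norm_sqr => h.
rewrite -(sqr_sqrtr (ltW e0)) ltr_pXn2r // nnegrE sqrtr_ge0 //.
Unshelve. all: by end_near.
Qed.

(** The value of [f] at the right end point of the step containing [t], as in the discrete
    equation. *)
Definition sampled (M : nat) (t : R) : E := f ((step T M t)%:R * dt T M).

Lemma step_itv M t : (0 < M)%N -> D t -> 0 <= (step T M t)%:R * dt T M <= T.
Proof.
move=> M0 /(step_ae T0 M0)[k [kM -> _]]; have d0 := dt_gt0 T0 M0.
by rewrite mulr_ge0 ?(ltW d0) //= -[leRHS](dtN T M0) ler_pM2r // ler_nat.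
Qed.

Lemma sampled_curve2 M : (0 < M)%N -> curve2 (sampled M).
Proof.
move=> M0; apply: curve2_fin_valued => //.
  exact: (fin_valued_step T0 (fun k => f (k%:R * dt T M)) M0).
by move=> t Dt; apply: sf; exact: step_itv.
Qed.

Lemma D_itv t : D t -> 0 <= t <= T.
Proof. by rewrite /= in_itv /= => /andP[/ltW -> /ltW ->]. Qed.

Lemma CT_curve2 : curve2 f.
Proof.
have cu : curve f.
  exists (fun n => sampled n.+1); split.
    by move=> n; exact: (fin_valued_step T0 (fun k => f (k%:R * dt T n.+1))).
  move=> t Dt; split; first exact: sf (D_itv Dt).
    by move=> n; apply: sf; exact: step_itv.
  apply: CT_seq_cvg; first by move=> n; exact: step_itv.
    exact: D_itv.
  by apply: (step_cvg T0 (N := succn)) => //; exact: dt_cvg0_inS.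
split=> //; have [B hB] := CT_dot_bounded.
apply: (rintegrable_le mD (curve_dot_measurable mOm finOm cu cu) _
  (rintegrable_cst mD B finD)) => t Dt.
by rewrite ger0_norm ?dot_ge0 // hB // D_itv.
Qed.

(** Pointwise convergence in time from the continuity of [f], dominated by a constant because [f] is
    bounded on the closed interval. *)
Lemma sampled_cvg (M : nat -> nat) : (forall n, (0 < M n)%N) ->
  dt T (M n) @[n --> \oo] --> (0 : R) ->
  cdot (fun t => sampled (M n) t - f t) (fun t => sampled (M n) t - f t)
    @[n --> \oo] --> (0 : R).
Proof.
move=> M0 cM; have [B hB] := CT_dot_bounded.
have cd n := curve2B mOm finOm mD (sampled_curve2 (M0 n)) CT_curve2.
have [|||_ h] := @Rint_dominated _ _ _ leb D mD
  (fun n t => dot (sampled (M n) t - f t) (sampled (M n) t - f t)) (fun=> 0)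
  (fun=> 2 * B + 2 * B) _ _ _ (rintegrable_cst mD _ finD).
- by move=> n; exact: (curve_dot_measurable mOm finOm (cd n).1 (cd n).1).
- move=> t Dt; apply: CT_seq_cvg; first by move=> n; exact: step_itv.
    exact: D_itv.
  exact: step_cvg.
- move=> n t Dt; rewrite ger0_norm ?dot_ge0 //.
  have s1 := sf (step_itv (M0 n) Dt); have s2 := sf (D_itv Dt).
  have sN : sqi (- f t) by rewrite -scaleN1r; exact: sqintZ.
  rewrite (le_trans (dotD_le mOm s1 sN)) //.
  have -> : dot (- f t) (- f t) = dot (f t) (f t).
    by apply: Rint_eq => p _; rewrite !fctE mulrNN.
  by rewrite lerD // ler_pM2l // hB // ?step_itv // D_itv.
by move: h; rewrite Rintegral_cst // mul0r.
Qed.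

End ContinuousInTime.

Variable X : set E.
Hypothesis XW : X `<=` W12 Om.

Lemma dual_cdot i z : curve2 z ->
  dual_L2T T X N (fun u => cdot z (fun t => wcomp i (u t))).
Proof.
move=> cz; apply: dual_W12curve => //.
  by move=> k u v wu wv; exact: (cdot_comb i k wu wv cz).
exists (Num.sqrt (cdot z z)) => u wu.
rewrite (le_trans (cdot_CS mOm finOm mD cz (wu.2 i))) // ler_wpM2l ?sqrtr_ge0 //.
have h j : 0 <= cdot (fun t => wcomp j (u t)) (fun t => wcomp j (u t)) by exact: cdot_ge0.
rewrite ler_wsqrtr // /nrmT2; case: i => [[]|].
- by rewrite lerDr addr_ge0.
- by rewrite -addrA addrCA lerDl addr_ge0.
- by rewrite -addrA lerDl addr_ge0.
Qed.

Lemma green_integrable s c u : W12curve u -> rintegrable leb D (fun t => green a b s c (u t)).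
Proof.
move=> wu.
have k1 : curve2 (fun=> green_weight a b s c).
  by apply: curve2_fin_valued => [//|//|//||t _]; [exact: fin_valued_cst|exact: green_weight_sqint].
have k0 : curve2 (fun=> green_weight0 a b c).
  by apply: curve2_fin_valued => [//|//|//||t _]; [exact: fin_valued_cst|exact: green_weight0_sqint].
apply: (rintegrableD mD).
  exact: (curve2_dot_integrable mOm finOm mD (wu.2 (Some false)) k1).
exact: (curve2_dot_integrable mOm finOm mD (wu.2 None) k0).
Qed.

(** The indicator of [A] is absorbed into the fixed weights, so the Green functional localized in
    time is itself a continuous functional. *)
Lemma green_weak_cvg (A : set TR) s c (u_ : nat -> R -> E) u : measurable A ->
  (forall n, W12curve (u_ n)) -> W12curve u -> weak_cvg T X N u_ u ->
  \int[leb]_(t in D) (\1_A t * green a b s c (u_ n t)) @[n --> \oo] -->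
  \int[leb]_(t in D) (\1_A t * green a b s c (u t)).
Proof.
move=> mA wu_ wu cu.
have cw (z : E) : sqi z -> curve2 (fun t => (\1_A t : R) *: z).
  move=> sz; apply: curve2_fin_valued => [//|//|//||t _]; last exact: sqintZ.
  exists bool, (fun t => t \in A), (fun i : bool => i%:R *: z); split=> [i|t _]; last by rewrite indicE.
  rewrite (_ : _ @^-1` _ = if i then A else ~` A).
    by apply: measurableI => //; case: i => //; exact: measurableC.
  case: i; apply/seteqP; split => t /= h; [exact: set_mem|exact: mem_set| |exact: memNset].
  by move=> At; rewrite mem_set in h.
have k1 := cw _ (green_weight_sqint a b s c); have k0 := cw _ (green_weight0_sqint a b c).
have e v : W12curve v -> \int[leb]_(t in D) (\1_A t * green a b s c (v t)) =
    cdot (fun t => (\1_A t : R) *: green_weight a b s c) (fun t => wcomp (Some false) (v t)) +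
    cdot (fun t => (\1_A t : R) *: green_weight0 a b c) (fun t => wcomp None (v t)).
  move=> wv.
  have I1 := curve2_dot_integrable mOm finOm mD k1 (wv.2 (Some false)).
  have I0 := curve2_dot_integrable mOm finOm mD k0 (wv.2 None).
  rewrite -(RintegralD mD I1 I0); apply: Rint_eq => t Dt.
  have v1 := curve_sqint (wv.2 (Some false)).1 Dt; have v0 := curve_sqint (wv.2 None).1 Dt.
  rewrite (dotZl mOm _ (green_weight_sqint a b s c) v1).
  rewrite (dotZl mOm _ (green_weight0_sqint a b c) v0) -mulrDr.
  by rewrite /green; congr (_ * (_ + _)); exact: dotC.
rewrite e //.
have h1 := cu _ (dual_cdot (Some false) k1); have h0 := cu _ (dual_cdot None k0).
have alg (x y z : nat -> R) (p q : R) : x n @[n --> \oo] --> p -> y n @[n --> \oo] --> q ->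
    (forall n, z n = x n + y n) -> z n @[n --> \oo] --> p + q.
  by move=> cx cy xyz; rewrite (_ : z = (fun n => x n + y n)); [exact: cvgD|exact/funext].
exact: (alg _ _ _ _ _ h1 h0 (fun n => e _ (wu_ n))).
Qed.

End TimeLimits.

Lemma ae_leb_imply {R : realType} (P Q : R -> Prop) : (forall y, P y -> Q y) ->
  {ae @lebesgue_measure R, forall y, P y} -> {ae @lebesgue_measure R, forall y, Q y}.
Proof. by move=> PQ; apply: (@filterS (measurableTypeR R)). Qed.

(** * Coupling of the traces *)

Section Coupling.
Context {R : realType}.
Local Notation leb := (@lebesgue_measure R).
Local Notation TR := (measurableTypeR R).
Variables (a b a' b' T : R) (s s' : side).
Hypotheses (ab : a < b) (ab' : a' < b') (T0 : 0 < T).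
Hypotheses (sv : s = Left \/ s = Right) (sv' : s' = Left \/ s' = Right).
Local Notation E := (R * R -> R).
Local Notation D := ([set` `]0, T[] : set TR).
Variables (X X' : set E).
Hypotheses (XW : X `<=` W12 (box a b 0 1)) (XW' : X' `<=` W12 (box a' b' 0 1)).

(** [trace_eq] for two arbitrary rectangles, so that both interfaces are treated at once. *)
Definition same_trace (u u' : E) : Prop := exists g g',
  [/\ has_trace a b u g, has_trace a' b' u' g' &
      {ae leb, forall y, 0 < y < 1 -> g s y = g' s' y}].

Let mD : measurable D. Proof. exact: measurable_itv. Qed.

Lemma same_trace_green u u' c : 0 < c < 1 -> same_trace u u' ->
  green a b s c u = green a' b' s' c u'.
Proof.
move=> c01 [g [g' [tg tg' e]]].
have [I1 ->] := green_trace ab sv c01 tg; have [I2 ->] := green_trace ab' sv' c01 tg'.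
have m01 : measurable ([set` `]0, 1[] : set TR) by exact: measurable_itv.
apply: Rint_ae_eq => //.
- by apply: rintegrable_indic => //; exact: measurable_itv.
- have J2 := rintegrable_indic m01 I2 (measurable_itv `]-oo, c[).
  exact: rintegrable_measurable J2.
- have e' : {ae leb, forall y, [set` `]0, 1[] y ->
      (\1_(`]-oo, c[) y : R) * g s y = \1_(`]-oo, c[) y * g' s' y}.
    by move: e; apply: ae_leb_imply => y h; rewrite /= in_itv /= => /h ->.
  exact: e'.
Qed.

(** Existence of the traces of the limits is a hypothesis, to be supplied by membership in [VV];
    only their equality has to pass to the limit. *)
Lemma same_trace_limit (u_ u_' : nat -> R -> E) u u' :
  (forall n, W12curve a b T (u_ n)) -> (forall n, W12curve a' b' T (u_' n)) ->
  W12curve a b T u -> W12curve a' b' T u' ->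
  weak_cvg T X (W12norm (box a b 0 1)) u_ u ->
  weak_cvg T X' (W12norm (box a' b' 0 1)) u_' u' ->
  (forall n t, D t -> same_trace (u_ n t) (u_' n t)) ->
  (forall t, D t -> exists g, has_trace a b (u t) g) ->
  (forall t, D t -> exists g, has_trace a' b' (u' t) g) ->
  {ae leb, forall t, D t -> same_trace (u t) (u' t)}.
Proof.
move=> wu_ wu_' wu wu' cu cu' st tu tu'.
have key c : 0 < c < 1 ->
    {ae leb, forall t, D t -> green a b s c (u t) - green a' b' s' c (u' t) = 0}.
  move=> c01; have I1 := green_integrable T0 s c wu.
  have I2 := green_integrable T0 s' c wu'.
  apply: (ae_zero_of_integrals mD (rintegrableB mD I1 I2)) => A mA.
  have h1 := green_weak_cvg ab T0 XW (s:=s) (c:=c) mA wu_ wu cu.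
  have h2 := green_weak_cvg ab' T0 XW' (s:=s') (c:=c) mA wu_' wu' cu'.
  have e n : \int[leb]_(t in D) (\1_A t * green a b s c (u_ n t)) =
      \int[leb]_(t in D) (\1_A t * green a' b' s' c (u_' n t)).
    by apply: Rint_eq => t Dt; rewrite (same_trace_green c01 (st n t Dt)).
  have J1 := rintegrable_indic mD I1 mA; have J2 := rintegrable_indic mD I2 mA.
  transitivity (\int[leb]_(t in D) (\1_A t * green a b s c (u t) - \1_A t * green a' b' s' c (u' t))).
    by apply: Rint_eq => t _; rewrite mulrBr.
  rewrite (RintegralB mD J1 J2); apply/eqP; rewrite subr_eq0; apply/eqP.
  have alg (x y : nat -> R) (p q : R) : x n @[n --> \oo] --> p -> y n @[n --> \oo] --> q ->
      (forall n, x n = y n) -> p = q.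
    by move=> cx cy /funext xy; rewrite xy in cx; exact: cvg_unique cx cy.
  exact: (alg _ _ _ _ h1 h2 e).
(* The null set of times depends on the height. Enumerating the rationals by [unpickle] gives one
   null set for all rational heights. *)
have keyq : {ae leb, forall t, forall n : nat, D t -> forall q : rat, unpickle n = Some q ->
    0 < (ratr q : R) < 1 -> green a b s (ratr q) (u t) = green a' b' s' (ratr q) (u' t)}.
  apply: ae_foralln => n; case e : (unpickle n : option rat) => [q|]; last by apply: aeW => t _ ?.
  have [c01|c01] := boolP (0 < (ratr q : R) < 1); last first.
    by apply: aeW => t _ q' [<-] h; rewrite h in c01.
  apply: filterS (key _ c01) => t h Dt q' [<-] _; apply/eqP; rewrite -subr_eq0.
  by apply/eqP; exact: h.
apply: filterS keyq => t h Dt.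
have [[g tg] [g' tg']] := (tu t Dt, tu' t Dt); exists g, g'; split=> //.
(* An arbitrary height in []0, 1[], used to obtain the integrability of the two traces. *)
have h2 : 0 < (2^-1 : R) < 1 by lra.
have [I1 _] := green_trace ab sv h2 tg; have [I2 _] := green_trace ab' sv' h2 tg'.
have m01 : measurable ([set` `]0, 1[] : set TR) by exact: measurable_itv.
have : {ae leb, forall y, 0 < y < 1 -> g s y - g' s' y = 0}.
  apply: (ae_zero_of_rational_rays (rintegrableB m01 I1 I2)) => q q01.
  have [_ e1] := green_trace ab sv q01 tg; have [_ e2] := green_trace ab' sv' q01 tg'.
  have J1 := rintegrable_indic m01 I1 (measurable_itv `]-oo, (ratr q : R)[).
  have J2 := rintegrable_indic m01 I2 (measurable_itv `]-oo, (ratr q : R)[).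
  transitivity (\int[leb]_(y in `]0, 1[) (\1_(`]-oo, ratr q[) y * g s y - \1_(`]-oo, ratr q[) y * g' s' y)).
    by apply: Rint_eq => y _; rewrite mulrBr.
  rewrite (RintegralB m01 J1 J2) -e1 -e2 (h (pickle q) Dt q (pickleK q) q01).
  exact: subrr.
by apply: ae_leb_imply => y hy y01; apply/eqP; rewrite -subr_eq0; apply/eqP; exact: hy.
Qed.

End Coupling.

(** * Integration of the discrete balance in time and its limit *)

Lemma Rint_balance d (T : measurableType d) (R : realType) (mu : {measure set T -> \bar R})
    (D : set T) (d1 d2 d3 a1 a2 a3 b1 b2 b3 : T -> R) (k l e : R) : measurable D ->
  rintegrable mu D d1 -> rintegrable mu D d2 -> rintegrable mu D d3 ->
  rintegrable mu D a1 -> rintegrable mu D a2 -> rintegrable mu D a3 ->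
  rintegrable mu D b1 -> rintegrable mu D b2 -> rintegrable mu D b3 ->
  {ae mu, forall t, D t -> d1 t + d2 t + k * d3 t + e * (a1 t + a2 t) + l * e * a3 t
    = e * (b1 t + b2 t) + e * b3 t} ->
  \int[mu]_(t in D) d1 t + \int[mu]_(t in D) d2 t + k * \int[mu]_(t in D) d3 t
    + e * (\int[mu]_(t in D) a1 t + \int[mu]_(t in D) a2 t)
    + l * e * \int[mu]_(t in D) a3 t
  = e * (\int[mu]_(t in D) b1 t + \int[mu]_(t in D) b2 t) + e * \int[mu]_(t in D) b3 t.
Proof.
move=> mD D1 D2 D3 A1 A2 A3 B1 B2 B3.
have L1 := rintegrableD mD D1 D2; have L2 := rintegrableD mD L1 (rintegrableZ mD k D3).
have LA := rintegrableD mD A1 A2; have L3 := rintegrableD mD L2 (rintegrableZ mD e LA).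
have L4 := rintegrableD mD L3 (rintegrableZ mD (l * e) A3).
have LB := rintegrableD mD B1 B2.
have L5 := rintegrableD mD (rintegrableZ mD e LB) (rintegrableZ mD e B3).
move=> /(Rint_ae_eq mD L4 (rintegrable_measurable L5)).
rewrite (RintegralD mD L3 (rintegrableZ mD (l * e) A3)) (RintegralD mD L2 (rintegrableZ mD e LA)).
rewrite (RintegralD mD L1 (rintegrableZ mD k D3)) (RintegralD mD D1 D2).
rewrite (RintegralZl _ mD A3) (RintegralZl _ mD LA) (RintegralD mD A1 A2) (RintegralZl _ mD D3).
rewrite (RintegralD mD (rintegrableZ mD e LB) (rintegrableZ mD e B3)).
by rewrite (RintegralZl _ mD LB) (RintegralD mD B1 B2) (RintegralZl _ mD B3).
Qed.

(** [e_] is the time step, while [k] and [l] stand for the powers of [eps]. Only the increments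
    [d1], [d2], [d3] lack the factor [e_ n], so their limits are taken after division by it. *)
Lemma balance_limit (R : realType) (k l : R) (e_ d1 d2 d3 a1 a2 a3 b1 b2 b3 : nat -> R)
    (d1' d2' d3' a1' a2' a3' b1' b2' b3' : R) : (forall n, 0 < e_ n) ->
  (e_ n)^-1 * d1 n @[n --> \oo] --> d1' -> (e_ n)^-1 * d2 n @[n --> \oo] --> d2' ->
  (e_ n)^-1 * d3 n @[n --> \oo] --> d3' ->
  a1 n @[n --> \oo] --> a1' -> a2 n @[n --> \oo] --> a2' -> a3 n @[n --> \oo] --> a3' ->
  b1 n @[n --> \oo] --> b1' -> b2 n @[n --> \oo] --> b2' -> b3 n @[n --> \oo] --> b3' ->
  (forall n, d1 n + d2 n + k * d3 n + e_ n * (a1 n + a2 n) + l * e_ n * a3 n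
    = e_ n * (b1 n + b2 n) + e_ n * b3 n) ->
  d1' + d2' + k * d3' + (a1' + a2') + l * a3' = b1' + b2' + b3'.
Proof.
move=> e0 D1 D2 D3 A1 A2 A3 B1 B2 B3 h.
pose L n := (e_ n)^-1 * d1 n + (e_ n)^-1 * d2 n + k * ((e_ n)^-1 * d3 n)
   + (a1 n + a2 n) + l * a3 n.
have cL : L n @[n --> \oo] --> d1' + d2' + k * d3' + (a1' + a2') + l * a3'.
  apply: cvgD; last exact: cvgMr.
  apply: cvgD; last exact: cvgD.
  apply: cvgD; last exact: cvgMr.
  exact: cvgD.
have cR : b1 n + b2 n + b3 n @[n --> \oo] --> b1' + b2' + b3'.
  by apply: cvgD => //; exact: cvgD.
have e : L = (fun n => b1 n + b2 n + b3 n).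
  apply/funext => n; have en : e_ n != 0 by rewrite gt_eqF.
  apply: (mulfI en); rewrite [RHS]mulrDr -h /L.
  have alg (x y z w v u t : R) : x != 0 ->
    x * (x^-1 * y + x^-1 * z + k * (x^-1 * w) + (v + u) + l * t) =
    y + z + k * w + x * (v + u) + l * x * t by move=> x0; field.
  exact: alg.
by rewrite e in cL; exact: cvg_unique cL cR.
Qed.

(** * Limits of the terms of the weak form *)

Section RegionLimits.
Context {R : realType}.
Local Notation leb := (@lebesgue_measure R).
Local Notation TR := (measurableTypeR R).
Local Notation mu2 := (leb \x leb)%E.
Variables (a b T : R).
Hypotheses (ab : a < b) (T0 : 0 < T).
Local Notation E := (R * R -> R).
Local Notation Om := (box a b 0 1).
Local Notation D := ([set` `]0, T[] : set TR).
Local Notation sqi := (sqint mu2 Om).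
Local Notation dot := (L2dot mu2 Om).
Local Notation curve := (curve mu2 Om D).
Local Notation curve2 := (curve2 mu2 Om leb D).
Local Notation cdot := (curve_dot mu2 Om leb D).
Local Notation W12curve := (W12curve a b T).
Local Notation N12 := (W12norm Om).
Variable X : set E.
Hypothesis XW : X `<=` W12 Om.
Variables (S K : R -> R) (LS MK : R).
Hypotheses (SL : forall x y, `|S x - S y| <= LS * `|x - y|) (S0 : S 0 = 0).
Hypothesis aK : almost_lip K MK.
Variables (N : nat -> nat).
Hypotheses (N0 : forall n, (0 < N n)%N) (cN : dt T (N n) @[n --> \oo] --> (0 : R)).
Variables (psi : nat -> nat -> E) (psiI : E) (Psi : R -> E).
Hypothesis psi0 : forall n, psi n 0%N = psiI.
Hypothesis Xpsi : forall n k, (k <= N n)%N -> X (psi n k).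
Hypothesis LPsi : L2T T X N12 Psi.
Local Notation s n := (fun k => S \o psi n k).
Local Notation Pb n := (Psi_bar T (N n) (psi n)).
Hypothesis HS_hat : strong_cvg T (L2norm Om) (fun n => pw_affine T (N n) (s n))
  (fun t => S \o Psi t).
Hypothesis HS_bar : strong_cvg T (L2norm Om) (fun n t => S \o Pb n t) (fun t => S \o Psi t).
Hypothesis HPsi : weak_cvg T X N12 (fun n => Pb n) Psi.

Let mOm : measurable Om. Proof. exact: measurable_box. Qed.
Let finOm : (mu2 Om < +oo)%E. Proof. exact: rect_finite. Qed.
Let mD : measurable D. Proof. exact: measurable_itv. Qed.
Let finD : (leb D < +oo)%E.
Proof. by rewrite lebesgue_measure_itv /= lte_fin T0 -EFinD ltry. Qed.

Lemma Psi_W12curve : W12curve Psi. Proof. exact: (L2T_W12curve ab XW LPsi). Qed.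

Lemma Psi_bar_W12curve n : W12curve (Pb n).
Proof.
apply: W12curve_fin_valued => //; first exact: fin_valued_step.
by move=> t /(step_ae T0 (N0 n))[k [kN e _]]; rewrite /Psi_bar e; apply: XW; exact: Xpsi.
Qed.

Lemma sqint_s n k : (k <= N n)%N -> sqi (s n k).
Proof.
move=> kN; apply: (sqint_lip mOm SL S0).
by apply: (@W12_sqint R a b); apply: XW; exact: Xpsi.
Qed.

Lemma S_bar_curve2 n : curve2 (fun t => S \o Pb n t).
Proof. exact: (step_curve2 T0 (N0 n) (sqint_s (n:=n))). Qed.

Lemma S_Psi_curve2 : curve2 (fun t => S \o Psi t).
Proof. exact: (curve2_lip mOm finOm mD SL S0 (Psi_W12curve.2 None)). Qed.

Lemma S_bar_cvg : cdot (fun t => (S \o Pb n t) - (S \o Psi t))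
  (fun t => (S \o Pb n t) - (S \o Psi t)) @[n --> \oo] --> (0 : R).
Proof. exact: (strong_cvg_cdot S_bar_curve2 S_Psi_curve2 HS_bar). Qed.

Lemma S_hat_cvg : cdot (fun t => pw_affine T (N n) (s n) t - (S \o Psi t))
  (fun t => pw_affine T (N n) (s n) t - (S \o Psi t)) @[n --> \oo] --> (0 : R).
Proof.
apply: (strong_cvg_cdot _ S_Psi_curve2 HS_hat) => n.
exact: (pw_affine_curve2 T0 (N0 n) (sqint_s (n:=n))).
Qed.

Section TestFunction.
Variables (phi dphi : R -> E).
Hypothesis Wphi : W12T T X N12 phi dphi.
Hypothesis phiT : {ae mu2, forall p, Om p -> phi T p = 0}.

Lemma phi_W12curve : W12curve phi.
Proof. by have [Lu _ _ _] := Wphi; exact: (L2T_W12curve ab XW Lu). Qed.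

Lemma dphi_W12curve : W12curve dphi.
Proof. by have [_ Lu _ _] := Wphi; exact: (L2T_W12curve ab XW Lu). Qed.

Lemma diffusion_limit :
  diffT a b T K (fun t => S \o Pb n t) (Pb n) phi @[n --> \oo] -->
  diffT a b T K (fun t => S \o Psi t) Psi phi.
Proof.
exact: (diffT_cvg ab T0 XW aK S_bar_curve2 S_Psi_curve2 S_bar_cvg Psi_bar_W12curve
  phi_W12curve HPsi).
Qed.

Lemma grad_ip_integrable (w u : R -> E) : curve2 w -> W12curve u ->
  rintegrable leb D (fun t => grad_ip Om (K \o w t) (u t) (phi t)) /\
  \int[leb]_(t in D) grad_ip Om (K \o w t) (u t) (phi t) = diffT a b T K w u phi.
Proof.
move=> cw wu; have I i := diffT_integrable i aK cw.1 wu phi_W12curve.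
have e t : D t -> grad_ip Om (K \o w t) (u t) (phi t) =
  wdot mu2 Om (K \o w t) (wcomp a b (Some false) (u t)) (wcomp a b (Some false) (phi t)) +
  wdot mu2 Om (K \o w t) (wcomp a b (Some true) (u t)) (wcomp a b (Some true) (phi t)).
  move=> Dt; exact: (grad_ipE aK (curve_sqint cw.1 Dt) (wu.1 t Dt) (phi_W12curve.1 t Dt)).
split; last exact: Rint_eq.
apply: (rintegrable_eq mD _ (rintegrableD mD (I (Some false)) (I (Some true)))) => t Dt.
by rewrite e.
Qed.

Lemma increment_integrable n :
  rintegrable leb D (fun t => dot (increment T (N n) (s n) t) (phi t)).
Proof.
exact: (curve2_dot_integrable mOm finOm mD
  (increment_curve2 T0 (N0 n) (sqint_s (n:=n))) (phi_W12curve.2 None)).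
Qed.

Lemma time_limit :
  (dt T (N n))^-1 * cdot (increment T (N n) (s n)) phi @[n --> \oo] -->
  - dot (S \o psiI) (phi 0) - cdot (fun t => S \o Psi t) dphi.
Proof.
have e n : - dot (S \o psiI) (phi 0) - cdot (pw_affine T (N n) (s n)) dphi =
    (dt T (N n))^-1 * cdot (increment T (N n) (s n)) phi.
  rewrite (time_term ab T0 XW (N0 n) (sqint_s (n:=n)) Wphi) psi0.
  have sN := sqint_s (leqnn (N n)).
  have [_ _ _ [Xphi _]] := Wphi.
  have sT : sqi (phi T) by apply: (@W12_sqint R a b); apply: XW; apply: Xphi; rewrite lexx ltW.
  (* [phi T] vanishes only almost everywhere; it is exchanged under the integral for
     [0 *: phi T]. *)
  suff -> : dot (s n (N n)) (phi T) = 0 by rewrite sub0r.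
  have s0 : sqi (0 *: phi T) by exact: sqintZ.
  rewrite -[RHS](mul0r (dot (s n (N n)) (phi T))) -(dotZr mOm 0 sN sT).
  apply: (dot_ae_eq mOm sN sN sT s0); first exact: aeW.
  by apply: filterS phiT => p h Op; rewrite h // !fctE /GRing.scale /= mul0r.
apply: (cvg_ext _ e); apply: cvgB; first exact: cvg_cst.
apply: (cdot_cvg mOm finOm mD _ S_Psi_curve2 (dphi_W12curve.2 None) S_hat_cvg) => n.
exact: (pw_affine_curve2 T0 (N0 n) (sqint_s (n:=n))).
Qed.

Variable f : R -> E.
Hypothesis cf : CT T (L2 Om) (L2norm Om) f.

Lemma source_integrable n : rintegrable leb D (fun t => dot (sampled T f (N n) t) (phi t)).
Proof.
exact: (curve2_dot_integrable mOm finOm mD (sampled_curve2 T0 cf (N0 n)) (phi_W12curve.2 None)).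
Qed.

Lemma source_limit : cdot (sampled T f (N n)) phi @[n --> \oo] --> cdot f phi.
Proof.
apply: (cdot_cvg mOm finOm mD _ (CT_curve2 T0 cf) (phi_W12curve.2 None) (sampled_cvg T0 cf N0 cN)) => n.
exact: sampled_curve2.
Qed.

End TestFunction.

End RegionLimits.

Section AlmostEverywhereTime.
Context {R : realType}.
Local Notation leb := (@lebesgue_measure R).

Lemma ae_leb_and (P Q : R -> Prop) : {ae leb, forall y, P y} -> {ae leb, forall y, Q y} ->
  {ae leb, forall y, P y /\ Q y}.
Proof. by move=> hP hQ; apply: (@filterS2 (measurableTypeR R)) hP hQ. Qed.

Lemma ae_leb_neq (x : R) : {ae leb, forall t, t != x}.
Proof.
exists [set x : measurableTypeR R]; split; first exact: measurable_set1.
  exact: lebesgue_measure_set1.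
by move=> t /= /negP; rewrite negbK => /eqP.
Qed.

End AlmostEverywhereTime.

(** * Assembly of the coupled weak form on the three regions *)

Unset Implicit Arguments.

Theorem theorem4p17 (R : realType) (eps kappa lambda T : R)
  (eps_gt0 : 0 < eps) (lambda_lt1 : lambda < 1) (T_gt0 : 0 < T)
  (Sm Sf Km Kf : R -> R) (f : region -> R -> R * R -> R)
  (psiI : region -> R * R -> R)
  (mS MS mK MK Mf : R) (Mpsi : region -> R)
  (Hdata : data_hyp eps T Sm Sf Km Kf f psiI mS MS mK MK Mf Mpsi)
  (N : nat -> nat) (N_gt0 : forall n, (0 < N n)%N)
  (dt_cvg0 : dt T (N n) @[n --> \oo] --> (0 : R))
  (psi : nat -> region -> nat -> R * R -> R)
  (Hpsi : forall n,
    discrete_sol eps kappa lambda T Sm Sf Km Kf f psiI (N n) (psi n))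
  (Psi : region -> R -> R * R -> R)
  (HPsi : forall rho, L2T T (VV eps rho) (Vnorm eps rho) (Psi rho))
  (HS_hat : forall rho, strong_cvg T (L2norm (Omega eps rho))
    (fun n => S_hat T Sm Sf (N n) rho (psi n rho))
    (fun t => matfrac Sm Sf rho \o Psi rho t))
  (HS_bar : forall rho, strong_cvg T (L2norm (Omega eps rho))
    (fun n => S_bar T Sm Sf (N n) rho (psi n rho))
    (fun t => matfrac Sm Sf rho \o Psi rho t))
  (HPsi_bar : forall rho, strong_cvg T (L2norm (Omega eps rho))
    (fun n => Psi_bar T (N n) (psi n rho)) (Psi rho))
  (HPsi_weak : forall rho, weak_cvg T (VV eps rho) (Vnorm eps rho)
    (fun n => Psi_bar T (N n) (psi n rho)) (Psi rho)) :
  weak_solution eps kappa lambda T Sm Sf Km Kf f psiI Psi.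
Proof.
have [Hf [mS0 HS] [mK0 HK] HI] := Hdata.
pose a (rho : region) : R := xl eps rho; pose b (rho : region) : R := xr eps rho.
have ab rho : a rho < b rho by rewrite /a /b; case: rho => /=; lra.
have XW rho : VV eps rho `<=` W12 (box (a rho) (b rho) 0 1) by move=> u [g [wu _ _] _].
pose S := matfrac Sm Sf; pose K := matfrac Km Kf.
have SL rho x y : `|S rho x - S rho y| <= MS * `|x - y|.
  have [cS _ dS] := HS rho; apply: C1_lipschitz => // z.
  by have /andP[h1 h2] := dS z; rewrite ger0_norm // (le_trans (ltW mS0)).
have S0 rho : S rho 0 = 0 by have [_ h _] := HS rho.
have aK rho : almost_lip (K rho) MK.
  by have [cK dK bK] := HK rho; exact: C1_incr_almost_lip cK (ltW mK0) dK bK.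
have psi0 rho n : psi n rho 0%N = psiI rho by have [h _] := Hpsi n.
(* Index [0] is not covered by the discrete problems; there the regularity is that of the initial
   datum. *)
have Xpsi rho n k : (k <= N n)%N -> VV eps rho (psi n rho k).
  case: k => [_|k kN]; first by rewrite psi0; have [h _] := HI rho.
  by have [_ /(_ k.+1 kN)[h _ _]] := Hpsi n.
pose Pb rho n := Psi_bar T (N n) (psi n rho).
have wPsi rho : W12curve (a rho) (b rho) T (Psi rho) := L2T_W12curve (ab rho) (XW rho) (HPsi rho).
have wPb rho n : W12curve (a rho) (b rho) T (Pb rho n) :=
  Psi_bar_W12curve T_gt0 (XW rho) N_gt0 (Xpsi rho) n.
have cPb n t : 0 < t < T -> coupled eps (fun rho => Pb rho n t).
  move=> tT; have [|k [kN e _]] := @step_ae R T T_gt0 (N n) t (N_gt0 n).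
    by rewrite /= in_itv.
  by rewrite /Pb /Psi_bar e; have [_ /(_ k.+1 kN)[_ h _]] := Hpsi n.
have trPsi rho t : 0 < t < T -> exists g, has_trace (a rho) (b rho) (Psi rho t) g.
  by move=> tT; have [[/(_ t tT)[g tg _] _] _] := HPsi rho; exists g.
have Dlt t : [set` `]0%R, T[] t -> 0 < t < T by rewrite time_itvE.
split=> [//||phi dphi Wphi cphi phiT].
- have lim rho s s' : s = Left \/ s = Right -> s' = Left \/ s' = Right ->
      (forall n t, 0 < t < T -> same_trace (a rho) (b rho) (a Fr) (b Fr) s s' (Pb rho n t) (Pb Fr n t)) ->
      {ae @lebesgue_measure R, forall t, 0 < t < T ->
        same_trace (a rho) (b rho) (a Fr) (b Fr) s s' (Psi rho t) (Psi Fr t)}.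
    move=> hs hs' h.
    have := same_trace_limit (ab rho) (ab Fr) T_gt0 hs hs' (XW rho) (XW Fr) (wPb rho) (wPb Fr)
      (wPsi rho) (wPsi Fr) (HPsi_weak rho) (HPsi_weak Fr).
    move=> H; have {}H := H (fun n t Dt => h n t (Dlt t Dt))
      (fun t Dt => trPsi rho t (Dlt t Dt))
      (fun t Dt => trPsi Fr t (Dlt t Dt)).
    by apply: ae_leb_imply H => t + tT; apply; rewrite time_itvE.
  have h1 := lim M1 Right Left (or_intror erefl) (or_introl erefl) (fun n t tT => (cPb n t tT).1).
  have h2 := lim M2 Left Right (or_introl erefl) (or_intror erefl) (fun n t tT => (cPb n t tT).2).
  (* The coupling is asked on the closed interval, whereas the limit argument works on the open one;
     the end points form a null set. *)
  have n0 := ae_leb_neq (0 : R); have nT := ae_leb_neq T.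
  apply: (ae_leb_imply _ (ae_leb_and (ae_leb_and h1 h2) (ae_leb_and n0 nT))) => t.
  move=> [[k1 k2] [t0 tT]] /andP[t0' tT'].
  have tT2 : 0 < t < T by rewrite !lt_neqAle eq_sym t0 t0' tT tT'.
  by split; [exact: k1|exact: k2].
have cf rho : CT T (L2 (box (a rho) (b rho) 0 1)) (L2norm (box (a rho) (b rho) 0 1)) (f rho) := (Hf rho).1.
pose mu2 := ((@lebesgue_measure R) \x (@lebesgue_measure R))%E.
pose Om rho := box (a rho) (b rho) 0 1.
pose D : set (measurableTypeR R) := [set` `]0, T[].
have mD : measurable D by exact: measurable_itv.
pose s rho n k := S rho \o psi n rho k.
pose dS rho n t := L2dot mu2 (Om rho) (increment T (N n) (s rho n) t) (phi rho t).
pose A rho n t := grad_ip (Om rho) (K rho \o (S rho \o Pb rho n t)) (Pb rho n t) (phi rho t).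
pose B rho n t := L2dot mu2 (Om rho) (sampled T (f rho) (N n) t) (phi rho t).
have IdS rho n : rintegrable lebesgue_measure D (dS rho n) :=
  increment_integrable (ab rho) T_gt0 (XW rho) (SL rho) (S0 rho) N_gt0 (Xpsi rho) (Wphi rho) n.
have cSb rho n := S_bar_curve2 T_gt0 (XW rho) (SL rho) (S0 rho) N_gt0 (Xpsi rho) n.
have cSP rho := S_Psi_curve2 (ab rho) (XW rho) (SL rho) (S0 rho) (HPsi rho).
have IA rho n := grad_ip_integrable (ab rho) (XW rho) (aK rho) (Wphi rho) (cSb rho n) (wPb rho n).
have IAP rho := grad_ip_integrable (ab rho) (XW rho) (aK rho) (Wphi rho) (cSP rho) (wPsi rho).
have IB rho n : rintegrable lebesgue_measure D (B rho n) :=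
  source_integrable (ab rho) T_gt0 (XW rho) N_gt0 (Wphi rho) (cf rho) n.
(* The test functions are coupled for almost every [t] only, so [phi t] is admissible in the
   discrete problem only almost everywhere. *)
have bal n : {ae @lebesgue_measure R, forall t, D t ->
    dS M1 n t + dS M2 n t + eps `^ kappa * dS Fr n t + dt T (N n) * (A M1 n t + A M2 n t)
      + eps `^ lambda * dt T (N n) * A Fr n t
    = dt T (N n) * (B M1 n t + B M2 n t) + dt T (N n) * B Fr n t}.
  apply: ae_leb_imply cphi => t ct Dt.
  have tT : 0 < t < T by rewrite -time_itvE.
  have [k [kN e _]] := step_ae T_gt0 (N_gt0 n) Dt.
  have Vphi rho : VV eps rho (phi rho t) by have [[[h _] _] _ _ _] := Wphi rho; exact: h.
  have ctt : coupled eps (phi ^~ t) by apply: ct; case/andP: tT => /ltW -> /ltW ->.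
  have [_ /(_ k.+1 kN)[_ _ /(_ _ Vphi ctt)]] := Hpsi n.
  by rewrite /dS /A /B /increment /Pb /Psi_bar /sampled e.
have eqn n := Rint_balance mD (IdS M1 n) (IdS M2 n) (IdS Fr n) (IA M1 n).1 (IA M2 n).1 (IA Fr n).1
  (IB M1 n) (IB M2 n) (IB Fr n) (bal n).
have limS rho := time_limit (ab rho) T_gt0 (XW rho) (SL rho) (S0 rho) N_gt0 (psi0 rho) (Xpsi rho)
  (HPsi rho) (HS_hat rho) (Wphi rho) (phiT rho).
have limA rho := diffusion_limit (ab rho) T_gt0 (XW rho) (SL rho) (S0 rho) (aK rho) N_gt0 (Xpsi rho)
  (HPsi rho) (HS_bar rho) (HPsi_weak rho) (Wphi rho).
have limB rho := source_limit (ab rho) T_gt0 (XW rho) N_gt0 dt_cvg0 (Wphi rho) (cf rho).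
have limA' rho : \int[lebesgue_measure]_(t in D) A rho n t @[n --> \oo] -->
    \int[lebesgue_measure]_(t in D) grad_ip (Om rho) (K rho \o (S rho \o Psi rho t)) (Psi rho t) (phi rho t).
  have alg (x y : nat -> R) (p q : R) : x n @[n --> \oo] --> p -> (forall n, y n = x n) ->
      q = p -> y n @[n --> \oo] --> q by move=> cx /funext -> ->.
  exact: (alg _ _ _ _ (limA rho) (fun n => (IA rho n).2) (IAP rho).2).
have := balance_limit (fun n => dt_gt0 T_gt0 (N_gt0 n)) (limS M1) (limS M2) (limS Fr)
  (limA' M1) (limA' M2) (limA' Fr) (limB M1) (limB M2) (limB Fr) eqn.
have alg (k l x1 x2 x3 y1 y2 y3 z1 z2 z3 w1 w2 w3 : R) :
    (- x1 - y1) + (- x2 - y2) + k * (- x3 - y3) + (z1 + z2) + l * z3 = w1 + w2 + w3 ->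
    - (y1 + y2) - k * y3 + (z1 + z2) + l * z3 = w1 + w2 + w3 + (x1 + x2) + k * x3.
  by move=> <-; ring.
exact: alg.
Qed.
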